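(* Assume (S1), (S2), (S3) as stated in the context, assume moreover that $U$ is a Polish space, and let $\bar u(\cdot)\in\mathcal U_{ad}$ be a minimizer of $J(\cdot)$ over $\mathcal U_{ad}$. Let $\bar x(\cdot)=x(\cdot;\bar u(\cdot))$, and let $\bar\psi(\cdot)$, $\bar W(\cdot)$ and $\bar U(t)$ be defined from $\bar u(\cdot)$ as in the context. Then for almost all $t\in[0,T]$ it holds that $$\Big\langle \bar W(t)\big(f(t,\bar x(t),\bar u(t))-f(t,\bar x(t),v)\big)+H_x(t,\bar x(t),\bar u(t),\bar\psi(t))-H_x(t,\bar x(t),v,\bar\psi(t)),\ f(t,\bar x(t),\bar u(t))-f(t,\bar x(t),v)\Big\rangle\le 0\qquad\text{for all } v\in\bar U(t).$$
   Context: Setting. Let $T>0$, $n\ge 1$, $x_0\in\mathbb R^n$, let $(U,\rho)$ be a metric space, and let $f^0:[0,T]\times\mathbb R^n\times U\to\mathbb R$, $f=(f^1,\dots,f^n)^\top:[0,T]\times\mathbb R^n\times U\to\mathbb R^n$, $\mathbf f=(f^0,f^1,\dots,f^n)^\top$. Let $\mathcal U_{ad}=\{v:[0,T]\to U \mid v(\cdot)\text{ measurable}\}$. For $u(\cdot)\in\mathcal U_{ad}$, $x(\cdot;u(\cdot))$ is the solution of $\dot x(t)=f(t,x(t),u(t))$ in $[0,T]$, $x(0)=x_0$, and $J(u(\cdot))=\int_0^T f^0(t,x(t;u(\cdot)),u(t))\,dt$. A Polish space is a separable completely metrizable topological space. Assumptions. (S1) $(U,\rho)$ is separable. (S2) $\mathbf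 f$ is measurable in $t$, continuous in $(x,u)$ and continuously differentiable in $x$; moreover there is a constant $L>0$ such that $|\mathbf f(t,x,u)-\mathbf f(t,\hat x,u)|\le L|x-\hat x|$ and $|\mathbf f(t,0,u)|\le L$ for all $(t,x,\hat x,u)\in[0,T]\times\mathbb R^n\times\mathbb R^n\times U$. (S3) $\mathbf f$ is twice continuously differentiable in $x$ and, with the same $L$, $|\mathbf f_x(t,x,u)-\mathbf f_x(t,\hat x,u)|\le L|x-\hat x|$ for all $(t,x,\hat x,u)\in[0,T]\times\mathbb R^n\times\mathbb R^n\times U$. Notation. $f_x(t,x,u)$ denotes the TRANSPOSE of the Jacobian matrix of $f$ with respect to $x$ (its $(i,j)$ entry is $\partial f^j/\partial x_i$); $f^k_x$ is the gradient (column vector) and $f^k_{xx}$ the Hessian matrix of $f^k$ in $x$. The Hamiltonian is $H(t,x,u,\psi)=\langle f(t,x,u),\psi\rangle-f^0(t,x,u)$ for $(t,x,u,\psi)\in[0,T]\times\mathbb R^n\times U\times\mathbb R^n$, with gradient $H_x$ and Hessian $H_{xx}$ in $x$. Objects associated with $\bar u(\cdot)$ (with $\bar x(\cdot)=x(\cdot;\bar u(\cdot))$): - $\bar\psi:[0,T]\to\mathbb R^n$ solves $\dot{\bar\psi}(t)=-f_x(t,\bar x(t),\bar u(t))\bar\psi(t)+f^0_x(t,\bar x(t),\bar u(t))$ in $[0,T]$, $\bar\psi(T)=0$. - $\bar W:[0,T]\to\mathbb R^{n\times n}$ solves $\dot{\bar W}(t)+f_x(t,\bar x(t),\bar u(t))\bar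 W(t)+\bar W(t)f_x(t,\bar x(t),\bar u(t))^\top+H_{xx}(t,\bar x(t),\bar u(t),\bar\psi(t))=0$ in $[0,T]$, $\bar W(T)=0$. - $\bar U(t)=\{w\in U\mid H(t,\bar x(t),w,\bar\psi(t))=\max_{v\in U}H(t,\bar x(t),v,\bar\psi(t))\}$. Differential equations are understood in the Carathéodory sense (absolutely continuous solutions, equality a.e.). *)

(* Defs.v *)
From HB Require Import structures.
From mathcomp Require Import all_boot all_order all_algebra.
From mathcomp Require Import all_classical all_reals all_analysis.

Set Implicit Arguments.
Unset Strict Implicit.
Unset Printing Implicit Defensive.

Import Order.TTheory GRing.Theory Num.Theory.
Import numFieldNormedType.Exports.

Local Open Scope classical_set_scope.
Local Open Scope ring_scope.

Section LinearAlgebra.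
Context {R : realType}.

Definition dotp n (a b : 'cV[R]_n) : R := \sum_(i < n) a i 0 * b i 0.

(* The library norm on matrices is the sup norm. This one is the Euclidean norm
   on column vectors and the Frobenius norm on matrices. *)
Definition enorm m n (M : 'M[R]_(m, n)) : R :=
  Num.sqrt (\sum_(i < m) \sum_(j < n) M i j ^+ 2).

End LinearAlgebra.

Section Calculus.
Context {R : realType}.

Definition partial n (i : 'I_n) (g : 'cV[R]_n -> R) (x : 'cV[R]_n) : R :=
  'D_(delta_mx i 0) g x.

Definition gradient n (g : 'cV[R]_n -> R) (x : 'cV[R]_n) : 'cV[R]_n :=
  \col_(i < n) partial i g x.

Definition hessian n (g : 'cV[R]_n -> R) (x : 'cV[R]_n) : 'M[R]_n :=
  \matrix_(i < n, j < n) partial i (partial j g) x.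

(* The transpose of the Jacobian matrix: column j is the gradient of the j-th
   component of g. *)
Definition jacobianT n m (g : 'cV[R]_n -> 'cV[R]_m) (x : 'cV[R]_n) :
    'M[R]_(n, m) :=
  \matrix_(i < n, j < m) partial i (fun y => g y j 0) x.

Definition class_C1 n m (g : 'cV[R]_n -> 'cV[R]_m) : Prop :=
  (forall x, differentiable g x) /\ continuous (jacobianT g).

Definition class_C2 n m (g : 'cV[R]_n -> 'cV[R]_m) : Prop :=
  [/\ class_C1 g,
      (forall x, differentiable (jacobianT g) x) &
      forall k : 'I_m, continuous (hessian (fun y => g y k 0))].

End Calculus.

Section Topology.
Context {R : realType}.

Definition separable (X : topologicalType) : Prop :=
  exists2 S : set X, countable S & dense S.

Definition is_metric (X : Type) (d : X -> X -> R) : Prop :=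
  [/\ (forall x y, 0 <= d x y),
      (forall x y, d x y = 0 <-> x = y),
      (forall x y, d x y = d y x) &
      (forall x y z, d x z <= d x y + d y z)].

Definition metric_induces_topology (X : topologicalType) (d : X -> X -> R) :
    Prop :=
  forall (x : X) (A : set X),
    nbhs x A <-> exists2 e : R, 0 < e & [set y | d x y < e] `<=` A.

Definition metric_complete (X : topologicalType) (d : X -> X -> R) : Prop :=
  forall s : nat -> X,
    (forall e : R, 0 < e ->
       exists N, forall p q, (N <= p)%N -> (N <= q)%N -> d (s p) (s q) < e) ->
    exists l : X, s @ \oo --> l.

(* The complete metric need not be the one X may already be equipped with. *)
Definition completely_metrizable (X : topologicalType) : Prop :=
  exists d : X -> X -> R,
    [/\ is_metric d, metric_induces_topology d & metric_complete d].

Definition polish (X : topologicalType) : Prop :=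
  separable X /\ completely_metrizable X.

End Topology.

Section Measurability.
Context {R : realType}.

(* The Caratheodory sigma-algebra, on which completed_lebesgue_measure is
   defined; the default measurable structure on R is the Borel one. *)
Definition lebesgue_measurable : set (set R) :=
  ((@wlength R idfun)^*%mu).-cara.-measurable.

(* X carries its Borel sigma-algebra. measurable_fun is not applicable here: it
   needs X to be canonically pointed. *)
Definition lebesgue_measurable_fun (X : topologicalType) (D : set R)
    (g : R -> X) : Prop :=
  forall B : set X, <<s @open X >> B -> lebesgue_measurable (D `&` g @^-1` B).

Definition absolutely_continuous (W : normedModType R) (a b : R) (y : R -> W) :
    Prop :=
  forall e : R, 0 < e -> exists2 d : R, 0 < d &
    forall (N : nat) (s t : 'I_N -> R),
      (forall i, [/\ a <= s i, s i <= t i & t i <= b]) ->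
      trivIset setT (fun i => `]s i, t i[%classic) ->
      \sum_(i < N) (t i - s i) < d ->
      \sum_(i < N) `|y (t i) - y (s i)| < e.

(* Functions on [0, T] are total functions on R whose values outside [0, T] are
   irrelevant, hence the derivative is only taken at interior points. *)
Definition caratheodory_solution (T : R) (W : normedModType R)
    (rhs : R -> W -> W) (y : R -> W) : Prop :=
  absolutely_continuous 0 T y /\
  {ae completed_lebesgue_measure, forall t : R, 0 < t < T ->
    is_derive t (1 : R) y (rhs t (y t))}.

End Measurability.

Section ControlProblem.
Context {R : realType} {U : metricType R}.
Variables (T : R) (n : nat) (x0 : 'cV[R]_n).
Variables (f0 : R -> 'cV[R]_n -> U -> R) (f : R -> 'cV[R]_n -> U -> 'cV[R]_n).

Definition bold_f (t : R) (x : 'cV[R]_n) (u : U) : 'cV[R]_(1 + n) :=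
  col_mx (f0 t x u)%:M (f t x u).

Definition bold_f_x (t : R) (x : 'cV[R]_n) (u : U) : 'M[R]_(n, 1 + n) :=
  jacobianT (fun y => bold_f t y u) x.

Definition assumption_S1 : Prop := separable U.

Definition assumption_S2 (L : R) : Prop :=
  [/\ (forall x u, lebesgue_measurable_fun `[0, T]%classic (fun t => bold_f t x u)),
      (forall t, t \in `[0, T] ->
         continuous (fun p : 'cV[R]_n * U => bold_f t p.1 p.2)),
      (forall t u, t \in `[0, T] -> class_C1 (fun x => bold_f t x u)),
      (forall t x x' u, t \in `[0, T] ->
         enorm (bold_f t x u - bold_f t x' u) <= L * enorm (x - x')) &
      (forall t u, t \in `[0, T] -> enorm (bold_f t 0 u) <= L)].

Definition assumption_S3 (L : R) : Prop :=
  (forall t u, t \in `[0, T] -> class_C2 (fun x => bold_f t x u)) /\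
  (forall t x x' u, t \in `[0, T] ->
     enorm (bold_f_x t x u - bold_f_x t x' u) <= L * enorm (x - x')).

Definition f_x (t : R) (x : 'cV[R]_n) (u : U) : 'M[R]_n :=
  jacobianT (fun y => f t y u) x.

Definition f0_x (t : R) (x : 'cV[R]_n) (u : U) : 'cV[R]_n :=
  gradient (fun y => f0 t y u) x.

Definition H (t : R) (x : 'cV[R]_n) (u : U) (psi : 'cV[R]_n) : R :=
  dotp (f t x u) psi - f0 t x u.

Definition H_x (t : R) (x : 'cV[R]_n) (u : U) (psi : 'cV[R]_n) : 'cV[R]_n :=
  gradient (fun y => H t y u psi) x.

Definition H_xx (t : R) (x : 'cV[R]_n) (u : U) (psi : 'cV[R]_n) : 'M[R]_n :=
  hessian (fun y => H t y u psi) x.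

Definition U_ad : set (R -> U) := [set v | lebesgue_measurable_fun `[0, T]%classic v].

Definition is_state (u : R -> U) (x : R -> 'cV[R]_n) : Prop :=
  caratheodory_solution T (fun t y => f t y (u t)) x /\ x 0 = x0.

Definition cost (u : R -> U) (x : R -> 'cV[R]_n) : R :=
  \int[completed_lebesgue_measure]_(t in `[0, T]%classic) f0 t (x t) (u t).

(* J(u) is the cost of (u, x) for the state x of u. Under S2 the state exists and
   is unique on [0, T], so quantifying over all states of u and v compares
   J(u) and J(v). *)
Definition is_minimizer (u : R -> U) : Prop :=
  U_ad u /\
  forall v x y, U_ad v -> is_state u x -> is_state v y -> cost u x <= cost v y.

Definition is_adjoint (u : R -> U) (x psi : R -> 'cV[R]_n) : Prop :=
  caratheodory_solution T
    (fun t p => - (f_x t (x t) (u t) *m p) + f0_x t (x t) (u t)) psi /\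
  psi T = 0.

Definition is_second_adjoint (u : R -> U) (x psi : R -> 'cV[R]_n)
    (W : R -> 'M[R]_n) : Prop :=
  caratheodory_solution T
    (fun t M => - (f_x t (x t) (u t) *m M + M *m (f_x t (x t) (u t))^T
                   + H_xx t (x t) (u t) (psi t))) W /\
  W T = 0.

Definition Ubar (x psi : R -> 'cV[R]_n) (t : R) : set U :=
  [set w | forall v : U, H t (x t) v (psi t) <= H t (x t) w (psi t)].

End ControlProblem.

(* Main.v *)
(** A control value [v] in [Ubar t] that violates the inequality at [t] gains
nothing at first order but gains at second order.  Suppose that this happens on
a set of positive measure.  Sorting the bad points by a rational approximation
[a] of [f t xbar v - f t xbar ubar] and by the size [c] of the violation, and
replacing [v] by a nearby element of a countable dense subset of [U], one of
countably many cells has positive measure.  Let [A] be the part of such a cell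
in a short interval of length [h], and let [z] be the variation of the state
when the control is changed on [A].  The function
[<psibar, z> + <Wbar z, z> / 2 - (running cost difference)] vanishes at [0],
equals [J ubar - J v <= 0] at [T], and its derivative is the sum of a Taylor
remainder [o(|z|^2)] and, on [A], of a term at least
[c / 2 * |A n [0, t]|] up to small errors, because [z] is close to
[|A n [0, t]| a] there.  Integrating gives [c / 4 * |A|^2 <= o(|A|^2)] as [h]
tends to [0], a contradiction.  Working on [A] with a fixed direction [a] avoids
any density-point argument. *)

Require Import Defs.
From HB Require Import structures.
From mathcomp Require Import all_boot all_order all_algebra.
From mathcomp Require Import all_classical all_reals all_analysis.
From mathcomp Require Import measurable_realfun ring lra.

Set Implicit Arguments.
Unset Strict Implicit.
Unset Printing Implicit Defensive.

Import Order.TTheory GRing.Theory Num.Theory.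
Import numFieldNormedType.Exports.

Local Open Scope classical_set_scope.
Local Open Scope ring_scope.

(** * Absolutely continuous functions *)

(** Two obstacles shape the argument. The second order Taylor remainder is small only below a
    threshold for [z] that depends on [t]. It is therefore divided by [|A|^2]: Lipschitz gradients
    bound the quotient by a constant, it tends to 0 pointwise, and dominated convergence makes its
    integral vanish. Off [A] the remaining error must be cubic in [z], because it acts on all of
    [[0, T]]; on [A] a quadratic one is enough, since the measure of [A] supplies the third factor.
    The second obstacle is a first order loss, because members of the dense sequence only almost
    maximize the Hamiltonian. The tolerance is fixed after [A], below [h |A|], so the points of a
    cell must allow every tolerance; taking the least admissible index keeps the new control
    measurable. Differential inequalities are integrated through monotonicity: an absolutely
    continuous function with nonnegative derivative almost everywhere is nondecreasing. Gronwall's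
    bound, Picard's contraction and the final comparison apply this to suitable auxiliary
    functions. *)

Section Comparison.
Context {R : realType}.
Implicit Types (O : set R) (y : R -> R).

(** Comparison with [g t] on both sides of [t] stands in for continuity. Its left half puts the
    supremum of the points with [g a <= g t] into that set; its right half forbids this supremum to
    lie before [b]. *)
Lemma locally_nondecreasing_le (g : R -> R) (a b : R) : a <= b ->
  (forall t, a <= t <= b -> exists2 d : R, 0 < d &
     forall s, a <= s <= b -> `|s - t| < d ->
       (s <= t -> g s <= g t) /\ (t <= s -> g t <= g s)) ->
  g a <= g b.
Proof.
move=> ab loc; pose S := [set t | a <= t <= b /\ g a <= g t].
have Sa : S a by split; rewrite ?lexx.
have hS : has_sup S by split; [exists a | exists b => t [/andP[]]].
have ac : a <= sup S by apply: sup_upper_bound.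
have cb : sup S <= b by apply: ge_sup; [exists a | move=> t [/andP[]]].
have [d d0 Hd] := loc (sup S) (introT andP (conj ac cb)).
have Sc : g a <= g (sup S).
  have [t [/andP[at_ tb] gt] tc] := sup_adherent d0 hS.
  have tS : t <= sup S by apply: sup_upper_bound => //; split => //; rewrite at_.
  apply: (le_trans gt); apply: (Hd t _ _).1 => //; first by rewrite at_.
  by rewrite ler0_norm ?subr_le0// opprB ltrBlDr -ltrBlDl.
move: cb; rewrite le_eqVlt => /orP[/eqP <-//|cb].
pose s := Num.min (sup S + d / 2) b.
have cs : sup S < s by rewrite lt_min cb andbT ltrDl divr_gt0.
have sb : s <= b by rewrite ge_min lexx orbT.
have as_ : a <= s by rewrite (le_trans ac)// ltW.
have : S s.
  split; first by rewrite as_.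
  apply: (le_trans Sc); apply: (Hd s _ _).2; rewrite ?as_ ?(ltW cs)//.
  rewrite gtr0_norm ?subr_gt0// ltrBlDl (@le_lt_trans _ _ (sup S + d / 2))//.
    by rewrite ge_min lexx.
  by rewrite ltrD2l ltr_pdivrMr// mulr_natr mulr2n ltrDl.
by move/(sup_upper_bound hS); rewrite leNgt cs.
Qed.

(** Ordered lists of adjacent or separated intervals inside [O]: a recursive encoding that makes
    appending an interval easy. [ac_chain] converts it into the disjoint families of
    [absolutely_continuous]. *)
Fixpoint interval_chain O (a : R) (l : seq (R * R)) (b : R) : Prop :=
  if l is p :: l' then
    [/\ a <= p.1, p.1 <= p.2, `[p.1, p.2] `<=` O & interval_chain O p.2 l' b]
  else a <= b.

Lemma interval_chain_widen O a l b b' :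
  interval_chain O a l b -> b <= b' -> interval_chain O a l b'.
Proof.
move=> + bb'; elim: l a => [|p l IH] a /=; first by move/le_trans; apply.
by case=> ap pp pO /IH.
Qed.

Lemma interval_chain_rcons O a l b b' : interval_chain O a l b -> b <= b' ->
  `[b, b'] `<=` O -> interval_chain O a (rcons l (b, b')) b'.
Proof.
move=> + bb' bO; elim: l a => [|p l IH] a /=; first by move=> ab; split.
by case=> ap pp pO /IH.
Qed.

Lemma interval_chain_nth O a l b : interval_chain O a l b ->
  a <= b /\ forall i, (i < size l)%N ->
  [/\ a <= (nth (0, 0) l i).1, (nth (0, 0) l i).1 <= (nth (0, 0) l i).2,
      (nth (0, 0) l i).2 <= b &
      forall j, (i < j < size l)%N ->
        (nth (0, 0) l i).2 <= (nth (0, 0) l j).1].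
Proof.
elim: l a => [|p l IH] a //=; case=> ap pp pO /IH[pb Hl].
split; first by rewrite (le_trans ap)// (le_trans pp).
case=> [_|i] /=.
  split => // -[|j]//=; rewrite ltnS => /Hl[].
  by [].
rewrite ltnS => /Hl[h1 h2 h3 h4]; split => //.
  by rewrite (le_trans ap)// (le_trans pp).
by case=> [|j]//=; rewrite !ltnS; exact: h4.
Qed.

Lemma interval_chain_length O (a : R) l b : open O -> interval_chain O a l b ->
  ((\sum_(p <- l) (p.2 - p.1))%:E <= lebesgue_measure (O `&` `[a, b]))%E.
Proof.
move=> oO; have mO : measurable O by exact: open_measurable.
elim: l a => [|p l IH] a /=; first by rewrite big_nil.
case=> ap pp pO ch; have [pb _] := interval_chain_nth ch.
rewrite big_cons EFinD.
(* The interval is half-open because consecutive intervals of a chain may share an endpoint. *)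
have disj : `[p.1, p.2[ `&` (O `&` `[p.2, b]) = set0.
  rewrite -subset0 => x [/=]; rewrite !in_itv/= => /andP[_ xp] [_ /andP[px _]].
  by move: (lt_le_trans xp px); rewrite ltxx.
apply: (@le_trans _ _ (lebesgue_measure (`[p.1, p.2[ `|` (O `&` `[p.2, b])))).
  rewrite measureU//; last exact: measurableI.
  apply: leeD; last exact: IH.
  apply: (@le_trans _ _ (lebesgue_measure `[p.1, p.2[%classic)) => //.
  by rewrite lebesgue_measure_itv/= lte_fin; case: ltP => //= ?; rewrite lee_fin subr_le0.
apply: le_measure; rewrite ?inE.
- by apply: measurableU => //; exact: measurableI.
- exact: measurableI.
move=> x [] /=; rewrite !in_itv/=.
- move=> /andP[px xp]; split.
    by apply: pO; rewrite /= in_itv/= px ltW.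
  by rewrite (le_trans ap px) (le_trans (ltW xp) pb).
- move=> [Ox /andP[px ->]]; split => //.
  by rewrite (le_trans ap)// (le_trans pp).
Qed.

Lemma negligible_open_cover (N : set R) (e : R) : 0 < e ->
  completed_lebesgue_measure.-negligible N ->
  exists O, [/\ open O, N `<=` O & (lebesgue_measure O <= e%:E)%E].
Proof.
move=> e0 [A [mA A0 NA]].
have [V [oV NV mV]] := @outer_measure_open_le R N e e0.
exists V; split => //; rewrite (le_trans mV)// -[leRHS]add0e leeD2r//.
by rewrite -A0; exact: le_outer_measure.
Qed.

Lemma negligible_set1_completed (a : R) :
  completed_lebesgue_measure.-negligible [set a].
Proof.
exists [set a]; split => //; first by apply: sub_caratheodory; exact: measurable_set1.
have := @lebesgue_measure_set1 R a; exact.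
Qed.

(** A chain inside [O] is no longer than the measure of [O], so absolute continuity controls all
    such chains at once. Halving [d] turns the non-strict bound on the measure into a strict one. *)
Lemma ac_chain y (a b e : R) : 0 < e -> absolutely_continuous a b y ->
  exists2 d : R, 0 < d & forall O l, interval_chain O a l b -> open O ->
    (lebesgue_measure O <= (d / 2)%:E)%E ->
    \sum_(p <- l) `|y p.2 - y p.1| <= e.
Proof.
move=> e0 /(_ e e0)[d d0 Hd]; exists d => // O l ch oO mO.
have [ab Hl] := interval_chain_nth ch.
have Hl' (i : 'I_(size l)) := Hl i (ltn_ord i).
have := Hd (size l) (fun i => (nth (0, 0) l i).1) (fun i => (nth (0, 0) l i).2).
rewrite -(big_mkord xpredT (fun i => (nth (0, 0) l i).2 - (nth (0, 0) l i).1)).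
rewrite -(big_mkord xpredT (fun i => `|y (nth (0, 0) l i).2 - y (nth (0, 0) l i).1|)).
rewrite -(big_nth (0, 0) xpredT (fun p => `|y p.2 - y p.1|)).
rewrite -(big_nth (0, 0) xpredT (fun p => p.2 - p.1)) => H.
apply: ltW; apply: H.
- by move=> i; have [] := Hl' i.
- apply/trivIsetP => i j _ _ ij.
  wlog {ij} ij : i j / (i < j)%N.
    move: ij; rewrite -(inj_eq val_inj)/= neq_ltn => /orP[ij /(_ _ _ ij)//|ij].
    by rewrite setIC => /(_ _ _ ij).
  rewrite -subset0 => x [/=]; rewrite !in_itv/= => /andP[_ xi] /andP[xj _].
  have [_ _ _ /(_ j)] := Hl' i; rewrite ij ltn_ord => /(_ isT).
  by move=> /(lt_le_trans xi)/lt_trans/(_ xj); rewrite ltxx.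
- rewrite -lte_fin (@le_lt_trans _ _ (d / 2)%:E)//.
    apply: le_trans (interval_chain_length oO ch) _.
    apply: le_trans _ mO; apply: le_measure; rewrite ?inE.
    + by apply: measurableI => //; exact: open_measurable.
    + exact: open_measurable.
    + exact: subIsetl.
  by rewrite lte_fin ltr_pdivrMr// mulr_natr mulr2n ltrDl.
Qed.

(** Near [t] the difference quotients exceed [- e], and the added slope [e] compensates. The
    conclusion has the form asked for by [locally_nondecreasing_le]. *)
Lemma is_derive_lower y (t l e : R) : is_derive t (1 : R) y l -> 0 <= l -> 0 < e ->
  exists2 d : R, 0 < d & forall s, `|s - t| < d ->
    (s <= t -> y s + e * s <= y t + e * t) /\
    (t <= s -> y t + e * t <= y s + e * s).
Proof.
move=> [dy <-] l0 e0.
move/cvgrPdist_lt : dy => /(_ _ e0); rewrite /=.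
rewrite near_withinE => -[d /= d0 Hd]; exists d => // s std.
have [->|st] := eqVneq s t; first by split.
have := Hd (s - t); rewrite /ball_ /= sub0r normrN => /(_ std).
rewrite subr_eq0 => /(_ st).
rewrite scaler1 addrNK -/('D_1 y t).
rewrite ltr_distlC => /andP[+ _].
have {l0} : 0 <= 'D_1 y t by [].
set D := 'D_1 y t => l0 H.
have {}H : - e < (s - t)^-1 * (y s - y t) by rewrite (le_lt_trans _ H)// lerBrDl addrN.
split=> ts.
- have st0 : s - t < 0 by rewrite subr_lt0 lt_neqAle st.
  by move: H; rewrite mulrC ltr_ndivlMr//; lra.
- have st0 : 0 < s - t by rewrite subr_gt0 lt_neqAle eq_sym st.
  by move: H; rewrite mulrC ltr_pdivlMr//; lra.
Qed.

Lemma ac_sub (W : normedModType R) (a b a' b' : R) (y : R -> W) :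
  a <= a' -> b' <= b -> absolutely_continuous a b y ->
  absolutely_continuous a' b' y.
Proof.
move=> aa bb H e /H[d d0 Hd]; exists d => // N s t st; apply: Hd => i.
by have [h1 h2 h3] := st i; split => //; [exact: le_trans aa h1 | exact: le_trans h3 bb].
Qed.

(* The bad points lie in an open set of small measure; adding to y the variation
   of y along that set makes y (plus a small slope) locally nondecreasing. *)
Theorem ac_nondecreasing (y : R -> R) (a b : R) : a <= b ->
  absolutely_continuous a b y ->
  {ae completed_lebesgue_measure, forall t, a < t < b ->
    exists2 l, 0 <= l & is_derive t (1 : R) y l} ->
  y a <= y b.
Proof.
move=> ab acy aey; apply/ler_addgt0Pr => e0 e0_gt0.
(* The total loss is [e * (b - a)] from the added slope and at most [e] from the added variation. *)
pose e := e0 / (b - a + 1).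
have ba1 : 0 < b - a + 1 by rewrite ltr_wpDl// subr_ge0.
have e_gt0 : 0 < e by rewrite divr_gt0.
have [d d_gt0 Hd] := ac_chain e_gt0 acy.
pose N := ~` [set t | a < t < b -> exists2 l, 0 <= l & is_derive t (1 : R) y l].
(* The endpoints join the bad set because the derivative is known only at interior points. *)
have nN : completed_lebesgue_measure.-negligible (N `|` ([set a] `|` [set b])).
  apply: negligibleU => //; apply: negligibleU; exact: negligible_set1_completed.
have d2 : 0 < d / 2 by rewrite divr_gt0.
have [V [oV NV mV]] := negligible_open_cover d2 nN.
pose S t := [set (\sum_(p <- l) `|y p.2 - y p.1|)%R | l in [set l | interval_chain V a l t]].
pose v t := sup (S t).
have S0 t : a <= t -> S t 0 by move=> at_; exists [::] => //; rewrite big_nil.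
have Sub t : t <= b -> ubound (S t) e.
  move=> tb _ [l /= ch <-]; apply: (Hd V) => //; exact: interval_chain_widen ch tb.
have hS t : a <= t -> t <= b -> has_sup (S t).
  by move=> at_ tb; split; [exists 0; exact: S0 | exists e; exact: Sub].
have v_nd s t : a <= s -> s <= t -> t <= b -> v s <= v t.
  move=> as_ st tb; apply: ge_sup; first by exists 0; exact: S0.
  move=> _ [l /= ch <-]; apply: sup_upper_bound.
    by apply: hS => //; exact: le_trans st.
  by exists l => //; exact: interval_chain_widen ch st.
have v_inc s t : a <= s -> s <= t -> t <= b -> `[s, t] `<=` V ->
    v s + `|y t - y s| <= v t.
  move=> as_ st tb sV; rewrite -lerBrDr; apply: ge_sup; first by exists 0; exact: S0.
  move=> _ [l /= ch <-]; rewrite lerBrDr; apply: sup_upper_bound.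
    by apply: hS => //; exact: le_trans st.
  exists (rcons l (s, t)); first exact: interval_chain_rcons.
  by rewrite -cats1 big_cat/= big_seq1.
suff : y a + v a + e * a <= y b + v b + e * b.
  have : 0 <= v a by apply: sup_upper_bound; [exact: hS | exact: S0].
  have : v b <= e by apply: ge_sup; [exists 0; exact: S0 | exact: Sub].
  have -> : e0 = e * (b - a) + e.
    by rewrite -{2}(mulr1 e) -mulrDr /e divfK// gt_eqF.
  lra.
apply: (@locally_nondecreasing_le (fun t => y t + v t + e * t)) => // t /andP[at_ tb].
have [Vt|nVt] := pselect (V t).
  have /nbhs_ballP[r /= r0 rV] : nbhs t V by apply: open_nbhs_nbhs.
  exists r => // s /andP[as_ sb] str.
  have inV p q : `|p - t| < r -> `|q - t| < r -> `[p, q] `<=` V.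
    rewrite !ltr_distl => /andP[p1 p2] /andP[q1 q2] x /=; rewrite in_itv/= => /andP[px xq].
    by apply: rV; rewrite /ball/= distrC ltr_distl; apply/andP; split; lra.
  have tt : `|t - t| < r by rewrite subrr normr0.
  split => h.
    have := v_inc _ _ as_ h tb (inV _ _ str tt).
    have : e * s <= e * t by rewrite ler_pM2l.
    have := ler_norm (y s - y t); rewrite distrC; lra.
  have := v_inc _ _ at_ h sb (inV _ _ tt str).
  have : e * t <= e * s by rewrite ler_pM2l.
  have := ler_norm (y t - y s); rewrite distrC; lra.
have tab : a < t < b.
  by rewrite !lt_neqAle at_ tb !andbT; apply/andP; split; apply/eqP => h;
    apply: nVt; apply: NV; right; [left|right].
have [l l0 dl] : exists2 l, 0 <= l & is_derive t (1 : R) y l.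
  by apply: contrapT => h; apply: nVt; apply: NV; left => /= /(_ tab).
have [r r0 Hr] := is_derive_lower dl l0 e_gt0.
exists r => // s /andP[as_ sb] /Hr[h1 h2]; split => st.
  by have := h1 st; have := v_nd s t as_ st tb; lra.
by have := h2 st; have := v_nd t s at_ st sb; lra.
Qed.

End Comparison.

(** * Calculus with absolutely continuous functions and their derivatives *)

Section AbsoluteContinuity.
Context {R : realType}.
Implicit Types (a b T : R).

Lemma ae_imply (P Q : R -> Prop) : (forall t, P t -> Q t) ->
  {ae completed_lebesgue_measure, forall t : R, P t} ->
  {ae completed_lebesgue_measure, forall t : R, Q t}.
Proof.
by move=> PQ; apply: negligibleS => t /= nQ Pt; apply: nQ; exact: PQ.
Qed.

Lemma ae_imply2 (P Q S : R -> Prop) : (forall t, P t -> Q t -> S t) ->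
  {ae completed_lebesgue_measure, forall t : R, P t} ->
  {ae completed_lebesgue_measure, forall t : R, Q t} ->
  {ae completed_lebesgue_measure, forall t : R, S t}.
Proof.
move=> PQS nP nQ; apply: negligibleS (negligibleU nP nQ) => t /= nS.
by apply/not_andP => -[Pt Qt]; apply: nS; exact: PQS.
Qed.

Lemma mx_entry_le_norm m n (M : 'M[R]_(m, n)) i j : `|M i j| <= `|M|.
Proof.
rewrite [leRHS]/Num.Def.normr/= mx_normrE.
exact: (le_bigmax _ (fun p : 'I_m * 'I_n => `|M p.1 p.2|) (i, j)).
Qed.

Lemma mx_norm_le m n (M : 'M[R]_(m, n)) (c : R) : 0 <= c ->
  (forall i j, `|M i j| <= c) -> `|M| <= c.
Proof.
move=> c0 H; rewrite [leLHS]/Num.Def.normr/= mx_normrE (bigmax_le _ c0)//= => -[i j] _.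
Qed.

Lemma is_derive_coord m n (y : R -> 'M[R]_(m, n)) (t : R) dy i j :
  is_derive t (1 : R) y dy -> is_derive t (1 : R) (fun s => y s i j) (dy i j).
Proof.
move=> [Dy <-]; split; first by move/derivable_mxP : Dy => /(_ i j).
by rewrite derive_mx// mxE.
Qed.

Lemma is_derive_mx m n (y : R -> 'M[R]_(m, n)) (t : R) (dy : 'M[R]_(m, n)) :
  (forall i j, is_derive t (1 : R) (fun s => y s i j) (dy i j)) ->
  is_derive t (1 : R) y dy.
Proof.
move=> H; have Dy : derivable y t (1 : R) by apply/derivable_mxP => i j; have [] := H i j.
split => //; rewrite derive_mx//; apply/matrixP => i j; rewrite mxE.
by have [] := H i j.
Qed.

Lemma ac_lipschitz (W : normedModType R) a b (y : R -> W) (K : R) :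
  (forall s t, a <= s -> s <= t -> t <= b -> `|y t - y s| <= K * (t - s)) ->
  absolutely_continuous a b y.
Proof.
move=> H e e0; pose k := `|K| + 1.
have k0 : 0 < k by rewrite ltr_wpDl.
exists (e / k); first by rewrite divr_gt0.
move=> N s t st _ ltd; apply: (@le_lt_trans _ _ (\sum_(i < N) k * (t i - s i))).
  apply: ler_sum => i _; have [h1 h2 h3] := st i.
  apply: le_trans (H _ _ h1 h2 h3) _; rewrite ler_wpM2r ?subr_ge0//.
  by rewrite /k (le_trans (ler_norm K))// lerDl.
by rewrite -mulr_sumr mulrC -ltr_pdivlMr.
Qed.

Lemma ac_uniform (W : normedModType R) a b (y : R -> W) (e : R) : 0 < e ->
  absolutely_continuous a b y ->
  exists2 d : R, 0 < d & forall s t, a <= s <= b -> a <= t <= b ->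
    `|s - t| < d -> `|y s - y t| < e.
Proof.
move=> e0 /(_ e e0)[d d0 Hd]; exists d => // s t.
wlog st : s t / s <= t.
  by move=> H; have [/H//|/ltW st hs ht] := leP s t; rewrite distrC (distrC (y s)); exact: H.
move=> /andP[as_ sb] /andP[at_ tb]; rewrite distrC => std; rewrite distrC.
have := Hd 1 (fun=> s) (fun=> t); rewrite !big_ord1; apply => //.
- apply/trivIsetP => i j _ _; by rewrite (ord1 i) (ord1 j) eqxx.
- by move: std; rewrite ger0_norm ?subr_ge0.
Qed.

Lemma ac_within_continuous (W : normedModType R) a b (y : R -> W) :
  absolutely_continuous a b y -> {within `[a, b], continuous y}.
Proof.
move=> acy; apply/subspace_continuousP => x /=; rewrite in_itv/= => xab.
apply/cvgrPdist_lt => e e0; have [d d0 Hd] := ac_uniform e0 acy.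
rewrite near_withinE; exists d => //= t /= xt; rewrite in_itv/= => tab.
exact: Hd.
Qed.

Lemma ac_norm (W : normedModType R) a b (y : R -> W) :
  absolutely_continuous a b y -> absolutely_continuous a b (fun t => `|y t|).
Proof.
move=> H e /H[d d0 Hd]; exists d => // N s t h1 h2 h3.
apply: le_lt_trans (Hd N s t h1 h2 h3); apply: ler_sum => i _.
exact: ler_dist_dist.
Qed.

Lemma ac_bounded (W : normedModType R) a b (y : R -> W) :
  absolutely_continuous a b y ->
  exists2 M : R, 0 <= M & forall t, a <= t <= b -> `|y t| <= M.
Proof.
move=> /ac_norm/ac_within_continuous cy.
have [ab|ba] := leP a b; last first.
  by exists 0 => // t /andP[at_ tb]; move: (le_trans at_ tb); rewrite leNgt ba.
have [c _ Hc] := EVT_max ab cy; by exists `|y c| => // t tab; apply: Hc; rewrite in_itv.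
Qed.

Lemma ac_coord m n a b (y : R -> 'M[R]_(m, n)) i j :
  absolutely_continuous a b y -> absolutely_continuous a b (fun t => y t i j).
Proof.
move=> H e /H[d d0 Hd]; exists d => // N s t h1 h2 h3.
apply: le_lt_trans (Hd N s t h1 h2 h3); apply: ler_sum => k _.
by have := mx_entry_le_norm (y (t k) - y (s k)) i j; rewrite !mxE.
Qed.

Lemma acD a b (y z : R -> R) : absolutely_continuous a b y ->
  absolutely_continuous a b z -> absolutely_continuous a b (fun t => y t + z t).
Proof.
move=> Hy Hz e e0; have e2 : 0 < e / 2 by rewrite divr_gt0.
have [d1 d10 H1] := Hy _ e2; have [d2 d20 H2] := Hz _ e2.
exists (Num.min d1 d2); first by rewrite lt_min d10.
move=> N s t h1 h2; rewrite lt_min => /andP[h3 h4].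
rewrite [ltRHS](splitr e); apply: le_lt_trans (ltrD (H1 _ _ _ h1 h2 h3) (H2 _ _ _ h1 h2 h4)).
rewrite -big_split/=; apply: ler_sum => k _.
by rewrite opprD addrACA ler_normD.
Qed.

Lemma acB (V : normedModType R) a b (y z : R -> V) :
  absolutely_continuous a b y -> absolutely_continuous a b z ->
  absolutely_continuous a b (fun t => y t - z t).
Proof.
move=> Hy Hz e e0; have e2 : 0 < e / 2 by rewrite divr_gt0.
have [d d0 Hd] := Hy _ e2; have [d' d'0 Hd'] := Hz _ e2.
exists (Num.min d d'); first by rewrite lt_min d0.
move=> N s t h1 h2; rewrite lt_min => /andP[h3 h4].
rewrite [ltRHS](splitr e); apply: le_lt_trans (ltrD (Hd _ _ _ h1 h2 h3) (Hd' _ _ _ h1 h2 h4)).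
rewrite -big_split/=; apply: ler_sum => k _.
have -> : y (t k) - z (t k) - (y (s k) - z (s k)) = (y (t k) - y (s k)) - (z (t k) - z (s k)).
  by rewrite !opprB addrACA [RHS]addrACA; congr (_ + _); rewrite addrC.
exact: ler_normB.
Qed.

Lemma acM a b (y z : R -> R) : absolutely_continuous a b y ->
  absolutely_continuous a b z -> absolutely_continuous a b (fun t => y t * z t).
Proof.
move=> Hy Hz e e0.
have [M1 M10 B1] := ac_bounded Hy; have [M2 M20 B2] := ac_bounded Hz.
pose M := M1 + M2 + 1; have M0 : 0 < M by rewrite ltr_wpDl// addr_ge0.
have e2 : 0 < e / 2 / M by rewrite !divr_gt0.
have [d1 d10 H1] := Hy _ e2; have [d2 d20 H2] := Hz _ e2.
exists (Num.min d1 d2); first by rewrite lt_min d10.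
move=> N s t h1 h2; rewrite lt_min => /andP[h3 h4].
apply: (@le_lt_trans _ _ (M * \sum_(i < N) `|y (t i) - y (s i)| + M * \sum_(i < N) `|z (t i) - z (s i)|)).
  rewrite !mulr_sumr -big_split/=; apply: ler_sum => i _; have [k1 k2 k3] := h1 i.
  have -> : y (t i) * z (t i) - y (s i) * z (s i) =
    z (t i) * (y (t i) - y (s i)) + y (s i) * (z (t i) - z (s i)) by ring.
  apply: le_trans (ler_normD _ _) _; rewrite !normrM.
  have := B1 (s i); rewrite k1 (le_trans k2 k3) => /(_ isT) b1.
  have := B2 (t i); rewrite k3 (le_trans k1 k2) => /(_ isT) b2.
  by apply: lerD; apply: ler_wpM2r => //; rewrite /M; lra.
have := H1 _ _ _ h1 h2 h3; have := H2 _ _ _ h1 h2 h4.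
rewrite !ltr_pdivlMr// => q1 q2; rewrite ![M * _]mulrC; lra.
Qed.

(** Detaches the derivative from the equation that produced it. The relation is closed under sums
    and products, so auxiliary functions and their derivatives can be assembled term by term. *)
Definition ac_derive T (y dy : R -> R) : Prop :=
  absolutely_continuous 0 T y /\
  {ae completed_lebesgue_measure, forall t : R, 0 < t < T ->
    is_derive t (1 : R) y (dy t)}.

Lemma ac_deriveD T y z dy dz : ac_derive T y dy -> ac_derive T z dz ->
  ac_derive T (fun t => y t + z t) (fun t => dy t + dz t).
Proof.
move=> [Hy Dy] [Hz Dz]; split; first exact: acD.
apply: ae_imply2 Dy Dz => t h1 h2 /[dup] /h1 ? /h2 ?; exact: is_deriveD.
Qed.

Lemma ac_deriveM T y z dy dz : ac_derive T y dy -> ac_derive T z dz ->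
  ac_derive T (fun t => y t * z t) (fun t => dy t * z t + y t * dz t).
Proof.
move=> [Hy Dy] [Hz Dz]; split; first exact: acM.
apply: ae_imply2 Dy Dz => t h1 h2 /[dup] /h1 ? /h2 ?.
apply: is_derive_eq; by rewrite addrC /GRing.scale/= (mulrC (dy t)).
Qed.

Lemma ac_derive_smooth T (y dy : R -> R) (K : R) : (forall t : R, is_derive t (1 : R) y (dy t)) ->
  (forall t, 0 <= t <= T -> `|dy t| <= K) -> ac_derive T y dy.
Proof.
move=> Dy bK; split; last by apply: aeW => t _; exact: Dy.
apply: (@ac_lipschitz _ _ _ _ K) => s t s0 st tT.
have [c] : exists2 c, c \in `[s, t] & y t - y s = dy c * (t - s).
  apply: (@MVT_segment R y dy s t st (fun x _ => Dy x)).
  apply: continuous_subspaceT => x; apply: differentiable_continuous.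
  by apply/derivable1_diffP; have [] := Dy x.
rewrite in_itv/= => /andP[sc ct] ->; rewrite normrM (@ger0_norm _ (t - s)) ?subr_ge0//.
rewrite ler_wpM2r ?subr_ge0//; apply: bK.
by rewrite (le_trans s0 sc) (le_trans ct tT).
Qed.

Lemma ac_derive_cst T (c : R) : ac_derive T (fun=> c) (fun=> 0).
Proof.
split; last by apply: aeW => t _; exact: is_derive_cst.
by apply: (@ac_lipschitz _ _ _ _ 0) => s t _ _ _; rewrite subrr normr0 mul0r.
Qed.

Lemma ac_derive_id T : ac_derive T (fun t => t) (fun=> 1).
Proof.
split; last by apply: aeW => t _; exact: is_derive_id.
by apply: (@ac_lipschitz _ _ _ _ 1) => s t _ st _; rewrite ger0_norm ?mul1r// subr_ge0.
Qed.

Lemma ac_deriveZ T (c : R) y dy : ac_derive T y dy ->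
  ac_derive T (fun t => c * y t) (fun t => c * dy t).
Proof.
move=> /(ac_deriveM (ac_derive_cst T c)).
by under [X in ac_derive _ _ X]eq_fun do rewrite mul0r add0r.
Qed.

Lemma ac_deriveB T y z dy dz : ac_derive T y dy -> ac_derive T z dz ->
  ac_derive T (fun t => y t - z t) (fun t => dy t - dz t).
Proof.
move=> Hy /(ac_deriveZ (-1)) Hz.
have := ac_deriveD Hy Hz.
by congr ac_derive; apply/funext => t; rewrite mulN1r.
Qed.

Lemma ac_derive_sum T n (y dy : 'I_n -> R -> R) :
  (forall i, ac_derive T (y i) (dy i)) ->
  ac_derive T (fun t => \sum_(i < n) y i t) (fun t => \sum_(i < n) dy i t).
Proof.
elim: n y dy => [|n IH] y dy H.
  have := ac_derive_cst T 0.
  by congr ac_derive; apply/funext => t; rewrite big_ord0.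
have := ac_deriveD (IH (fun i => y (lift ord_max i)) (fun i => dy (lift ord_max i)) (fun i => H _)) (H ord_max).
have liftE (i : 'I_n) : lift ord_max i = widen_ord (leqnSn n) i.
  by apply/val_inj; rewrite /= /bump leqNgt ltn_ord.
by congr ac_derive; apply/funext => t; rewrite big_ord_recr/=; congr (_ + _);
  apply: eq_bigr => i _; rewrite liftE.
Qed.

(** The integration step of every later estimate: applied to a bound plus or minus a function, it
    turns an inequality between derivatives into one between increments. *)
Lemma ac_derive_nondecreasing T y dy (s t : R) : ac_derive T y dy ->
  0 <= s -> s <= t -> t <= T ->
  {ae completed_lebesgue_measure, forall r : R, s < r < t -> 0 <= dy r} ->
  y s <= y t.
Proof.
move=> [Hy Dy] s0 st tT ae0; apply: ac_nondecreasing => //.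
  exact: ac_sub Hy.
apply: ae_imply2 Dy ae0 => r h1 h2 /[dup] /h2 ? /andP[sr rt].
by exists (dy r) => //; apply: h1; rewrite (le_lt_trans s0 sr) (lt_le_trans rt tT).
Qed.

End AbsoluteContinuity.

Local Notation lebesgueT R := (caratheodory_type ((@wlength R idfun)^*)%mu).

(** * Primitives of bounded Lebesgue measurable functions *)

Section Primitive.
Context {R : realType}.
Local Notation LT := (lebesgueT R).
Local Notation mu := (@completed_lebesgue_measure R).

Lemma borel_lebesgue_measurable (A : set R) : measurable A ->
  measurable (A : set LT).
Proof. by move=> mA; apply: sub_caratheodory. Qed.

Lemma measurable_fun_lebesgue_id : measurable_fun [set: LT] (id : LT -> R).
Proof. by move=> _ A mA; rewrite setTI; exact: borel_lebesgue_measurable. Qed.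

Lemma measurable_itv_lebesgue (i : interval R) : measurable ([set` i] : set LT).
Proof. by apply: borel_lebesgue_measurable; exact: measurable_itv. Qed.

Lemma completed_measure_itv (a b : R) : a <= b ->
  mu (`[a, b]%classic : set LT) = (b - a)%:E.
Proof.
move=> ab; transitivity (@lebesgue_measure R `[a, b]%classic) => //.
rewrite lebesgue_measure_itv/= lte_fin; case: ltP => //= ba.
have -> : a = b by apply/eqP; rewrite eq_le ab ba.
by rewrite subrr.
Qed.

(** Prepares the use of [FTC1], which concerns the Borel structure. Each rational superlevel set of
    [g] is a Borel set up to a negligible one; the supremum of the levels whose Borel set contains
    [t] is [g t] outside the countable union of the exceptional sets. *)
Lemma borel_version (g : R -> R) (M : R) :
  measurable_fun [set: LT] (g : LT -> R) -> (forall t, `|g t| <= M) ->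
  exists g' : R -> R, [/\ measurable_fun [set: R] g', (forall t, `|g' t| <= M) &
    {ae mu, forall t : R, g t = g' t}].
Proof.
move=> mg gM.
have M0 : 0 <= M by rewrite (le_trans _ (gM 0)).
(* Codes of no rational number fall back on the level 0, which merely repeats a level. *)
pose E (k : nat) := [set t | ratr (odflt 0 (unpickle k : option rat)) < g t].
have HE k : exists AN : set R * set R, [/\ measurable AN.1,
    mu.-negligible AN.2 & AN.1 `|` AN.2 = E k].
  have mE : measurable (E k : set LT).
    have := mg measurableT `]ratr (odflt 0 (unpickle k : option rat)), +oo[%classic (measurable_itv _).
    by rewrite setTI; congr measurable; apply/seteqP; split=> t /=; rewrite in_itv/= andbT.
  have : (completed_algebra_gen (@lebesgue_measure R)) (E k).
    by rewrite -g_sigma_completed_algebra_genE completed_caratheodory_measurable.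
  move=> [B mB [N [Z [mZ Z0 NZ]] BN]]; exists (B, N); split => //.
  by exists Z; split => //; exact: borel_lebesgue_measurable.
pose B k := (projT1 (cid (HE k))).1; pose N k := (projT1 (cid (HE k))).2.
have mB k : measurable (B k) by rewrite /B; case: cid => -[? ?] [].
have nN k : mu.-negligible (N k) by rewrite /N; case: cid => -[? ?] [].
have BN k : B k `|` N k = E k by rewrite /B /N; case: cid => -[? ?] [].
(* Cutting the levels at [- M], which is also the value off [B k], keeps every [h k] and the
   supremum within the bounds of [g]. *)
pose q k : R := Num.max (- M) (ratr (odflt 0 (unpickle k : option rat))).
pose h k t : R := if t \in B k then q k else - M.
have hlow k t : - M <= h k t by rewrite /h; case: ifP => // _; rewrite le_max lexx.
have hup k t : h k t <= M.
  rewrite /h; case: ifPn => [|_]; last by lra.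
  rewrite inE => Bt; rewrite ge_max; apply/andP; split; first by lra.
  have : E k t by rewrite -BN; left.
  rewrite /E/= => /ltW/le_trans; apply; exact: le_trans (ler_norm _) (gM t).
pose g' t := sups (h ^~ t) 0.
have hub t : has_ubound (range (h ^~ t)) by exists M => _ [k _ <-].
have g'ge k t : h k t <= g' t.
  by apply: sup_upper_bound; [split; [exists (h k t); exists k | exists M => _ [j _ <-]] | exists k].
have g'le t c : (forall k, h k t <= c) -> g' t <= c.
  by move=> H; apply: ge_sup; [exists (h 0%N t); exists 0%N | move=> _ [k _ <-]].
exists g'; split.
- apply: measurable_fun_sups => [t _|k]; first exact: hub.
  apply: measurable_fun_ifT => //; apply: (measurable_fun_bool true).
  rewrite setTI (_ : _ @^-1` _ = B k)//.
  by apply/seteqP; split => t /= => [/set_mem|/mem_set].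
- move=> t; rewrite ler_norml (le_trans (hlow 0%N t) (g'ge 0%N t))/=.
  by apply: g'le.
have : mu.-negligible (\bigcup_k N k) by apply: negligible_bigcup.
apply: negligibleS => t /= gg'; apply: contrapT => nNt; apply: gg'.
have BE k : B k t <-> E k t.
  rewrite -BN; split => [|[]//]; first by left.
  by move=> Nk; exfalso; apply: nNt; exists k.
apply/eqP; rewrite eq_le; apply/andP; split.
- apply/ler_addgt0Pr => e e0.
  have : g t - e < g t by rewrite ltrBlDr ltrDl.
  move=> /rat_in_itvoo[r]; rewrite in_itv/= => /andP[r1 r2].
  have Bt : B (pickle r) t by apply/BE; rewrite /E/= pickleK/=.
  have := g'ge (pickle r) t; rewrite /h mem_set// /q pickleK/= ge_max => /andP[_].
  by move=> h1; rewrite -lerBlDr ltW// (lt_le_trans r1).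
- apply: g'le => k; rewrite /h; have := gM t; rewrite ler_norml => /andP[gl gu].
  case: ifPn => //; rewrite inE => /BE; rewrite /E/= => /ltW r1.
  by rewrite ge_max gl.
Qed.

Definition prim (g : R -> R) (t : R) : R := \int[mu]_(s in (`[0%R, t]%classic : set LT)) g s.

Lemma prim0 g : prim g 0 = 0.
Proof.
rewrite /prim set_itv1 /Rintegral -[RHS]/(fine 0%E); congr fine.
apply: null_set_integral => //.
- by apply: borel_lebesgue_measurable; exact: measurable_set1.
- move=> _ B mB; apply: completed_lebesgue_measure_is_complete.
  by apply: negligibleS (negligible_set1_completed 0); exact: subIsetl.
have := @lebesgue_measure_set1 R 0; exact.
Qed.

Lemma bounded_integrable (D : set R) (T : R) (g : R -> R) (M : R) : measurable (D : set LT) ->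
  D `<=` `[0, T]%classic ->
  measurable_fun (`[0, T]%classic : set LT) g ->
  (forall t, 0 <= t <= T -> `|g t| <= M) ->
  mu.-integrable (D : set LT) (EFin \o g).
Proof.
move=> mD DT mg gM; apply: measurable_bounded_integrable => //.
- have [T0|T0] := leP 0 T; last first.
    have -> : D = set0.
      rewrite -subset0 => t /DT/=; rewrite in_itv/= => /andP[t0 tT].
      by move: (le_trans t0 tT); rewrite leNgt T0.
    by rewrite measure0.
  apply: (@le_lt_trans _ _ (mu (`[0, T]%classic : set LT))).
    by apply: le_measure; rewrite ?inE//; exact: measurable_itv_lebesgue.
  by rewrite completed_measure_itv// ltry.
- by apply: measurable_funS mg => //; exact: measurable_itv_lebesgue.
- exists M; split; first exact: num_real.
  move=> x Mx t /DT/=; rewrite in_itv/= => /gM/le_trans; apply; exact: ltW.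
Qed.

Section prim_lemmas.
Variables (T M : R) (g : R -> R).
Hypotheses (T0 : 0 <= T) (mg : measurable_fun (`[0, T]%classic : set LT) g).
Hypothesis gM : forall t, 0 <= t <= T -> `|g t| <= M.

Lemma prim_lipschitz (s t : R) : 0 <= s -> s <= t -> t <= T ->
  `|prim g t - prim g s| <= M * (t - s).
Proof.
move=> s0 st tT; rewrite /prim.
have split_ : `[0, t]%classic = `[0, s]%classic `|` `]s, t]%classic.
  apply/seteqP; split => x /=; rewrite !in_itv/=.
    by move=> /andP[x0 xt]; have [xs|sx] := leP x s; [left; rewrite x0 | right].
  by move=> [/andP[-> /le_trans]|/andP[sx ->]]; [apply | rewrite (le_trans s0 (ltW sx))].
have sub1 : `]s, t] `<=` `[0, T].
  by move=> x /=; rewrite !in_itv/= => /andP[sx xt]; rewrite (le_trans s0 (ltW sx)) (le_trans xt tT).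
have sub2 : `[0, t] `<=` `[0, T].
  by move=> x /=; rewrite !in_itv/= => /andP[-> xt]; rewrite (le_trans xt tT).
have int1 := bounded_integrable (measurable_itv_lebesgue _) sub1 mg gM.
have int2 := bounded_integrable (measurable_itv_lebesgue _) sub2 mg gM.
rewrite split_ Rintegral_setU; last 4 first.
- exact: measurable_itv_lebesgue.
- exact: measurable_itv_lebesgue.
- by rewrite -split_.
- apply/disj_setPS => x [/=]; rewrite !in_itv/= => /andP[_ xs] /andP[sx _].
  by move: (lt_le_trans sx xs); rewrite ltxx.
rewrite addrC addKr.
apply: le_trans (le_normr_Rintegral _ int1) _; first exact: measurable_itv_lebesgue.
have M0 : 0 <= M by rewrite (le_trans _ (gM _ : `|g 0| <= M))// lexx.
have fin : mu (`]s, t]%classic : set LT) = (t - s)%:E.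
  transitivity (@lebesgue_measure R `]s, t]%classic) => //.
  rewrite lebesgue_measure_itv/= lte_fin; case: ltP => //= ts.
  have -> : s = t by apply/eqP; rewrite eq_le st ts.
  by rewrite subrr.
have -> : M * (t - s) = \int[mu]_(x in (`]s, t]%classic : set LT)) (cst M) x.
  transitivity (M * fine (mu (`]s, t]%classic : set LT))); first by rewrite fin.
  by apply/esym/Rintegral_cst; exact: measurable_itv_lebesgue.
apply: le_Rintegral.
- exact: measurable_itv_lebesgue.
- exact: integrable_norm int1.
- apply: (@bounded_integrable _ T _ M) => //; first exact: measurable_itv_lebesgue.
  by move=> ? _; rewrite /= ger0_norm.
- by move=> x /sub1/=; rewrite in_itv/= => /gM.
Qed.

Lemma lebesgue_ae_completed (P : R -> Prop) :
  {ae @lebesgue_measure R, forall t : R, P t} -> {ae mu, forall t : R, P t}.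
Proof.
by move=> [B [mB B0 PB]]; exists B; split => //; exact: borel_lebesgue_measurable.
Qed.

(** Lebesgue's differentiation theorem, applied to a Borel version of [g] extended by 0. The
    primitive of that version agrees with [prim g] on [[0, T]], hence near each interior point. *)
Lemma prim_derive_ae :
  {ae mu, forall t : R, 0 < t < T -> is_derive t (1 : R) (prim g) (g t)}.
Proof.
pose g1 : R -> R := g \_ `[0, T].
have mg1 : measurable_fun [set: LT] (g1 : LT -> R).
  have /iffLR := @measurable_restrictT _ _ LT R `[0, T]%classic g (measurable_itv_lebesgue _); exact.
have M0 : 0 <= M by rewrite (le_trans _ (gM _ : `|g 0| <= M))// lexx.
have g1M t : `|g1 t| <= M.
  rewrite /g1 /patch; case: ifPn => [|_]; last by rewrite normr0.
  by rewrite inE/= in_itv/= => /gM.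
have [g' [mg' g'M gg']] := borel_version mg1 g1M.
have intg' (D : set R) (a b : R) : measurable D -> D `<=` `[a, b]%classic ->
    (@lebesgue_measure R).-integrable D (EFin \o g').
  move=> mD Dab; apply: measurable_bounded_integrable => //.
  - apply: (@le_lt_trans _ _ (@lebesgue_measure R `[a, b]%classic)).
      by apply: le_measure; rewrite ?inE.
    by rewrite lebesgue_measure_itv/=; case: ifP => // _; rewrite -EFinD ltry.
  - exact: measurable_funTS.
  - exists M; split; first exact: num_real.
    by move=> x Mx t _; rewrite /= (le_trans (g'M t))// ltW.
have loc : locally_integrable [set: R] g'.
  split => //; first exact: openT.
  move=> K _ cK; have [/= N [_ HN]] := compact_bounded cK.
  have : (@lebesgue_measure R).-integrable K (EFin \o g').
    apply: (intg' _ (- (N + 1)) (N + 1)); first exact: compact_measurable.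
    move=> x Kx /=; rewrite in_itv/= -ler_norml; apply: HN => //.
    by rewrite ltrDl.
  by move=> /integrableP[_].
have := FTC1 (a := BLeft 0) (fun y => intg' _ 0 y (measurable_itv _) (@subset_refl _ _)) loc.
move=> /lebesgue_ae_completed; apply: ae_imply2 (gg') => t gt H /andP[t0 tT].
have lt0 : (0%:E < t%:E)%E by rewrite lte_fin.
have {H}[DF F't] := H lt0.
have primE s : 0 <= s <= T -> prim g s = \int[@lebesgue_measure R]_(x in `[0, s]%classic) g' x.
  move=> /andP[s0 sT]; rewrite /prim /Rintegral; congr fine.
  have sub2 : `[0, s] `<=` `[0, T].
    by move=> x /=; rewrite !in_itv/= => /andP[-> xt]; rewrite (le_trans xt sT).
  transitivity (\int[mu]_(x in (`[0%R, s]%classic : set LT)) (g' x)%:E)%E.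
    apply: ae_eq_integral.
    - exact: measurable_itv_lebesgue.
    - apply/measurable_EFinP; apply: measurable_funS mg => //.
      exact: measurable_itv_lebesgue.
    - apply/measurable_EFinP; apply: measurable_funTS.
      exact: (measurableT_comp mg' measurable_fun_lebesgue_id).
    - apply: ae_imply (gg') => x <- xs; rewrite /g1 patchE mem_set//.
      exact: sub2.
  (* The completed measure and the Lebesgue measure live on different sigma-algebras; pushing the
     former forward along the identity gives the latter on Borel sets. *)
  have mi : measurable_fun [set: LT] (id : LT -> measurableTypeR R) := measurable_fun_lebesgue_id.
  have := @integral_pushforward _ _ LT (measurableTypeR R) R id mi mu `[0, s]%classic (EFin \o g').
  move=> /(_ _ _ (measurable_itv _)) <-.
  - pose phi : {mfun LT >-> measurableTypeR R} := HB.pack (id : LT -> measurableTypeR R) (isMeasurableFun.Build _ _ _ _ _ mi).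
    have := @eq_measure_integral _ (measurableTypeR R) R `[0%R, s]%classic (@lebesgue_measure R) (pushforward mu phi) (EFin \o g').
    by apply => A mA _.
  - exact/measurable_EFinP.
  - apply: measurable_bounded_integrable.
    + exact: measurable_itv_lebesgue.
    + by rewrite /= completed_measure_itv// ltry.
    + apply: measurable_funTS.
      exact: (measurableT_comp mg' measurable_fun_lebesgue_id).
    + exists M; split; first exact: num_real.
      by move=> x Mx u _; rewrite /= (le_trans (g'M u))// ltW.
have -> : g t = g' t.
  by rewrite -gt /g1 patchE mem_set//= in_itv/= (ltW t0) (ltW tT).
rewrite -F't.
have nearE : {near t, (fun y => \int[@lebesgue_measure R]_(x in `[0, y]%classic) g' x) =1 prim g}.
  have : t \in `]0, T[ by rewrite in_itv/= t0.
  move=> /near_in_itvoo; apply: filterS => s; rewrite in_itv/= => /andP[s0 sT].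
  by rewrite primE// (ltW s0) (ltW sT).
split; first by apply: near_eq_derivable DF.
by rewrite derive1E; apply/esym; apply: near_eq_derive.
Qed.

Lemma prim_ac_derive : ac_derive T (prim g) g.
Proof.
split; last exact: prim_derive_ae.
by apply: (@ac_lipschitz _ _ _ _ _ M) => s t; exact: prim_lipschitz.
Qed.

End prim_lemmas.

End Primitive.

(** * Measurability along paths and Carathéodory solutions *)

Section CaratheodoryMeasurability.
Context {R : realType}.
Local Notation LT := (lebesgueT R).

(** Measurable selection among countably many candidates: index [i] is chosen where [P i] holds and
    no earlier condition does. The default 0 occurs only where no candidate exists. *)
Definition first_index (P : nat -> R -> Prop) (t : R) : nat :=
  if pselect (exists i, `[< P i t >]) is left H then ex_minn H else 0%N.

Lemma first_indexP (P : nat -> R -> Prop) t : (exists i, P i t) ->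
  P (first_index P t) t /\ forall i, P i t -> (first_index P t <= i)%N.
Proof.
move=> [i0 Pi0]; rewrite /first_index; case: pselect => [H|]; last first.
  by case; exists i0; apply/asboolP.
case: ex_minnP => m /asboolP Pm mmin; split => // i Pi.
by apply: mmin; apply/asboolP.
Qed.

Lemma measurable_first_index (D : set R) (P : nat -> R -> Prop) i :
  measurable (D : set LT) ->
  (forall i, measurable (D `&` [set t | P i t] : set LT)) ->
  (forall t, D t -> exists i, P i t) ->
  measurable (D `&` [set t | first_index P t = i] : set LT).
Proof.
move=> mD mP exP.
have -> : D `&` [set t | first_index P t = i] =
    (D `&` [set t | P i t]) `\` (\big[setU/set0]_(k < i) (D `&` [set t | P k t])).
  apply/seteqP; split => [t [Dt /= <-]|t [[Dt /= Pi]]].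
    have [Pf minf] := first_indexP (exP t Dt).
    split=> //; rewrite -(bigcup_mkord _ (fun k => D `&` [set t | P k t])) => -[k /= ki [_ /= /minf]].
    by rewrite leqNgt ki.
  have [Pf minf] := first_indexP (exP t Dt).
  rewrite -(bigcup_mkord _ (fun k => D `&` [set t | P k t])) => H; split => //=; apply/eqP; rewrite eqn_leq minf//=.
  by rewrite leqNgt; apply/negP => fi; apply: H; exists (first_index P t).
by apply: measurableD => //; apply: bigsetU_measurable.
Qed.

(** Carathéodory's superposition argument. An approximation of [v] with countably many values makes
    [g] measurable piece by piece, and continuity in the second argument passes to the limit. *)
Lemma measurable_caratheodory_approx (X : topologicalType) (D : set R)
    (g : R -> X -> R) (v : R -> X) (c : nat -> nat -> X) (j : nat -> R -> nat) :
  measurable (D : set LT) ->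
  (forall x, measurable_fun (D : set LT) (g ^~ x : LT -> R)) ->
  (forall t, D t -> continuous (g t)) ->
  (forall k i, measurable (D `&` [set t | j k t = i] : set LT)) ->
  (forall t, D t -> (fun k => c k (j k t)) @ \oo --> v t) ->
  measurable_fun (D : set LT) ((fun t => g t (v t)) : LT -> R).
Proof.
move=> mD mg cg mj cv.
apply: (@measurable_fun_cvg _ LT R D (fun k t => g t (c k (j k t)))) => [k _ Y mY|t Dt].
  have -> : D `&` (fun t => g t (c k (j k t))) @^-1` Y =
      \bigcup_i ((D `&` [set t | j k t = i]) `&` (D `&` (g ^~ (c k i)) @^-1` Y)).
    apply/seteqP; split => [t [Dt Yt]|t [i _ [[Dt /= <-] [_ Yt]]]]; last by split.
    by exists (j k t) => //; split; split.
  by apply: bigcupT_measurable => i; apply: measurableI => //; exact: mg.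
by apply: continuous_cvg; [exact: cg | exact: cv].
Qed.

Lemma separable_sequence (U : topologicalType) (u0 : U) : separable U ->
  exists d : nat -> U, forall V : set U, open V -> V !=set0 -> exists i, V (d i).
Proof.
move=> [S /countable_injP[h hinj] dS].
pose d i := if pselect (exists u, S u /\ h u = i) is left H then projT1 (cid H) else u0.
exists d => V oV V0; have [u [Vu Su]] := dS V V0 oV; exists (h u).
rewrite /d; case: pselect => [H|[]]; last by exists u.
case: cid => w /= [Sw hw].
by rewrite (hinj w u _ _ hw)// inE.
Qed.

Lemma measurable_caratheodory_metric (U : pseudoMetricType R) (D : set R)
    (g : R -> U -> R) (v : R -> U) :
  measurable (D : set LT) -> separable U -> lebesgue_measurable_fun D v ->
  (forall u, measurable_fun (D : set LT) (g ^~ u : LT -> R)) ->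
  (forall t, D t -> continuous (g t)) ->
  measurable_fun (D : set LT) ((fun t => g t (v t)) : LT -> R).
Proof.
move=> mD sU mv mg cg.
have [d Hd] := separable_sequence (v 0) sU.
(* Interiors are taken because measurability of [v] is tested on open sets, and a ball of a
   pseudometric structure need not be open. *)
pose P k i t := (ball (d i) (k.+1%:R^-1 : R))° (v t).
have exP k t : exists i, P k i t.
  have e0 : 0 < (k.+1%:R^-1 : R) / 2 by rewrite divr_gt0 ?invr_gt0.
  have [||i Hi] := Hd (ball (v t) ((k.+1%:R^-1 : R) / 2))°.
  - exact: open_interior.
  - exists (v t); exact: nbhsx_ballx.
  exists i; apply/nbhs_ballP; exists ((k.+1%:R^-1 : R) / 2) => //= y vy.
  move/interior_subset : Hi => Hi.
  by rewrite [X in ball _ X]splitr; apply: ball_triangle vy; exact: ball_sym.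
apply: (@measurable_caratheodory_approx _ D g v (fun k i => d i)
  (fun k => first_index (P k))) => //.
- move=> k i; apply: measurable_first_index => // l.
  apply: (mv ((ball (d l) (k.+1%:R^-1 : R))°)).
  by apply: sub_sigma_algebra; exact: open_interior.
- move=> t Dt; apply/cvg_ballP => e e0; near=> k.
  have [/interior_subset Pf _] := first_indexP (exP k t).
  apply: ball_sym; apply: le_ball Pf; apply: ltW.
  near: k; exact: near_infty_natSinv_lt (PosNum e0).
Unshelve. all: by end_near. Qed.

(** The path is sampled at the grid point of step [1 / k.+1] to the left of [t]: the sampling time
    stays in [[0, T]], and uniform continuity gives convergence. *)
Lemma measurable_caratheodory_ac (W : normedModType R) (T : R)
    (g : R -> W -> R) (w : R -> W) :
  absolutely_continuous 0 T w ->
  (forall x, measurable_fun (`[0, T]%classic : set LT) (g ^~ x : LT -> R)) ->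
  (forall t, 0 <= t <= T -> continuous (g t)) ->
  measurable_fun (`[0, T]%classic : set LT) ((fun t => g t (w t)) : LT -> R).
Proof.
move=> acw mg cg.
have k0 k : 0 < (k.+1%:R : R) by [].
apply: (@measurable_caratheodory_approx _ _ g w (fun k i => w (i%:R / k.+1%:R))
  (fun k t => Num.truncn (t * k.+1%:R))).
- exact: measurable_itv_lebesgue.
- exact: mg.
- by move=> t /=; rewrite in_itv/=; exact: cg.
- move=> k i.
  have -> : `[0, T] `&` [set t | Num.truncn (t * k.+1%:R) = i] =
     `[0, T] `&` `[(i%:R / k.+1%:R : R), i.+1%:R / k.+1%:R[%classic.
    apply/seteqP; split => t [] /=; rewrite !in_itv/= => /andP[t0 tT].
      move=> <-; split; first by rewrite t0.
      have /truncn_itv : 0 <= t * k.+1%:R by rewrite mulr_ge0.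
      by rewrite ler_pdivrMr// ltr_pdivlMr.
    rewrite ler_pdivrMr// ltr_pdivlMr// => ht; split; first by rewrite t0.
    exact: truncn_def.
  by apply: measurableI; exact: measurable_itv_lebesgue.
- move=> t /=; rewrite in_itv/= => /andP[t0 tT]; apply/cvgrPdist_lt => e e0.
  have [d d0 Hd] := ac_uniform e0 acw; near=> k.
  have /truncn_itv/andP[h1 h2] : 0 <= t * k.+1%:R by rewrite mulr_ge0.
  have h3 : (Num.truncn (t * k.+1%:R))%:R / k.+1%:R <= t by rewrite ler_pdivrMr.
  apply: Hd; first by rewrite t0.
    by rewrite divr_ge0//= (le_trans h3).
  rewrite ger0_norm ?subr_ge0// (@le_lt_trans _ _ k.+1%:R^-1)//; last first.
    near: k; exact: near_infty_natSinv_lt (PosNum d0).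
  rewrite lerBlDr -[X in X + _]mul1r -mulrDl ler_pdivlMr//.
  by rewrite addrC natr1 ltW.
Unshelve. all: by end_near. Qed.

End CaratheodoryMeasurability.

(** * Existence of Carathéodory solutions by Picard iteration *)

Section Picard.
Context {R : realType}.
Local Notation LT := (lebesgueT R).

Lemma ae_forall_ord n (P : 'I_n -> R -> Prop) :
  (forall i, {ae completed_lebesgue_measure, forall t : R, P i t}) ->
  {ae completed_lebesgue_measure, forall t : R, forall i, P i t}.
Proof.
elim: n P => [|n IH] P H; first by apply: aeW => t [].
have := IH (fun i => P (lift ord0 i)) (fun i => H _).
move: (H ord0); apply: ae_imply2 => t h0 h i.
by case: (unliftP ord0 i) => [j ->|->].
Qed.

(** Nested intervals: [e k] is the sum of the remaining steps, so [u k - e k] increases and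
    [u k + e k] decreases. This gives the limit together with an explicit rate. *)
Lemma geometric_limit (u : nat -> R) (C : R) :
  (forall k, `|u k.+1 - u k| <= C / 2 ^+ k) ->
  exists l, forall k, `|l - u k| <= 2 * C / 2 ^+ k.
Proof.
move=> Hu; pose e k := 2 * C / 2 ^+ k.
have eS k : e k - e k.+1 = C / 2 ^+ k.
  by rewrite /e exprS; field; rewrite expf_neq0.
have C0 : 0 <= C by have := Hu 0%N; rewrite expr0 divr1; apply: le_trans.
have e0 k : 0 <= e k by rewrite /e divr_ge0 ?exprn_ge0// mulr_ge0.
have nda : {homo (fun k => u k - e k) : i j / (i <= j)%N >-> i <= j}.
  apply: homo_leq => [//|x y z|k]; first exact: le_trans.
  by have := Hu k; have := eS k; rewrite ler_norml => ? /andP[? ?]; lra.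
have nib : {homo (fun k => - (u k + e k)) : i j / (i <= j)%N >-> i <= j}.
  apply: homo_leq => [//|x y z|k]; first exact: le_trans.
  by have := Hu k; have := eS k; rewrite ler_norml => ? /andP[? ?]; lra.
have ab i j : u i - e i <= u j + e j.
  have := nda _ _ (leq_maxl i j); have := nib _ _ (leq_maxr i j).
  by have := e0 (maxn i j); lra.
have hs : has_sup (range (fun k => u k - e k)).
  by split; [exists (u 0%N - e 0%N); exists 0%N | exists (u 0%N + e 0%N) => _ [k _ <-]].
exists (sup (range (fun k => u k - e k))) => k.
have h1 : u k - e k <= sup (range (fun k => u k - e k)) by apply: sup_upper_bound => //; exists k.
have h2 : sup (range (fun k => u k - e k)) <= u k + e k.
  by apply: ge_sup; [exact: hs.1 | move=> _ [j _ <-]].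
by rewrite -/(e k) ler_norml; apply/andP; split; lra.
Qed.

Lemma ac_derive_expR (T K : R) : 0 <= K ->
  ac_derive T (fun t => expR (K * t)) (fun t => K * expR (K * t)).
Proof.
move=> K0; apply: (@ac_derive_smooth _ _ _ _ (K * expR (K * T))) => [t|t /andP[t0 tT]].
  have -> : K * expR (K * t) = expR (K * t) * K by rewrite mulrC.
  apply: (@is_derive1_comp _ expR (fun t => K * t)).
  by apply: is_derive_eq; rewrite /GRing.scale/= mulr1.
by rewrite ger0_norm ?mulr_ge0 ?expR_ge0// ler_wpM2l// ler_expR ler_wpM2l.
Qed.

Section PicardIteration.
Variables (T K : R) (n : nat) (x0 : 'cV[R]_n) (F : R -> 'cV[R]_n -> 'cV[R]_n).
Hypotheses (T0 : 0 <= T) (K0 : 0 <= K).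
Hypothesis F_measurable : forall (w : R -> 'cV[R]_n) i,
  absolutely_continuous 0 T w ->
  measurable_fun (`[0, T]%classic : set LT) ((fun t => F t (w t) i 0) : LT -> R).
Hypothesis F_lipschitz : forall t x y, 0 <= t <= T ->
  `|F t x - F t y| <= K * `|x - y|.
Hypothesis F_bounded : forall t, 0 <= t <= T -> `|F t 0| <= K.

Definition picard (w : R -> 'cV[R]_n) (t : R) : 'cV[R]_n :=
  \col_i (x0 i 0 + prim (fun s => F s (w s) i 0) t).

Lemma picard_rhs_bounded (w : R -> 'cV[R]_n) (B : R) :
  (forall t, 0 <= t <= T -> `|w t| <= B) ->
  forall t i, 0 <= t <= T -> `|F t (w t) i 0| <= K * (1 + B).
Proof.
move=> wB t i tT; apply: le_trans (mx_entry_le_norm _ _ _) _.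
rewrite -[F t (w t)](subrK (F t 0)); apply: le_trans (ler_normD _ _) _.
rewrite mulrDr mulr1 addrC lerD//; first exact: F_bounded.
apply: le_trans (F_lipschitz _ _ tT) _; rewrite subr0.
by rewrite ler_wpM2l// wB.
Qed.

Lemma picard_entry_derive (w : R -> 'cV[R]_n) i : absolutely_continuous 0 T w ->
  ac_derive T (fun t => picard w t i 0) (fun t => F t (w t) i 0).
Proof.
move=> acw; have [B B0 wB] := ac_bounded acw.
have := ac_deriveD (ac_derive_cst T (x0 i 0))
  (prim_ac_derive T0 (F_measurable i acw) (fun t => picard_rhs_bounded wB i)).
by congr ac_derive; apply/funext => t; rewrite ?mxE ?add0r.
Qed.

Lemma picard_lipschitz (w : R -> 'cV[R]_n) (B s t : R) :
  absolutely_continuous 0 T w -> (forall t, 0 <= t <= T -> `|w t| <= B) ->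
  0 <= s -> s <= t -> t <= T ->
  `|picard w t - picard w s| <= K * (1 + B) * (t - s).
Proof.
move=> acw wB s0 st tT.
have B0 : 0 <= B by rewrite (le_trans _ (wB 0 _))// lexx.
apply: mx_norm_le => [|i j].
  by rewrite !mulr_ge0 ?subr_ge0// addr_ge0.
rewrite !mxE opprD addrACA subrr add0r.
exact: (prim_lipschitz T0 (F_measurable i acw) (fun t => picard_rhs_bounded wB i)).
Qed.

Lemma picard_ac (w : R -> 'cV[R]_n) : absolutely_continuous 0 T w ->
  absolutely_continuous 0 T (picard w).
Proof.
move=> acw; have [B B0 wB] := ac_bounded acw.
by apply: (@ac_lipschitz _ _ _ _ _ (K * (1 + B))) => s t; exact: picard_lipschitz.
Qed.

(** For the supremum norm weighted by [expR (2 * K * t)] the iteration contracts by one half,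
    whatever the length of the interval: [c / 2 * expR (2 * K * t)] has derivative [K] times the
    assumed bound. *)
Lemma picard_contraction (w w' : R -> 'cV[R]_n) (c : R) :
  absolutely_continuous 0 T w -> absolutely_continuous 0 T w' -> 0 <= c ->
  (forall t, 0 <= t <= T -> `|w t - w' t| <= c * expR (2 * K * t)) ->
  forall t, 0 <= t <= T -> `|picard w t - picard w' t| <= c / 2 * expR (2 * K * t).
Proof.
move=> acw acw' c0 ww' t /andP[t0 tT].
have e2 : ac_derive T (fun t => c / 2 * expR (2 * K * t)) (fun t => c / 2 * (2 * K * expR (2 * K * t))).
  by apply: ac_deriveZ; apply: ac_derive_expR; rewrite mulr_ge0.
apply: mx_norm_le => [|i j]; first by rewrite mulr_ge0 ?divr_ge0 ?expR_ge0.
have -> : (picard w t - picard w' t) i j = picard w t i 0 - picard w' t i 0.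
  by rewrite (ord1 j) mxE [X in _ + X]mxE.
have Fle s : 0 < s < t -> `|F s (w s) i 0 - F s (w' s) i 0| <= c / 2 * (2 * K * expR (2 * K * s)).
  move=> /andP[s0 st]; have sT : 0 <= s <= T by rewrite (ltW s0) (le_trans (ltW st) tT).
  have := mx_entry_le_norm (F s (w s) - F s (w' s)) i 0; rewrite !mxE => /le_trans; apply.
  apply: le_trans (F_lipschitz _ _ sT) _.
  have -> : c / 2 * (2 * K * expR (2 * K * s)) = K * (c * expR (2 * K * s)) by field.
  by rewrite ler_wpM2l// ww'.
have p0 (v : R -> 'cV[R]_n) : picard v 0 i 0 = x0 i 0 by rewrite !mxE prim0 addr0.
have dw := picard_entry_derive i acw; have dw' := picard_entry_derive i acw'.
have c2 : 0 <= c / 2 by rewrite divr_ge0.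
have h1 := ac_derive_nondecreasing (ac_deriveB e2 (ac_deriveB dw dw')) (lexx 0) t0 tT.
have h2 := ac_derive_nondecreasing (ac_deriveD e2 (ac_deriveB dw dw')) (lexx 0) t0 tT.
move: h1 h2; rewrite (p0 w) (p0 w') subrr subr0 addr0 mulr0 expR0 mulr1 => h1 h2.
have {}h1 : c / 2 <= c / 2 * expR (2 * K * t) - (picard w t i 0 - picard w' t i 0).
  by apply: h1; apply: aeW => s /Fle; rewrite ler_norml => /andP[? ?]; lra.
have {}h2 : c / 2 <= c / 2 * expR (2 * K * t) + (picard w t i 0 - picard w' t i 0).
  by apply: h2; apply: aeW => s /Fle; rewrite ler_norml => /andP[? ?]; lra.
by rewrite ler_norml; apply/andP; split; lra.
Qed.

Theorem picard_exists : exists y : R -> 'cV[R]_n,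
  caratheodory_solution T F y /\ y 0 = x0.
Proof.
pose Y k := iter k picard (fun=> x0).
have acY k : absolutely_continuous 0 T (Y k).
  elim: k => [|k IH]; last exact: picard_ac.
  by apply: (@ac_lipschitz _ _ _ _ _ 0) => s t _ _ _; rewrite subrr normr0 mul0r.
have [B1 B10 Y1B] := ac_bounded (acY 1%N).
pose c := B1 + `|x0|; have c0 : 0 <= c by rewrite addr_ge0.
have YS k t : 0 <= t <= T -> `|Y k.+1 t - Y k t| <= c / 2 ^+ k * expR (2 * K * t).
  elim: k t => [|k IH] t tT.
    rewrite expr0 divr1; apply: (@le_trans _ _ c).
      by apply: le_trans (ler_normB _ _) _; rewrite lerD// Y1B.
    rewrite -[leLHS]mulr1 ler_wpM2l// -expR0 ler_expR.
    by move: tT => /andP[? _]; rewrite !mulr_ge0.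
  have := picard_contraction (acY k.+1) (acY k) _ IH tT.
  rewrite divr_ge0 ?exprn_ge0// => /(_ isT).
  suff -> : c / 2 ^+ k / 2 = c / 2 ^+ k.+1 by [].
  by rewrite exprSr; field; rewrite expf_neq0.
pose C := c * expR (2 * K * T).
have YSC k t : 0 <= t <= T -> `|Y k.+1 t - Y k t| <= C / 2 ^+ k.
  move=> tT; apply: le_trans (YS k t tT) _; rewrite /C [leRHS]mulrAC.
  rewrite ler_wpM2l ?divr_ge0 ?exprn_ge0// ler_expR.
  by move: tT => /andP[? tT]; rewrite ler_wpM2l// mulr_ge0.
have lim t i : 0 <= t <= T -> exists l, forall k, `|l - Y k t i 0| <= 2 * C / 2 ^+ k.
  move=> tT; apply: geometric_limit => k; apply: le_trans (YSC k t tT).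
  by have := mx_entry_le_norm (Y k.+1 t - Y k t) i 0; rewrite !mxE.
(* The pointwise limit on [[0, T]]; the value 0 elsewhere is arbitrary. *)
pose y t : 'cV[R]_n := \col_i (if pselect (0 <= t <= T) is left tT then projT1 (cid (lim t i tT)) else 0).
have C0 : 0 <= C by rewrite mulr_ge0 ?expR_ge0.
have e0 k : 0 <= 2 * C / 2 ^+ k by rewrite divr_ge0 ?exprn_ge0// mulr_ge0.
have yY k t : 0 <= t <= T -> `|y t - Y k t| <= 2 * C / 2 ^+ k.
  move=> tT; apply: mx_norm_le => // i j; rewrite (ord1 j) !mxE.
  by case: pselect => // tT'; case: cid => l /= Hl; exact: Hl.
have small (a : R) : (forall k, a <= 2 * C / 2 ^+ k) -> a <= 0.
  move=> Ha; have cvg0 : (fun k => 2 * C / 2 ^+ k) @ \oo --> 0.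
    rewrite -[X in _ --> X](mulr0 (2 * C)); apply: cvgM; first exact: cvg_cst.
    under eq_fun do rewrite -exprVn.
    by apply: cvg_expr; rewrite ger0_norm ?invr_ge0// invf_lt1// ltr1n.
  by apply: (cvgr_to_ge cvg0); apply: nearW => k; exact: Ha.
have aux (p q e E : R) : 0 <= e -> 1 <= E -> p <= e / 2 * E -> q <= e / 2 ->
    p + q <= e * (2 * E).
  move=> he hE hp hq; have : 0 <= e * (E - 1) by rewrite mulr_ge0// subr_ge0.
  by move=> hh; nra.
pose B := `|x0| + 2 * C.
have YB k t : 0 <= t <= T -> `|Y k t| <= B + 2 * C.
  move=> tT; rewrite -[Y k t](subrK (y t)) -[y t in X in _ + X](subrK x0).
  apply: le_trans (ler_normD _ _) _; rewrite addrC lerD//.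
    apply: le_trans (ler_normD _ _) _; rewrite addrC lerD//.
    by have := yY 0%N t tT; rewrite expr0 divr1.
  rewrite distrC; apply: le_trans (yY k t tT) _.
  rewrite ler_piMr ?mulr_ge0// invf_le1 ?exprn_gt0//.
  by rewrite exprn_ege1// ler1n.
have acy : absolutely_continuous 0 T y.
  apply: (@ac_lipschitz _ _ _ _ _ (K * (1 + (B + 2 * C)))) => s t s0 st tT.
  have sT' : 0 <= s <= T by rewrite s0 (le_trans st tT).
  have tT' : 0 <= t <= T by rewrite tT (le_trans s0 st).
  rewrite -subr_le0 -(pmulr_rle0 _ (_ : 0 < 2^-1 :> R))//.
  apply: small => k; rewrite mulrC ler_pdivrMr//.
  have h1 := yY k.+1 t tT'; have h2 := yY k.+1 s sT'.
  have h3 := picard_lipschitz (acY k) (YB k) s0 st tT.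
  have h4 : 2 * C / 2 ^+ k.+1 <= 2 * C / 2 ^+ k.
    by rewrite ler_wpM2l ?mulr_ge0// lef_pV2 ?posrE ?exprn_gt0// ler_weXn2l// ler1n.
  have : `|y t - y s| <= `|y t - Y k.+1 t| + `|Y k.+1 t - Y k.+1 s| + `|Y k.+1 s - y s|.
    have -> : y t - y s = (y t - Y k.+1 t) + (Y k.+1 t - Y k.+1 s) + (Y k.+1 s - y s).
      by rewrite !addrA !subrK.
    by apply: le_trans (ler_normD _ _) _; rewrite lerD2r ler_normD.
  rewrite (distrC (Y k.+1 s) (y s)); move: h1 h2 h3 h4; rewrite -/(Y k.+1).
  move: `|y t - Y _ _| `|y s - Y _ _| `|Y _ _ - Y _ _| `|y t - y s| (2 * C / _) (2 * C / _) (K * _ * _).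
  by move=> *; lra.
have yE t : 0 <= t <= T -> picard y t = y t.
  move=> tT; apply/eqP; rewrite -subr_eq0 -normr_le0.
  rewrite -(pmulr_rle0 _ (_ : 0 < (2 * expR (2 * K * t))^-1)); last by rewrite invr_gt0 mulr_gt0// expR_gt0.
  have E1 : 1 <= expR (2 * K * t).
    by rewrite -expR0 ler_expR; move: tT => /andP[? _]; rewrite !mulr_ge0.
  apply: small => k; rewrite mulrC ler_pdivrMr ?mulr_gt0 ?expR_gt0//.
  have h1 : `|picard y t - Y k.+1 t| <= 2 * C / 2 ^+ k / 2 * expR (2 * K * t).
    apply: picard_contraction => // s sT; apply: le_trans (yY k s sT) _.
    rewrite -[leLHS]mulr1 ler_wpM2l// -expR0 ler_expR.
    by move: sT => /andP[? _]; rewrite !mulr_ge0.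
  have h2 := yY k.+1 t tT; have h3 := e0 k; have h4 := e0 k.+1.
  have h5 : 2 * C / 2 ^+ k.+1 = 2 * C / 2 ^+ k / 2 by rewrite exprSr; field; rewrite expf_neq0.
  apply: (@le_trans _ _ (`|picard y t - Y k.+1 t| + `|y t - Y k.+1 t|)).
    by rewrite (distrC (y t)); apply: ler_distD.
  by move: h1 h2; rewrite h5; exact: aux.
(* [picard y] equals [y] on [[0, T]] and is the form whose derivative is known, as a primitive. *)
exists (picard y); split; last first.
  by apply/matrixP => i j; rewrite (ord1 j) !mxE prim0 addr0.
split; first exact: picard_ac.
have : {ae completed_lebesgue_measure, forall t : R, forall i, 0 < t < T ->
    is_derive t (1 : R) (fun s => picard y s i 0) (F t (y t) i 0)}.
  apply: ae_forall_ord => i; exact: (picard_entry_derive i acy).2.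
apply: ae_imply => t H tT; apply: is_derive_mx => i j; rewrite (ord1 j).
rewrite yE; first exact: H.
by move: tT => /andP[/ltW-> /ltW->].
Qed.

End PicardIteration.

End Picard.

(** * Taylor expansion of the control system and of the Hamiltonian *)

Section Taylor.
Context {R : realType} (n : nat).
Implicit Types (g : 'cV[R]_n -> R) (x z : 'cV[R]_n).

Lemma cV_sum_delta (z : 'cV[R]_n) : z = \sum_(i < n) z i 0 *: delta_mx i 0.
Proof.
apply/matrixP => i j; rewrite summxE (bigD1 i)//= big1 => [|k ki].
  by rewrite addr0 !mxE (ord1 j) !eqxx mulr1.
by rewrite !mxE (eq_sym i) (negbTE ki) mulr0.
Qed.

Lemma diff_partial g x z : differentiable g x ->
  'd g x z = \sum_(i < n) z i 0 * partial i g x.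
Proof.
move=> dg; rewrite [in LHS](cV_sum_delta z) linear_sum; apply: eq_bigr => i _.
by rewrite linearZ /partial deriveE.
Qed.

Lemma is_derive_line g x z (s : R) : (forall y, differentiable g y) ->
  is_derive s (1 : R) (fun s => g (x + s *: z))
    (\sum_(i < n) z i 0 * partial i g (x + s *: z)).
Proof.
move=> dg; rewrite -diff_partial// -deriveE//.
have E : (fun h : R => h^-1 *: (((fun s => g (x + s *: z)) \o shift s) (h *: (1 : R)) - g (x + s *: z))) =
    (fun h => h^-1 *: ((g \o shift (x + s *: z)) (h *: z) - g (x + s *: z))).
  apply/funext => h /=; congr (_ *: (g _ - _)).
  by rewrite [h *: (1 : R)]mulr1 scalerDl addrCA.
have D : derivable g (x + s *: z) z by exact: diff_derivable.
by split; rewrite /derivable /derive E.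
Qed.

Lemma line_mvt g x z : (forall y, differentiable g y) ->
  exists2 c : R, 0 <= c <= 1 &
    g (x + z) - g x = \sum_(i < n) z i 0 * partial i g (x + c *: z).
Proof.
move=> dg.
have [||c] := @MVT_segment R (fun s => g (x + s *: z))
   (fun s => \sum_(i < n) z i 0 * partial i g (x + s *: z)) 0 1 ler01.
- by move=> s _; exact: is_derive_line.
- apply: continuous_subspaceT => s; apply: differentiable_continuous.
  by apply/derivable1_diffP; have [] := is_derive_line x z s dg.
by rewrite in_itv/= => c01; rewrite scale1r scale0r addr0 subr0 mulr1 => ?; exists c.
Qed.

Lemma norm_sum_le (a : 'I_n -> R) (c : R) : (forall i, `|a i| <= c) ->
  `|\sum_(i < n) a i| <= n%:R * c.
Proof.
move=> H; apply: le_trans (ler_norm_sum _ _ _) _.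
apply: (@le_trans _ _ (\sum_(i < n) c)); first by apply: ler_sum.
by rewrite sumr_const card_ord mulr_natl.
Qed.

Lemma taylor1 g x z (K : R) : 0 <= K -> (forall y, differentiable g y) ->
  (forall i y y', `|partial i g y - partial i g y'| <= K * `|y - y'|) ->
  `|g (x + z) - g x - \sum_(i < n) z i 0 * partial i g x| <= n%:R * K * `|z| ^+ 2.
Proof.
move=> K0 dg LK; have [c /andP[c0 c1] ->] := line_mvt x z dg.
rewrite -sumrB -mulrA; apply: norm_sum_le => i.
rewrite -mulrBr normrM expr2 mulrCA ler_pM//; first exact: mx_entry_le_norm.
apply: le_trans (LK _ _ _) _; rewrite addrC addKr normrZ ger0_norm// ler_wpM2l//.
by rewrite ler_piMl.
Qed.

Lemma differentiable_small g x (e : R) : 0 < e -> differentiable g x ->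
  \forall w \near (0 : 'cV[R]_n),
    `|g (x + w) - g x - \sum_(i < n) w i 0 * partial i g x| <= e * `|w|.
Proof.
move=> e0 dg; have /diff_locallyP[_ /eqaddoP] := dg.
move=> /(_ e e0); apply: filterS => w /=.
rewrite -(diff_partial w dg) (addrC x w).
have -> : (g \o +%R^~ x - (cst (g x) + 'd g x)) w = g (w + x) - (g x + 'd g x w) by [].
by rewrite opprD addrA.
Qed.

(** The mean value theorem applies to [g] along the segment minus its quadratic polynomial: the
    derivative of this difference pairs [z] with the first order remainders of the partial
    derivatives at [x]. The threshold [d] depends on [g] and [x]. *)
Lemma taylor2 g x (e : R) : 0 < e -> (forall y, differentiable g y) ->
  (forall j, differentiable (partial j g) x) ->
  exists2 d : R, 0 < d & forall z, `|z| < d ->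
  `|g (x + z) - g x - \sum_(i < n) z i 0 * partial i g x
    - 2^-1 * \sum_(j < n) \sum_(i < n) z j 0 * z i 0 * partial i (partial j g) x|
  <= n%:R * e * `|z| ^+ 2.
Proof.
move=> e0 dg ddg.
have : \forall w \near (0 : 'cV[R]_n), forall j : 'I_n,
    `|partial j g (x + w) - partial j g x - \sum_(i < n) w i 0 * partial i (partial j g) x| <= e * `|w|.
  exact: (filter_forall _ (fun j => differentiable_small e0 (ddg j))).
move=> /nbhs_ballP[d /= d0 Hd]; exists d => // z zd.
pose q := \sum_(j < n) \sum_(i < n) z j 0 * z i 0 * partial i (partial j g) x.
pose p := \sum_(i < n) z i 0 * partial i g x.
pose phi s := g (x + s *: z) - s * p - 2^-1 * s ^+ 2 * q.
pose dphi s := \sum_(i < n) z i 0 * partial i g (x + s *: z) - p - s * q.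
have Dphi (s : R) : is_derive s (1 : R) phi (dphi s).
  have := is_derive_line x z s dg => D1.
  apply: is_derive_eq; rewrite /dphi /GRing.scale/=.
  by field.
have cphi : {within `[0, 1], continuous phi}.
  apply: continuous_subspaceT => s; apply: differentiable_continuous.
  by apply/derivable1_diffP; have [] := Dphi s.
have [c] := MVT_segment ler01 (fun s _ => Dphi s) cphi.
rewrite in_itv/= => /andP[c0 c1].
rewrite /phi scale1r scale0r addr0 subr0 expr0n/= expr1n !mulr1 !mul0r mul1r !mulr0 mul0r !subr0 => E.
have -> : g (x + z) - g x - p - 2^-1 * q = dphi c by rewrite -E; ring.
have -> : dphi c = \sum_(j < n) z j 0 * (partial j g (x + c *: z) - partial j g x
    - \sum_(i < n) (c *: z) i 0 * partial i (partial j g) x).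
  rewrite /dphi /p /q mulr_sumr -!sumrB; apply: eq_bigr => j _.
  rewrite !mulrBr mulr_sumr mulr_sumr; congr (_ - _ - _); apply: eq_bigr => i _.
  by rewrite mxE; ring.
rewrite -mulrA; apply: norm_sum_le => j; rewrite normrM expr2 mulrCA ler_pM//.
  exact: mx_entry_le_norm.
have czz : `|c *: z| <= `|z| by rewrite normrZ ger0_norm// ler_piMl.
apply: le_trans (Hd (c *: z) _ j) _; last by rewrite ler_wpM2l// ltW.
by rewrite -ball_normE/= sub0r normrN (le_lt_trans czz).
Qed.

Lemma partial_le_lipschitz g x i (K : R) : 0 <= K ->
  (forall y y', `|g y - g y'| <= K * `|y - y'|) -> derivable g x (delta_mx i 0) ->
  `|partial i g x| <= K.
Proof.
move=> K0 LK dg; rewrite /partial /derive.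
have /cvg_norm := dg; set l := lim _ => cl.
have e1 : `|delta_mx i 0 : 'cV[R]_n| <= 1.
  by apply: mx_norm_le => // a b; rewrite mxE; case: (_ && _); rewrite ?normr1 ?normr0.
apply: (cvgr_to_le cl); near=> h.
have h0 : h != 0 by near: h; exact: nbhs_dnbhs_neq.
rewrite normrZ normfV mulrC ler_pdivrMr ?normr_gt0//=.
apply: le_trans (LK _ _) _; rewrite ler_wpM2l// addrK normrZ ler_piMr//.
Unshelve. all: by end_near. Qed.

End Taylor.

Section EuclideanNorm.
Context {R : realType}.

Lemma entry_le_enorm m n (M : 'M[R]_(m, n)) i j : `|M i j| <= enorm M.
Proof.
rewrite -sqrtr_sqr /enorm; apply: ler_wsqrtr.
rewrite (bigD1 i)//= (bigD1 j)//= -addrA lerDl addr_ge0 ?sumr_ge0// => k _.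
- exact: sqr_ge0.
- by apply: sumr_ge0 => l _; exact: sqr_ge0.
Qed.

Lemma enorm_le_norm n (x : 'cV[R]_n) : enorm x <= n%:R * `|x|.
Proof.
have nx0 : 0 <= n%:R * `|x| by rewrite mulr_ge0.
rewrite -[leRHS]ger0_norm// -sqrtr_sqr; apply: ler_wsqrtr.
apply: (@le_trans _ _ (\sum_(i < n) `|x| ^+ 2)).
  apply: ler_sum => i _; rewrite big_ord1 -[X in X <= _]ger0_norm ?sqr_ge0// normrX.
  by rewrite ler_pXn2r ?nnegrE//; exact: mx_entry_le_norm.
rewrite sumr_const card_ord exprMn -[X in X <= _]mulr_natl ler_wpM2r ?sqr_ge0//.
by rewrite -natrX ler_nat; case: (n) => // k; rewrite expnS expn1 leq_pmulr.
Qed.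

End EuclideanNorm.

Section LinearCombination.
Context {R : realType} (n m : nat).
Variables (g : 'I_m -> 'cV[R]_n -> R) (c : 'I_m -> R).

Lemma differentiable_lincomb x : (forall k, differentiable (g k) x) ->
  differentiable (fun y => \sum_(k < m) c k * g k y) x.
Proof.
move=> dg.
have -> : (fun y => \sum_(k < m) c k * g k y) = \sum_(k < m) (fun y => c k *: g k y).
  by apply/funext => y; rewrite fct_sumE.
by apply: differentiable_sum => k; apply: differentiableZ.
Qed.

Lemma partial_lincomb i x : (forall k, differentiable (g k) x) ->
  partial i (fun y => \sum_(k < m) c k * g k y) x = \sum_(k < m) c k * partial i (g k) x.
Proof.
move=> dg; rewrite /partial.
have -> : (fun y => \sum_(k < m) c k * g k y) = \sum_(k < m) (fun y => c k *: g k y).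
  by apply/funext => y; rewrite fct_sumE.
rewrite derive_sum => [|k]; last by apply: derivableZ; exact: diff_derivable.
by apply: eq_bigr => k _; rewrite deriveZ//; exact: diff_derivable.
Qed.

Lemma lincomb_lipschitz (K Q : R) x x' : 0 <= Q ->
  (forall k, `|g k x - g k x'| <= K * `|x - x'|) ->
  (forall k, `|c k| <= Q) ->
  `|\sum_(k < m) c k * g k x - \sum_(k < m) c k * g k x'| <= m%:R * (Q * K) * `|x - x'|.
Proof.
move=> Q0 gK cQ; rewrite -sumrB -mulrA; apply: norm_sum_le => k.
by rewrite -mulrBr normrM -mulrA ler_pM.
Qed.

End LinearCombination.

Section PathMeasurability.
Context {R : realType} (n : nat) (T : R).
Local Notation LT := (lebesgueT R).

(* G t (w t) is measurable in t along every absolutely continuous w. *)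
Definition path_measurable (G : R -> 'cV[R]_n -> R) : Prop :=
  forall w, absolutely_continuous 0 T w ->
    measurable_fun (`[0, T]%classic : set LT) ((fun t => G t (w t)) : LT -> R).

Lemma ac_measurable (y : R -> R) : absolutely_continuous 0 T y ->
  measurable_fun (`[0, T]%classic : set LT) (y : LT -> R).
Proof.
move=> acy; apply: (@measurable_caratheodory_ac R R T (fun _ x => x)); first exact: acy.
- by move=> x; exact: measurable_cst.
- by move=> t _ x; exact: cvg_id.
Qed.

(** A partial derivative is the limit of difference quotients, which evaluate [G] along [w] and
    along a translate of [w], again absolutely continuous. *)
Lemma path_measurable_partial G i : path_measurable G ->
  (forall t x, 0 <= t <= T -> derivable (G t) x (delta_mx i 0)) ->
  path_measurable (fun t x => partial i (G t) x).
Proof.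
move=> mG dG w acw.
apply: (@measurable_fun_cvg _ LT R _ (fun k t =>
  k.+1%:R * (G t (w t + k.+1%:R^-1 *: delta_mx i 0) - G t (w t)))) => [k|t /=].
  apply: measurable_funM; first exact: measurable_cst.
  apply: measurable_funB; last exact: mG.
  apply: (mG (fun t => w t + k.+1%:R^-1 *: delta_mx i 0)).
  move=> e /acw[d d0 Hd]; exists d => // N s t h1 h2 h3.
  have := Hd N s t h1 h2 h3; congr (_ < _); apply: eq_bigr => j _.
  by rewrite opprD addrACA subrr addr0.
rewrite in_itv/= => tT; have := dG t (w t) tT.
move=> /cvgr_dnbhsP; rewrite -/(partial i (G t) (w t)) => /(_ (fun k => k.+1%:R^-1)).
have h0 : (forall k, (k.+1%:R^-1 : R) != 0) /\ (k.+1%:R^-1 : R) @[k --> \oo] --> 0.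
  by split=> [k|]; [rewrite invr_eq0 pnatr_eq0 | exact: cvg_harmonic].
move=> /(_ h0); apply: cvg_trans; apply: near_eq_cvg; apply: nearW => k /=.
by rewrite invrK (addrC (w t)).
Qed.

Lemma path_measurable_lincomb m (g : 'I_m -> R -> 'cV[R]_n -> R) (c : 'I_m -> R -> R) :
  (forall k, path_measurable (g k)) -> (forall k, absolutely_continuous 0 T (c k)) ->
  path_measurable (fun t x => \sum_(k < m) c k t * g k t x).
Proof.
move=> mg acc w acw; apply: measurable_sum => k.
by apply: measurable_funM; [exact: ac_measurable | exact: mg].
Qed.

End PathMeasurability.

(** * Consequences of (S1), (S2) and (S3) for the coordinates of the system *)

Section ControlSystem.
Context {R : realType} {U : metricType R}.
Variables (T : R) (n : nat) (L : R).
Variables (f0 : R -> 'cV[R]_n -> U -> R) (f : R -> 'cV[R]_n -> U -> 'cV[R]_n).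
Local Notation LT := (lebesgueT R).
Hypotheses (L0 : 0 < L) (hS1 : @assumption_S1 R U).
Hypotheses (hS2 : assumption_S2 T f0 f L) (hS3 : assumption_S3 T f0 f L).

(** The factor pays for replacing the Euclidean norms of the assumptions by sup norms; with [n.+1]
    in place of [n] the constant is also at least [L]. *)
Definition system_cst : R := L * n.+1%:R.
Local Notation K := system_cst.

Definition bf k t x u : R := bold_f f0 f t x u k 0.

Lemma bf_cost t x u : bf (lshift n 0) t x u = f0 t x u.
Proof. by rewrite /bf /bold_f col_mxEu !mxE eqxx. Qed.

Lemma bf_state j t x u : bf (rshift 1 j) t x u = f t x u j 0.
Proof. by rewrite /bf /bold_f col_mxEd. Qed.

Lemma system_cst_ge0 : 0 <= K.
Proof. by rewrite mulr_ge0// ltW. Qed.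

Lemma enorm_system (x : 'cV[R]_n) : L * enorm x <= K * `|x|.
Proof.
rewrite /system_cst -mulrA ler_wpM2l ?(ltW L0)//; apply: le_trans (enorm_le_norm _) _.
by rewrite ler_wpM2r// ler_nat.
Qed.

Let itvP t : 0 <= t <= T -> t \in `[0, T].
Proof. by rewrite in_itv. Qed.

Lemma bf_lipschitz k t x x' u : 0 <= t <= T ->
  `|bf k t x u - bf k t x' u| <= K * `|x - x'|.
Proof.
move=> /itvP tT; have [_ _ _ /(_ t x x' u tT) H _] := hS2.
apply: le_trans (enorm_system _); apply: le_trans H.
by have := entry_le_enorm (bold_f f0 f t x u - bold_f f0 f t x' u) k 0; rewrite mxE [X in _ + X]mxE.
Qed.

Lemma bf_bounded0 k t u : 0 <= t <= T -> `|bf k t 0 u| <= K.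
Proof.
move=> /itvP tT; have [_ _ _ _ /(_ t u tT) H] := hS2.
apply: le_trans (entry_le_enorm _ _ _) _; apply: le_trans H _.
by rewrite /system_cst ler_peMr ?(ltW L0)// ler1n.
Qed.

Lemma bf_bounded k t x u : 0 <= t <= T -> `|bf k t x u| <= K * (1 + `|x|).
Proof.
move=> tT; rewrite -[bf k t x u](subrK (bf k t 0 u)).
apply: le_trans (ler_normD _ _) _; rewrite mulrDr mulr1 addrC lerD ?bf_bounded0//.
by have := bf_lipschitz k x 0 u tT; rewrite subr0.
Qed.

Lemma bf_differentiable k t u x : 0 <= t <= T ->
  differentiable (fun y => bf k t y u) x.
Proof.
move=> /itvP tT; have [_ _ /(_ t u tT)[/(_ x) dx _] _ _] := hS2.
apply: (@differentiable_comp _ _ _ _ (fun y => bold_f f0 f t y u) (fun M => M k 0)) => //.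
exact: differentiable_coord.
Qed.

Lemma bf_partial_lipschitz k i t x x' u : 0 <= t <= T ->
  `|partial i (fun y => bf k t y u) x - partial i (fun y => bf k t y u) x'| <= K * `|x - x'|.
Proof.
move=> /itvP tT; have [_ /(_ t x x' u tT) H] := hS3.
apply: le_trans (enorm_system _); apply: le_trans H.
have := entry_le_enorm (bold_f_x f0 f t x u - bold_f_x f0 f t x' u) i k.
by rewrite !mxE.
Qed.

Lemma bf_partial_differentiable k i t u x : 0 <= t <= T ->
  differentiable (partial i (fun y => bf k t y u)) x.
Proof.
move=> /itvP tT; have [/(_ t u tT)[_ /(_ x) dx _] _] := hS3.
have -> : partial i (fun y => bf k t y u) =
    (fun M : 'M[R]_(n, 1 + n) => M i k) \o jacobianT (fun y => bold_f f0 f t y u).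
  by apply/funext => y; rewrite /= mxE.
by apply: differentiable_comp => //; exact: differentiable_coord.
Qed.

Lemma bf_continuous k t : 0 <= t <= T ->
  continuous (fun p : 'cV[R]_n * U => bf k t p.1 p.2).
Proof.
move=> /itvP tT p; have [_ /(_ t tT p) cf _ _ _] := hS2.
apply: (@continuous_comp _ _ _ (fun p : 'cV[R]_n * U => bold_f f0 f t p.1 p.2)
  (fun M : 'cV[R]_(1 + n) => M k 0)); [exact: cf | exact: coord_continuous].
Qed.

Lemma bf_continuous_control k t x : 0 <= t <= T -> continuous (bf k t x).
Proof.
move=> tT u; apply: (@continuous_comp _ _ _ (fun u => (x, u)) (fun p => bf k t p.1 p.2)).
  move=> A [[B C] /= [Bx Cu] BCA]; apply: filterS Cu => w Cw; apply: BCA.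
  by split => //=; exact: nbhs_singleton.
exact: bf_continuous.
Qed.

(** Superposition is used twice: with the state frozen, in the control, where separability of [U]
    enters; then in the state, along the path. *)
Lemma bf_path_measurable k (v : R -> U) : U_ad T v ->
  path_measurable T (fun t x => bf k t x (v t)).
Proof.
move=> mv w acw.
apply: (@measurable_caratheodory_ac R _ T (fun t x => bf k t x (v t)) w acw); last first.
- move=> t tT x.
  apply: (@continuous_comp _ _ _ (fun x => (x, v t)) (fun p => bf k t p.1 p.2)).
    move=> A [[B C] /= [Bx Cu] BCA]; apply: filterS Bx => y By; apply: BCA.
    by split => //=; exact: nbhs_singleton.
  exact: bf_continuous.
- move=> x.
  apply: (@measurable_caratheodory_metric R U `[0, T]%classic (fun t u => bf k t x u) v
    (measurable_itv_lebesgue _) hS1 mv).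
  + move=> u; have [/(_ x u) mf _ _ _ _] := hS2.
    move=> mD; apply: (measurability _ (RGenOInfty.measurableE R)) => //.
    move=> _ [_ [r ->] <-].
    apply: (mf ((fun M : 'cV[R]_(1 + n) => M k 0) @^-1` `]r, +oo[)).
    apply: sub_sigma_algebra; apply: open_comp; last exact: interval_open.
    by move=> M _; exact: coord_continuous.
  + by move=> t /=; rewrite in_itv/=; exact: bf_continuous_control.
Qed.

Lemma state_exists (v : R -> U) (x0 : 'cV[R]_n) : 0 <= T -> U_ad T v ->
  exists y, is_state T x0 f v y.
Proof.
move=> T0 mv.
apply: (@picard_exists R T K n x0 (fun t y => f t y (v t)) T0 system_cst_ge0).
- move=> w i acw; have := bf_path_measurable (rshift 1 i) mv acw.
  suff -> : (fun t => f t (w t) (v t) i 0) = (fun t => bf (rshift 1 i) t (w t) (v t)) by [].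
  by apply/funext => t; rewrite bf_state.
- move=> t x y tT; apply: mx_norm_le => [|i j].
    by rewrite mulr_ge0// system_cst_ge0.
  rewrite (ord1 j) !mxE -!bf_state; exact: bf_lipschitz.
- move=> t tT; apply: mx_norm_le => [|i j]; first exact: system_cst_ge0.
  by rewrite (ord1 j) -bf_state; exact: bf_bounded0.
Qed.

(** The assumptions give continuity in the control for the functions themselves. It passes to the
    partial derivatives because, by the Lipschitz gradient, a difference quotient of step [h] is
    within [n%:R * K * h] of the derivative, uniformly in the control. *)
Lemma bf_partial_continuous_control k i t x : 0 <= t <= T ->
  continuous (fun u => partial i (fun y => bf k t y u) x).
Proof.
move=> tT u; apply/cvgrPdist_lt => e e0.
have K0 := system_cst_ge0.
pose c := n%:R * K + 1; have c0 : 0 < c by rewrite ltr_wpDl// mulr_ge0.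
(* With this step both Taylor errors and both continuity errors are at most [h * e / 4]. *)
pose h := e / (4 * c); have h0 : 0 < h by rewrite divr_gt0// mulr_gt0.
pose z : 'cV[R]_n := h *: delta_mx i 0.
have zn : `|z| <= h.
  rewrite normrZ gtr0_norm// ler_piMr ?(ltW h0)//.
  by apply: mx_norm_le => // a b; rewrite mxE; case: (_ && _); rewrite ?normr1 ?normr0.
have zi (P : 'I_n -> R) : \sum_(j < n) z j 0 * P j = h * P i.
  rewrite (bigD1 i)//= big1 => [|j ji]; first by rewrite !mxE !eqxx mulr1 addr0.
  by rewrite !mxE (negbTE ji) mulr0 mul0r.
have T1 w : `|bf k t (x + z) w - bf k t x w - h * partial i (fun y => bf k t y w) x| <= n%:R * K * h ^+ 2.
  have := @taylor1 R n (fun y => bf k t y w) x z K K0 (fun y => bf_differentiable k w y tT)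
    (fun j y y' => bf_partial_lipschitz k j y y' w tT).
  rewrite zi => /le_trans; apply; rewrite ler_wpM2l ?(mulr_ge0 _ K0)//.
  by rewrite ler_pXn2r ?nnegrE ?(ltW h0).
have he : 0 < h * e / 4 by rewrite !divr_gt0// mulr_gt0.
have /cvgrPdist_lt/(_ _ he) C1 := @bf_continuous_control k t (x + z) tT u.
have /cvgrPdist_lt/(_ _ he) C2 := @bf_continuous_control k t x tT u.
near=> w.
have h1 : `|bf k t (x + z) u - bf k t (x + z) w| < h * e / 4 by near: w.
have h2 : `|bf k t x u - bf k t x w| < h * e / 4 by near: w.
have h3 := T1 u; have h4 := T1 w.
have h5 : n%:R * K * h ^+ 2 <= h * e / 4.
  have -> : h * e / 4 = c * h ^+ 2 by rewrite /h; field; rewrite gt_eqF.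
  by rewrite ler_wpM2r ?sqr_ge0// lerDl.
rewrite -(ltr_pM2l h0) -[X in X * _]gtr0_norm// -normrM.
move: h1 h2 h3 h4; rewrite mulrBr !ltr_norml !ler_norml.
move=> /andP[? ?] /andP[? ?] /andP[? ?] /andP[? ?].
by apply/andP; split; lra.
Unshelve. all: by end_near. Qed.

End ControlSystem.

(** * Inner products, matrix-valued paths and Gronwall's inequality *)

Section DotProduct.
Context {R : realType} (n : nat).
Implicit Types (a b c : 'cV[R]_n) (A B : 'M[R]_n).

Lemma dotpC a b : dotp a b = dotp b a.
Proof. by apply: eq_bigr => i _; rewrite mulrC. Qed.

Lemma dotpDl a b c : dotp (a + b) c = dotp a c + dotp b c.
Proof. by rewrite -big_split/=; apply: eq_bigr => i _; rewrite mxE mulrDl. Qed.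

Lemma dotpDr a b c : dotp a (b + c) = dotp a b + dotp a c.
Proof. by rewrite dotpC dotpDl !(dotpC a). Qed.

Lemma dotpZl k a b : dotp (k *: a) b = k * dotp a b.
Proof. by rewrite mulr_sumr; apply: eq_bigr => i _; rewrite mxE mulrA. Qed.

Lemma dotpZr k a b : dotp a (k *: b) = k * dotp a b.
Proof. by rewrite dotpC dotpZl dotpC. Qed.

Lemma dotpNl a b : dotp (- a) b = - dotp a b.
Proof. by rewrite -scaleN1r dotpZl mulN1r. Qed.

Lemma dotpNr a b : dotp a (- b) = - dotp a b.
Proof. by rewrite dotpC dotpNl dotpC. Qed.

Lemma dotpBl a b c : dotp (a - b) c = dotp a c - dotp b c.
Proof. by rewrite dotpDl dotpNl. Qed.

Lemma dotpBr a b c : dotp a (b - c) = dotp a b - dotp a c.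
Proof. by rewrite dotpDr dotpNr. Qed.

Lemma dotpE a b : dotp a b = (a^T *m b) 0 0.
Proof. by rewrite mxE; apply: eq_bigr => i _; rewrite mxE. Qed.

Lemma dotp_mull A a b : dotp (A *m a) b = dotp a (A^T *m b).
Proof. by rewrite !dotpE trmx_mul mulmxA. Qed.

Lemma dotp_le a b : `|dotp a b| <= n%:R * (`|a| * `|b|).
Proof.
by apply: norm_sum_le => i; rewrite normrM ler_pM//; exact: mx_entry_le_norm.
Qed.

Lemma mulmx_le A a : `|A *m a| <= n%:R * (`|A| * `|a|).
Proof.
apply: mx_norm_le => [|i j]; first by rewrite !mulr_ge0.
by rewrite mxE; apply: norm_sum_le => k; rewrite normrM ler_pM//; exact: mx_entry_le_norm.
Qed.

Lemma trmx_le A : `|A^T| <= `|A|.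
Proof. by apply: mx_norm_le => // i j; rewrite mxE; exact: mx_entry_le_norm. Qed.

End DotProduct.

Section MatrixDerivative.
Context {R : realType} (T : R).

Definition mx_ac_derive m n (y dy : R -> 'M[R]_(m, n)) : Prop :=
  forall i j, ac_derive T (fun t => y t i j) (fun t => dy t i j).

Lemma caratheodory_mx_ac_derive m n (F : R -> 'M[R]_(m, n) -> 'M[R]_(m, n))
    (y : R -> 'M[R]_(m, n)) :
  caratheodory_solution T F y -> mx_ac_derive y (fun t => F t (y t)).
Proof.
move=> [acy dy] i j; split; first exact: ac_coord.
by apply: ae_imply dy => t H /H; exact: is_derive_coord.
Qed.

Lemma mx_ac_deriveB m n (y z dy dz : R -> 'M[R]_(m, n)) :
  mx_ac_derive y dy -> mx_ac_derive z dz ->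
  mx_ac_derive (fun t => y t - z t) (fun t => dy t - dz t).
Proof.
move=> Hy Hz i j; have := ac_deriveB (Hy i j) (Hz i j).
by congr ac_derive; apply/funext => t; rewrite !mxE.
Qed.

Lemma mx_ac_deriveM m n p (y dy : R -> 'M[R]_(m, n)) (z dz : R -> 'M[R]_(n, p)) :
  mx_ac_derive y dy -> mx_ac_derive z dz ->
  mx_ac_derive (fun t => y t *m z t) (fun t => dy t *m z t + y t *m dz t).
Proof.
move=> Hy Hz i j.
have := ac_derive_sum (fun k => ac_deriveM (Hy i k) (Hz k j)).
by congr ac_derive; apply/funext => t; rewrite !mxE ?big_split.
Qed.

Lemma ac_derive_dotp n (y dy z dz : R -> 'cV[R]_n) :
  mx_ac_derive y dy -> mx_ac_derive z dz ->
  ac_derive T (fun t => dotp (y t) (z t)) (fun t => dotp (dy t) (z t) + dotp (y t) (dz t)).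
Proof.
move=> Hy Hz; have := ac_derive_sum (fun k => ac_deriveM (Hy k 0) (Hz k 0)).
by congr ac_derive; apply/funext => t; rewrite /dotp ?big_split.
Qed.

(* The weight [expR (2 * K * t)] turns the Lipschitz term into half of the
   weighted supremum of z. *)
Lemma gronwall n (z dz : R -> 'cV[R]_n) (alpha c : R -> R) (K : R) :
  0 <= K -> absolutely_continuous 0 T z -> mx_ac_derive z dz -> z 0 = 0 ->
  ac_derive T alpha c -> alpha 0 = 0 -> (forall t, 0 <= t <= T -> 0 <= c t) ->
  (forall t i, 0 <= t <= T -> `|dz t i 0| <= K * `|z t| + c t) ->
  forall t, 0 <= t <= T -> `|z t| <= 2 * expR (2 * K * t) * alpha t.
Proof.
move=> K0 acz dzz z0 da a0 c0 Hdz tau /andP[tau0 tauT].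
have K20 : 0 <= 2 * K by rewrite mulr_ge0.
have eT := ac_derive_expR T K20.
(* The supremum stops at [tau], so that the final bound involves [alpha tau]. It is finite because
   [z] is bounded, so [S / 2] can be absorbed. *)
pose S := sup [set `|z t| / expR (2 * K * t) | t in `[0, tau]].
have [B B0 HB] := ac_bounded acz.
have E1 t : 0 <= t -> 1 <= expR (2 * K * t).
  by move=> t0; rewrite -[leLHS]expR0 ler_expR mulr_ge0.
have hs : has_sup [set `|z t| / expR (2 * K * t) | t in `[0, tau]].
  split; first by exists (`|z 0| / expR (2 * K * 0)); exists 0 => //=; rewrite in_itv/= lexx.
  exists B => y [t]; rewrite /= in_itv/= => /andP[t0 tt] <-.
  rewrite ler_pdivrMr ?expR_gt0// (le_trans (HB t _)) ?t0 ?(le_trans tt)//.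
  by rewrite ler_peMr// E1.
have zS t : 0 <= t <= tau -> `|z t| <= S * expR (2 * K * t).
  move=> tt; rewrite -ler_pdivrMr ?expR_gt0//; apply: sup_upper_bound => //.
  by exists t.
have S0 : 0 <= S by have := zS 0; rewrite z0 normr0 mulr0 expR0 mulr1 lexx => /(_ tau0).
have zb t : 0 <= t <= tau -> `|z t| <= alpha t + S / 2 * expR (2 * K * t).
  move=> /andP[t0 tt]; have tT := le_trans tt tauT.
  have e2 := ac_deriveD da (ac_deriveZ (S / 2) eT).
  have dzle s : 0 < s < t -> forall i, `|dz s i 0| <= c s + S / 2 * (2 * K * expR (2 * K * s)).
    move=> /andP[s0 st] i.
    have sT : 0 <= s <= T by rewrite (ltW s0) (le_trans (ltW st) tT).
    apply: le_trans (Hdz s i sT) _; rewrite addrC lerD2l.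
    have -> : S / 2 * (2 * K * expR (2 * K * s)) = K * (S * expR (2 * K * s)) by field.
    by rewrite ler_wpM2l// zS// (ltW s0) (le_trans (ltW st) tt).
  have pos : 0 <= alpha t + S / 2 * expR (2 * K * t).
    rewrite addr_ge0 ?mulr_ge0 ?divr_ge0 ?expR_ge0// -a0.
    apply: (ac_derive_nondecreasing da (lexx 0) t0 tT); apply: aeW => s /andP[s0 st].
    by apply: c0; rewrite (ltW s0) (le_trans (ltW st) tT).
  apply: mx_norm_le => // i j; rewrite (ord1 j).
  have zi0 : z 0 i 0 = 0 by rewrite z0 mxE.
  have S20 : 0 <= S / 2 by rewrite divr_ge0.
  have h1 := ac_derive_nondecreasing (ac_deriveB e2 (dzz i 0)) (lexx 0) t0 tT.
  have h2 := ac_derive_nondecreasing (ac_deriveD e2 (dzz i 0)) (lexx 0) t0 tT.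
  move: h1 h2; rewrite zi0 a0 add0r subr0 addr0 mulr0 expR0 mulr1 => h1 h2.
  have {}h1 : S / 2 <= alpha t + S / 2 * expR (2 * K * t) - z t i 0.
    by apply: h1; apply: aeW => s /dzle/(_ i); rewrite ler_norml => /andP[? ?]; lra.
  have {}h2 : S / 2 <= alpha t + S / 2 * expR (2 * K * t) + z t i 0.
    by apply: h2; apply: aeW => s /dzle/(_ i); rewrite ler_norml => /andP[? ?]; lra.
  by rewrite ler_norml; apply/andP; split; lra.
have SA : S <= alpha tau + S / 2.
  apply: ge_sup; first exact: hs.1.
  move=> y [t]; rewrite /= in_itv/= => tt <-; have /andP[t0 tt'] := tt.
  rewrite ler_pdivrMr ?expR_gt0//; apply: le_trans (zb t tt) _.
  have at_ : alpha t <= alpha tau.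
    apply: (ac_derive_nondecreasing da t0 tt' tauT); apply: aeW => s /andP[s0 st].
    by apply: c0; rewrite (le_trans t0 (ltW s0)) (le_trans (ltW st) tauT).
  have at0 : 0 <= alpha t.
    rewrite -a0; apply: (ac_derive_nondecreasing da (lexx 0) t0 (le_trans tt' tauT)).
    apply: aeW => s /andP[s0 st].
    by apply: c0; rewrite (ltW s0) (le_trans (ltW st) (le_trans tt' tauT)).
  rewrite [leRHS]mulrDl lerD2r; apply: (le_trans at_); rewrite ler_peMr ?E1//.
  exact: le_trans at_.
have Sa : S <= 2 * alpha tau by lra.
have := zS tau; rewrite tau0 lexx => /(_ isT)/le_trans; apply.
by rewrite [leRHS]mulrAC ler_wpM2r ?expR_ge0.
Qed.

End MatrixDerivative.

Lemma continuous_lincomb (R : realType) (X : topologicalType) m (c : 'I_m -> R)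
    (g : 'I_m -> X -> R) : (forall k, continuous (g k)) ->
  continuous (fun u => \sum_(k < m) c k * g k u).
Proof.
elim: m c g => [|m IH] c g cg u.
  have -> : (fun u : X => \sum_(k < 0) c k * g k u) = (fun=> 0).
    by apply/funext => w; rewrite big_ord0.
  exact: cvg_cst.
have -> : (fun u : X => \sum_(k < m.+1) c k * g k u) =
    (fun u => c ord0 * g ord0 u + \sum_(k < m) c (lift ord0 k) * g (lift ord0 k) u).
  by apply/funext => w; rewrite big_ord_recl.
apply: cvgD; first by apply: cvgM; [exact: cvg_cst | exact: cg].
exact: (IH (fun k => c (lift ord0 k)) (fun k => g (lift ord0 k))).
Qed.

(** * Regularity of the Hamiltonian *)

Section Hamiltonian.
Context {R : realType} {U : metricType R}.
Variables (T : R) (n : nat) (L : R).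
Variables (f0 : R -> 'cV[R]_n -> U -> R) (f : R -> 'cV[R]_n -> U -> 'cV[R]_n).
Hypotheses (L0 : 0 < L) (hS1 : @assumption_S1 R U).
Hypotheses (hS2 : assumption_S2 T f0 f L) (hS3 : assumption_S3 T f0 f L).
Local Notation K := (system_cst n L).
Local Notation bf := (bf f0 f).
Local Notation H := (H f0 f).

Lemma dotp_gradient (g : 'cV[R]_n -> R) x z :
  dotp (gradient g x) z = \sum_(i < n) z i 0 * partial i g x.
Proof. by apply: eq_bigr => i _; rewrite mxE mulrC. Qed.

Lemma dotp_hessian (g : 'cV[R]_n -> R) x z :
  dotp (hessian g x *m z) z =
  \sum_(j < n) \sum_(i < n) z j 0 * z i 0 * partial i (partial j g) x.
Proof.
rewrite exchange_big/=; apply: eq_bigr => i _; rewrite mxE mulr_suml.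
by apply: eq_bigr => j _; rewrite mxE; ring.
Qed.

(** The vector [(-1, psi)]: with these coefficients [H] is a linear combination of the coordinates
    of [bold_f], and each regularity property of [H] follows from that of the coordinates. *)
Definition hcoef (psi : 'cV[R]_n) (k : 'I_(1 + n)) : R := col_mx (-1)%:M psi k 0.

Lemma hcoef_cost psi : hcoef psi (lshift n 0) = -1.
Proof. by rewrite /hcoef col_mxEu mxE eqxx. Qed.

Lemma hcoef_state psi j : hcoef psi (rshift 1 j) = psi j 0.
Proof. by rewrite /hcoef col_mxEd. Qed.

Lemma hcoef_le psi k (Q : R) : `|psi| <= Q -> `|hcoef psi k| <= Q + 1.
Proof.
move=> pQ; have Q0 : 0 <= Q by exact: le_trans pQ.
rewrite /hcoef mxE; case: (fintype.split k) => i.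
  by rewrite mxE (ord1 i) eqxx mulr1n normrN1 lerDr.
by rewrite (le_trans (mx_entry_le_norm _ _ _))// (le_trans pQ)// lerDl.
Qed.

Lemma H_bf t x u psi : H t x u psi = \sum_(k < 1 + n) hcoef psi k * bf k t x u.
Proof.
rewrite big_split_ord/= big_ord1 hcoef_cost bf_cost mulN1r addrC /H; congr (_ - _).
by apply: eq_bigr => j _; rewrite hcoef_state bf_state mulrC.
Qed.

Lemma H_fun t u psi :
  (fun y => H t y u psi) = (fun y => \sum_(k < 1 + n) hcoef psi k * bf k t y u).
Proof. by apply/funext => y; exact: H_bf. Qed.

Definition hamiltonian_cst (Q : R) : R := (1 + n)%:R * ((Q + 1) * K).
Local Notation KH := hamiltonian_cst.

Lemma hamiltonian_cst_ge0 Q : 0 <= Q -> 0 <= KH Q.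
Proof. by move=> Q0; rewrite !mulr_ge0 ?addr_ge0// (ltW L0). Qed.

Lemma H_differentiable t u psi x : 0 <= t <= T -> differentiable (fun y => H t y u psi) x.
Proof.
by move=> tT; rewrite H_fun; apply: differentiable_lincomb => k; exact: (bf_differentiable hS2).
Qed.

Lemma H_partialE i t u psi x : 0 <= t <= T ->
  partial i (fun y => H t y u psi) x =
  \sum_(k < 1 + n) hcoef psi k * partial i (fun y => bf k t y u) x.
Proof.
by move=> tT; rewrite H_fun partial_lincomb// => k; exact: (bf_differentiable hS2).
Qed.

Lemma H_partial_fun i t u psi : 0 <= t <= T ->
  partial i (fun y => H t y u psi) =
  (fun x => \sum_(k < 1 + n) hcoef psi k * partial i (fun y => bf k t y u) x).
Proof. by move=> tT; apply/funext => x; exact: H_partialE. Qed.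

Lemma H_partial_differentiable i t u psi x : 0 <= t <= T ->
  differentiable (partial i (fun y => H t y u psi)) x.
Proof.
move=> tT; rewrite H_partial_fun//; apply: differentiable_lincomb => k.
exact: (bf_partial_differentiable hS3).
Qed.

Lemma H_partial_lipschitz (Q : R) i t u psi x x' : 0 <= t <= T -> `|psi| <= Q ->
  `|partial i (fun y => H t y u psi) x - partial i (fun y => H t y u psi) x'|
  <= KH Q * `|x - x'|.
Proof.
move=> tT pQ; have Q0 : 0 <= Q by exact: le_trans pQ.
rewrite !H_partialE//; apply: (@lincomb_lipschitz R n (1 + n)
  (fun k => partial i (fun y => bf k t y u))) => [|k|k]; first by rewrite addr_ge0.
- exact: (bf_partial_lipschitz L0 hS3).
- exact: hcoef_le.
Qed.

Lemma H_lipschitz (Q : R) t u psi x x' : 0 <= t <= T -> `|psi| <= Q ->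
  `|H t x u psi - H t x' u psi| <= KH Q * `|x - x'|.
Proof.
move=> tT pQ; have Q0 : 0 <= Q by exact: le_trans pQ.
rewrite !H_bf; apply: (@lincomb_lipschitz R n (1 + n) (fun k y => bf k t y u)) => [|k|k].
- by rewrite addr_ge0.
- exact: (bf_lipschitz L0 hS2).
- exact: hcoef_le.
Qed.

Lemma H_partial_bounded (Q : R) i t u psi x : 0 <= t <= T -> `|psi| <= Q ->
  `|partial i (fun y => H t y u psi) x| <= KH Q.
Proof.
move=> tT pQ; have Q0 : 0 <= Q by exact: le_trans pQ.
apply: partial_le_lipschitz; first exact: hamiltonian_cst_ge0.
- by move=> y y'; exact: H_lipschitz.
- exact/diff_derivable/H_differentiable.
Qed.

Lemma H_hessian_bounded (Q : R) t u psi x : 0 <= t <= T -> `|psi| <= Q ->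
  `|H_xx f0 f t x u psi| <= KH Q.
Proof.
move=> tT pQ; have Q0 : 0 <= Q by exact: le_trans pQ.
apply: mx_norm_le => [|i j]; first exact: hamiltonian_cst_ge0.
rewrite mxE; apply: partial_le_lipschitz; first exact: hamiltonian_cst_ge0.
- by move=> y y'; exact: H_partial_lipschitz.
- exact/diff_derivable/H_partial_differentiable.
Qed.

Lemma H_gradient_bounded (Q : R) t u psi x : 0 <= t <= T -> `|psi| <= Q ->
  `|H_x f0 f t x u psi| <= KH Q.
Proof.
move=> tT pQ; have Q0 : 0 <= Q by exact: le_trans pQ.
apply: mx_norm_le => [|i j]; first exact: hamiltonian_cst_ge0.
by rewrite mxE; exact: H_partial_bounded.
Qed.

Lemma f_fun j t u : (fun y => f t y u j 0) = (fun y => bf (rshift 1 j) t y u).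
Proof. by apply/funext => y; rewrite bf_state. Qed.

Lemma f_x_bounded t x u : 0 <= t <= T -> `|f_x f t x u| <= K.
Proof.
move=> tT; apply: mx_norm_le => [|i j]; first exact: system_cst_ge0.
rewrite mxE f_fun; apply: partial_le_lipschitz; first exact: system_cst_ge0.
- by move=> y y'; exact: (bf_lipschitz L0 hS2).
- exact/diff_derivable/(bf_differentiable hS2).
Qed.

(** Shows that the right-hand side of the adjoint equation is minus the gradient of the Hamiltonian,
    which is what cancels the first order terms in [z]. *)
Lemma H_xE t x u psi : 0 <= t <= T ->
  H_x f0 f t x u psi = f_x f t x u *m psi - f0_x f0 t x u.
Proof.
move=> tT; apply/matrixP => i j; rewrite (ord1 j) !mxE H_partialE//.
rewrite big_split_ord/= big_ord1 hcoef_cost mulN1r addrC; congr (_ - _).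
- apply: eq_bigr => k _; rewrite hcoef_state mxE mulrC f_fun.
  by [].
- by congr (partial i _ x); apply/funext => y; rewrite bf_cost.
Qed.

Lemma f_lipschitz t x x' u : 0 <= t <= T -> `|f t x u - f t x' u| <= K * `|x - x'|.
Proof.
move=> tT; apply: mx_norm_le => [|i j].
  by rewrite mulr_ge0//; exact: system_cst_ge0.
by rewrite (ord1 j) !mxE -!(bf_state f0); exact: (bf_lipschitz L0 hS2).
Qed.

Lemma f_bounded t x u : 0 <= t <= T -> `|f t x u| <= K * (1 + `|x|).
Proof.
move=> tT; apply: mx_norm_le => [|i j].
  by rewrite mulr_ge0 ?addr_ge0//; exact: system_cst_ge0.
by rewrite (ord1 j) -(bf_state f0); exact: (bf_bounded L0 hS2).
Qed.

Lemma f_taylor t x z u : 0 <= t <= T ->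
  `|f t (x + z) u - f t x u - (f_x f t x u)^T *m z| <= n%:R * K * `|z| ^+ 2.
Proof.
move=> tT; have K0 : 0 <= K by exact: system_cst_ge0.
apply: mx_norm_le => [|i j]; first by apply: mulr_ge0; [exact: mulr_ge0 | exact: exprn_ge0].
rewrite (ord1 j); have := @taylor1 R n (fun y => bf (rshift 1 i) t y u) x z K K0
  (fun y => bf_differentiable hS2 (rshift 1 i) u y tT)
  (fun k y y' => bf_partial_lipschitz L0 hS3 (rshift 1 i) k y y' u tT).
congr (`|_| <= _); rewrite !bf_state !mxE; congr (_ - _); apply: eq_bigr => k _.
by rewrite !mxE mulrC -f_fun.
Qed.

Lemma H_taylor (Q : R) t x z u psi : 0 <= t <= T -> `|psi| <= Q ->
  `|H t (x + z) u psi - H t x u psi - dotp (H_x f0 f t x u psi) z|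
  <= n%:R * KH Q * `|z| ^+ 2.
Proof.
move=> tT pQ; have Q0 : 0 <= Q by exact: le_trans pQ.
rewrite dotp_gradient; apply: (@taylor1 R n (fun y => H t y u psi) x z).
- exact: hamiltonian_cst_ge0.
- by move=> y; exact: H_differentiable.
- by move=> i y y'; exact: H_partial_lipschitz.
Qed.

Lemma H_continuous_control t x psi : 0 <= t <= T -> continuous (fun u => H t x u psi).
Proof.
move=> tT; have -> : (fun u => H t x u psi) = (fun u => \sum_(k < 1 + n) hcoef psi k * bf k t x u).
  by apply/funext => u; exact: H_bf.
by apply: continuous_lincomb => k; exact: (bf_continuous_control hS2).
Qed.

Lemma H_partial_continuous_control i t x psi : 0 <= t <= T ->
  continuous (fun u => partial i (fun y => H t y u psi) x).
Proof.
move=> tT; have -> : (fun u => partial i (fun y => H t y u psi) x) =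
    (fun u => \sum_(k < 1 + n) hcoef psi k * partial i (fun y => bf k t y u) x).
  by apply/funext => u; exact: H_partialE.
apply: (continuous_lincomb (g := fun k u => partial i (fun y => bf k t y u) x)) => k.
exact: (bf_partial_continuous_control L0 hS2 hS3).
Qed.

Lemma H_path_measurable (v : R -> U) (psi : R -> 'cV[R]_n) :
  U_ad T v -> absolutely_continuous 0 T psi ->
  path_measurable T (fun t x => H t x (v t) (psi t)).
Proof.
move=> mv acp.
have -> : (fun t x => H t x (v t) (psi t)) =
    (fun t x => \sum_(k < 1 + n) hcoef (psi t) k * bf k t x (v t)).
  by apply/funext => t; apply/funext => x; exact: H_bf.
apply: path_measurable_lincomb => k; first exact: (bf_path_measurable hS1 hS2).
rewrite /hcoef -(splitK k); case: (fintype.split k) => j /=.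
  under eq_fun do rewrite col_mxEu.
  exact: (ac_derive_cst T ((-1)%:M j 0)).1.
by under eq_fun do rewrite col_mxEd; exact: ac_coord.
Qed.

End Hamiltonian.

Local Ltac nonneg := repeat (first [done | apply: mulr_ge0 | apply: addr_ge0]).

(** * Expansions along the reference trajectory *)

Section Reference.
Context {R : realType} {U : metricType R}.
Variables (T : R) (n : nat) (L : R).
Variables (f0 : R -> 'cV[R]_n -> U -> R) (f : R -> 'cV[R]_n -> U -> 'cV[R]_n).
Local Notation LT := (lebesgueT R).
Hypotheses (L0 : 0 < L) (hS1 : @assumption_S1 R U).
Hypotheses (hS2 : assumption_S2 T f0 f L) (hS3 : assumption_S3 T f0 f L).
Local Notation K := (system_cst n L).
Local Notation H := (H f0 f).
Variables (ub : R -> U) (xb psi : R -> 'cV[R]_n) (W : R -> 'M[R]_n).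
Hypotheses (mub : U_ad T ub) (acx : absolutely_continuous 0 T xb).
Hypotheses (acp : absolutely_continuous 0 T psi) (acW : absolutely_continuous 0 T W).

Definition df t u : 'cV[R]_n := f t (xb t) u - f t (xb t) (ub t).
Definition Hx t u : 'cV[R]_n := H_x f0 f t (xb t) u (psi t).
Definition Hxx t : 'M[R]_n := H_xx f0 f t (xb t) (ub t) (psi t).
Definition dH t u : R := H t (xb t) u (psi t) - H t (xb t) (ub t) (psi t).
(* The gradient in [z] at [z = 0] of the part of [rate t u z] caused by [u]
   (see [rate_on]); the inequality of the theorem is [dotp (bb t u) (df t u) <= 0]. *)
Definition bb t u : 'cV[R]_n :=
  Hx t u - Hx t (ub t) + 2^-1 *: (W t *m df t u + (W t)^T *m df t u).

(** At [u = ub t] this is the second order Taylor remainder of the Hamiltonian; for other [u] it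
    also contains the jump [dH t u]. *)
Definition taylor_rem t u z : R := H t (xb t + z) u (psi t) - H t (xb t) (ub t) (psi t)
  - dotp (Hx t (ub t)) z - 2^-1 * dotp (Hxx t *m z) z.
Definition drift t u z : 'cV[R]_n :=
  f t (xb t + z) u - f t (xb t) (ub t) - (f_x f t (xb t) (ub t))^T *m z.
(** What remains of the derivative of [lyapunov] after both adjoint equations have been used.
    Symmetry of [W t] is not at hand, hence the average over [W t] and its transpose. *)
Definition rate t u z : R := taylor_rem t u z +
  2^-1 * (dotp (W t *m z) (drift t u z) + dotp ((W t)^T *m z) (drift t u z)).

Lemma le_sum5 (a b c d e : R) : 0 <= a -> 0 <= b -> 0 <= c -> 0 <= d -> 0 <= e ->
  [/\ a <= a + b + c + d + e, b <= a + b + c + d + e, c <= a + b + c + d + e,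
      d <= a + b + c + d + e & e <= a + b + c + d + e].
Proof. by move=> *; split; lra. Qed.

Lemma half_sum_le (x y B : R) : `|x| <= B -> `|y| <= B -> `|2^-1 * (x + y)| <= B.
Proof. by rewrite !ler_norml => /andP[? ?] /andP[? ?]; apply/andP; split; lra. Qed.

Lemma dotp_mul_le (A : 'M[R]_n) (z g : 'cV[R]_n) (a b : R) : `|A| <= a -> `|g| <= b ->
  `|dotp (A *m z) g| <= n%:R * (n%:R * (a * `|z|) * b).
Proof.
move=> Aa gb; apply: le_trans (dotp_le _ _) _; rewrite ler_wpM2l// ler_pM//.
by apply: le_trans (mulmx_le _ _) _; rewrite ler_wpM2l// ler_wpM2r.
Qed.

(** Isolates the first order jump and the linear term in [z]; each line on the right is quadratic in
    [z]. In the last one [drift - df] is linear in [z], since [drift] reduces to [df] at [z = 0]. *)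
Lemma rate_on t u z : rate t u z - dH t u - dotp (bb t u) z =
  (H t (xb t + z) u (psi t) - H t (xb t) u (psi t) - dotp (Hx t u) z)
  - 2^-1 * dotp (Hxx t *m z) z
  + 2^-1 * (dotp (W t *m z) (drift t u z - df t u) + dotp ((W t)^T *m z) (drift t u z - df t u)).
Proof.
rewrite /rate /taylor_rem /dH /bb; move: (drift t u z) (df t u) => g d.
rewrite dotpDl dotpBl dotpZl dotpDl !dotpBr.
have -> : dotp (W t *m d) z = dotp ((W t)^T *m z) d by rewrite dotp_mull dotpC.
have -> : dotp ((W t)^T *m d) z = dotp (W t *m z) d by rewrite dotp_mull dotpC trmxK.
by field.
Qed.

(** For the reference control [drift] is a Taylor remainder, quadratic in [z], so its pairing with
    [W t *m z] is cubic. For another control [drift] contains [df], whose pairing with [W t *m z]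
    goes into [bb]. The third bound serves domination. The five constants are added to obtain a
    single one. *)
Lemma expansion : exists2 C : R, 0 <= C & forall t, 0 <= t <= T ->
  [/\ (forall z, `|rate t (ub t) z - taylor_rem t (ub t) z| <= C * `|z| ^+ 3),
      (forall u z, `|rate t u z - dH t u - dotp (bb t u) z| <= C * `|z| ^+ 2),
      (forall z, `|taylor_rem t (ub t) z| <= C * `|z| ^+ 2),
      (forall u, `|df t u| <= C) &
      (forall u, `|bb t u| <= C)].
Proof.
have [X X0 xX] := ac_bounded acx; have [Q Q0 pQ] := ac_bounded acp.
have [B B0 wB] := ac_bounded acW.
have K0 : 0 <= K by exact: system_cst_ge0.
pose KH := hamiltonian_cst n L Q; have KH0 : 0 <= KH by exact: hamiltonian_cst_ge0.
have N0 : 0 <= n%:R :> R by [].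
pose C1 := n%:R * (n%:R * B * (n%:R * K)).
pose C2 := n%:R * KH + n%:R * (n%:R * KH) + n%:R * (n%:R * B * ((1 + n%:R) * K)).
pose C3 := n%:R * KH + n%:R * (n%:R * KH).
pose C4 := 2 * (K * (1 + X)).
pose C5 := 2 * KH + n%:R * (B * C4).
have C10 : 0 <= C1 by rewrite /C1; nonneg.
have C40 : 0 <= C4 by rewrite /C4; nonneg.
have C30 : 0 <= C3 by rewrite /C3; nonneg.
have C20 : 0 <= C2 by rewrite /C2; nonneg.
have C50 : 0 <= C5 by rewrite /C5; nonneg.
have [l1 l2 l3 l4 l5] := le_sum5 C10 C20 C30 C40 C50.
exists (C1 + C2 + C3 + C4 + C5); first by nonneg.
move=> t tT.
have wB' : `|(W t)^T| <= B by rewrite (le_trans (trmx_le _))// wB.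
have Hq z : `|2^-1 * dotp (Hxx t *m z) z| <= n%:R * (n%:R * KH) * `|z| ^+ 2.
  have h : `|dotp (Hxx t *m z) z| <= n%:R * (n%:R * KH) * `|z| ^+ 2.
    have := @dotp_mul_le (Hxx t) z z KH `|z| (H_hessian_bounded L0 hS2 hS3 _ _ tT (pQ t tT)) (lexx _).
    by move=> /le_trans; apply; rewrite expr2 !mulrA.
  rewrite normrM gtr0_norm ?invr_gt0// -[leRHS]mul1r ler_pM// invf_le1// ler1n//.
have dfb u : `|df t u| <= C4.
  have h v : `|f t (xb t) v| <= K * (1 + X).
    apply: le_trans (f_bounded L0 hS2 _ _ tT) _; rewrite ler_wpM2l// lerD2l; exact: xX.
  by apply: le_trans (ler_normB _ _) _; rewrite /C4 mulr_natl mulr2n lerD.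
split=> [z|u z|z|u|u].
- rewrite /rate addrC addKr; apply: (@le_trans _ _ (C1 * `|z| ^+ 3)); last first.
    by rewrite ler_wpM2r// exprn_ge0.
  have dz : `|drift t (ub t) z| <= n%:R * K * `|z| ^+ 2 by exact: (f_taylor L0 hS2 hS3).
  have E : C1 * `|z| ^+ 3 = n%:R * (n%:R * (B * `|z|) * (n%:R * K * `|z| ^+ 2)).
    by rewrite /C1; ring.
  by rewrite E; apply: half_sum_le; apply: dotp_mul_le => //; exact: wB.
- rewrite rate_on; apply: (@le_trans _ _ (C2 * `|z| ^+ 2)); last first.
    by rewrite ler_wpM2r// exprn_ge0.
  have dz : `|drift t u z - df t u| <= (1 + n%:R) * K * `|z|.
    have -> : drift t u z - df t u = (f t (xb t + z) u - f t (xb t) u) - (f_x f t (xb t) (ub t))^T *m z.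
      by rewrite /drift /df opprB addrAC addrA addrNK addrAC.
    apply: le_trans (ler_normB _ _) _; rewrite -mulrA mulrDl mul1r lerD//.
      have := f_lipschitz L0 hS2 (xb t + z) (xb t) u tT.
      by rewrite [xb t + z - _]addrC addKr.
    apply: le_trans (mulmx_le _ _) _; rewrite ler_wpM2l// ler_wpM2r//.
    by rewrite (le_trans (trmx_le _))//; exact: (f_x_bounded L0 hS2).
  have h1 : `|H t (xb t + z) u (psi t) - H t (xb t) u (psi t) - dotp (Hx t u) z|
      <= n%:R * KH * `|z| ^+ 2 by apply: (H_taylor L0 hS2 hS3) => //; exact: pQ.
  have h3 : `|2^-1 * (dotp (W t *m z) (drift t u z - df t u)
      + dotp ((W t)^T *m z) (drift t u z - df t u))|
      <= n%:R * (n%:R * B * ((1 + n%:R) * K)) * `|z| ^+ 2.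
    have -> : n%:R * (n%:R * B * ((1 + n%:R) * K)) * `|z| ^+ 2 =
        n%:R * (n%:R * (B * `|z|) * ((1 + n%:R) * K * `|z|)) by ring.
    by apply: half_sum_le; apply: dotp_mul_le => //; exact: wB.
  apply: le_trans (ler_normD _ _) _; rewrite /C2 mulrDl lerD//.
  by apply: le_trans (ler_normB _ _) _; rewrite mulrDl lerD.
- apply: (@le_trans _ _ (C3 * `|z| ^+ 2)); last first.
    by rewrite ler_wpM2r// exprn_ge0.
  apply: le_trans (ler_normB _ _) _; rewrite /C3 mulrDl lerD//.
  by apply: (H_taylor L0 hS2 hS3) => //; exact: pQ.
- exact: le_trans (dfb u) l4.
- apply: (@le_trans _ _ C5); last exact: l5.
  have Hb v : `|Hx t v| <= KH by apply: (H_gradient_bounded L0 hS2) => //; exact: pQ.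
  apply: le_trans (ler_normD _ _) _; rewrite lerD//.
    by apply: le_trans (ler_normB _ _) _; rewrite mulr_natl mulr2n lerD.
  have m1 (A : 'M[R]_n) : `|A| <= B -> `|A *m df t u| <= n%:R * (B * C4).
    by move=> AB; apply: le_trans (mulmx_le _ _) _; rewrite ler_wpM2l// ler_pM.
  apply: mx_norm_le => [|i j]; first by nonneg.
  rewrite mxE [X in _ * X]mxE; apply: half_sum_le.
    by apply: le_trans (mx_entry_le_norm _ _ _) _; apply: m1; exact: wB.
  by apply: le_trans (mx_entry_le_norm _ _ _) _; apply: m1.
Qed.

(** Pointwise counterpart of the third bound of [expansion]; the two together feed dominated
    convergence. Dividing [e] by [n.+1] absorbs the factor [n] of [taylor2]. *)
Lemma taylor_rem_small t (e : R) : 0 <= t <= T -> 0 < e ->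
  exists2 d : R, 0 < d & forall z, `|z| < d -> `|taylor_rem t (ub t) z| <= e * `|z| ^+ 2.
Proof.
move=> tT e0.
have en0 : 0 < e / n.+1%:R by rewrite divr_gt0.
have [d d0 Hd] := taylor2 en0 (fun y => H_differentiable hS2 (ub t) (psi t) y tT)
  (fun j => H_partial_differentiable hS2 hS3 j (ub t) (psi t) (xb t) tT).
exists d => // z /Hd.
rewrite /taylor_rem /Hx /Hxx dotp_gradient dotp_hessian => /le_trans; apply.
rewrite ler_wpM2r ?exprn_ge0// mulrCA ler_piMr ?(ltW e0)// ler_pdivrMr// mul1r.
by rewrite ler_nat.
Qed.

End Reference.

(** * Variation of the state *)

Section Variation.
Context {R : realType} {U : metricType R}.
Variables (T : R) (n : nat) (L : R).
Variables (f0 : R -> 'cV[R]_n -> U -> R) (f : R -> 'cV[R]_n -> U -> 'cV[R]_n).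
Local Notation LT := (lebesgueT R).
Hypotheses (T0 : 0 <= T) (L0 : 0 < L) (hS1 : @assumption_S1 R U).
Hypotheses (hS2 : assumption_S2 T f0 f L) (hS3 : assumption_S3 T f0 f L).
Variables (x0 : 'cV[R]_n) (ub : R -> U) (xb psi : R -> 'cV[R]_n) (W : R -> 'M[R]_n).
Hypotheses (mub : U_ad T ub) (sx : is_state T x0 f ub xb).
Hypotheses (sp : is_adjoint T f0 f ub xb psi) (sW : is_second_adjoint T f0 f ub xb psi W).
Local Notation H := (H f0 f).
Local Notation df := (df f ub xb).
Local Notation Hx := (Hx f0 f xb psi).
Local Notation Hxx := (Hxx f0 f ub xb psi).
Local Notation dH := (dH f0 f ub xb psi).
Local Notation bb := (bb f0 f ub xb psi W).
Local Notation taylor_rem := (taylor_rem f0 f ub xb psi).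
Local Notation rate := (rate f0 f ub xb psi W).
Local Notation lmeas g := (measurable_fun (`[0, T]%classic : set LT) (g : LT -> R)).

Let acx : absolutely_continuous 0 T xb := sx.1.1.
Let acp : absolutely_continuous 0 T psi := sp.1.1.
Let acW : absolutely_continuous 0 T W := sW.1.1.

Lemma U_ad_cst (u : U) : U_ad T (fun=> u).
Proof.
move=> B _; have [Bu|Bu] := pselect (B u).
  have -> : `[0, T] `&` (fun=> u) @^-1` B = `[0, T]%classic.
    by apply/seteqP; split => t [].
  exact: measurable_itv_lebesgue.
have -> : `[0, T] `&` (fun=> u) @^-1` B = set0 by rewrite -subset0 => t [].
exact: (@measurable0 _ LT).
Qed.

Lemma H_measurable (v : R -> U) (w : R -> 'cV[R]_n) : U_ad T v ->
  absolutely_continuous 0 T w -> lmeas (fun t => H t (w t) (v t) (psi t)).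
Proof. by move=> mv acw; apply: (H_path_measurable hS1 hS2 mv acp acw). Qed.

Lemma H_partial_path_measurable (v : R -> U) i : U_ad T v ->
  path_measurable T (fun t x => partial i (fun y => H t y (v t) (psi t)) x).
Proof.
move=> mv; apply: (path_measurable_partial (H_path_measurable hS1 hS2 mv acp)).
by move=> t x tT; exact/diff_derivable/(H_differentiable hS2).
Qed.

Lemma Hx_measurable (v : R -> U) i : U_ad T v -> lmeas (fun t => Hx t (v t) i 0).
Proof.
move=> mv.
have -> : (fun t => Hx t (v t) i 0) = (fun t => partial i (fun y => H t y (v t) (psi t)) (xb t)).
  by apply/funext => t; rewrite mxE.
exact: (H_partial_path_measurable i mv acx).
Qed.

Lemma Hxx_measurable i j : lmeas (fun t => Hxx t i j).
Proof.
have -> : (fun t => Hxx t i j) =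
    (fun t => partial i (partial j (fun y => H t y (ub t) (psi t))) (xb t)).
  by apply/funext => t; rewrite mxE.
apply: (path_measurable_partial (H_partial_path_measurable j mub) _ acx).
by move=> t x tT; exact/diff_derivable/(H_partial_differentiable hS2 hS3).
Qed.

Lemma f_measurable (v : R -> U) (w : R -> 'cV[R]_n) i : U_ad T v ->
  absolutely_continuous 0 T w -> lmeas (fun t => f t (w t) (v t) i 0).
Proof.
move=> mv acw.
have -> : (fun t => f t (w t) (v t) i 0) = (fun t => bf f0 f (rshift 1 i) t (w t) (v t)).
  by apply/funext => t; rewrite bf_state.
exact: (bf_path_measurable hS1 hS2 _ mv acw).
Qed.

Lemma f0_measurable (v : R -> U) (w : R -> 'cV[R]_n) : U_ad T v ->
  absolutely_continuous 0 T w -> lmeas (fun t => f0 t (w t) (v t)).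
Proof.
move=> mv acw.
have -> : (fun t => f0 t (w t) (v t)) = (fun t => bf f0 f (lshift n 0) t (w t) (v t)).
  by apply/funext => t; rewrite bf_cost.
exact: (bf_path_measurable hS1 hS2 _ mv acw).
Qed.

Lemma dH_measurable u : lmeas (dH ^~ u).
Proof.
by apply: measurable_funB; [exact: (H_measurable (U_ad_cst u) acx) | exact: (H_measurable mub acx)].
Qed.

Lemma df_measurable u i : lmeas (fun t => df t u i 0).
Proof.
have -> : (fun t => df t u i 0) = (fun t => f t (xb t) u i 0 - f t (xb t) (ub t) i 0).
  by apply/funext => t; rewrite mxE [X in _ + X]mxE.
by apply: measurable_funB; [exact: (f_measurable i (U_ad_cst u) acx) | exact: (f_measurable i mub acx)].
Qed.

Lemma bb_entry t u i : bb t u i 0 = Hx t u i 0 - Hx t (ub t) i 0 +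
  2^-1 * (\sum_(j < n) W t i j * df t u j 0 + \sum_(j < n) W t j i * df t u j 0).
Proof.
rewrite mxE; congr (_ + _); first by rewrite mxE [X in _ + X]mxE.
rewrite mxE mxE; congr (_ * (_ + _)); first by rewrite mxE.
by rewrite mxE; apply: eq_bigr => j _; rewrite mxE.
Qed.

Lemma bb_measurable u (a : 'cV[R]_n) : lmeas (fun t => dotp (bb t u) a).
Proof.
apply: measurable_sum => i; apply: measurable_funM; last exact: measurable_cst.
have -> : (fun t => bb t u i 0) = (fun t => Hx t u i 0 - Hx t (ub t) i 0 +
  2^-1 * (\sum_(j < n) W t i j * df t u j 0 + \sum_(j < n) W t j i * df t u j 0)).
  by apply/funext => t; exact: bb_entry.
apply: measurable_funD.
  by apply: measurable_funB; [exact: (Hx_measurable i (U_ad_cst u)) | exact: Hx_measurable].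
apply: measurable_funM; first exact: measurable_cst.
apply: measurable_funD; apply: measurable_sum => j;
  by apply: measurable_funM; [apply: ac_measurable; exact: ac_coord | exact: df_measurable].
Qed.

Lemma taylor_rem_measurable (z : R -> 'cV[R]_n) : absolutely_continuous 0 T z ->
  absolutely_continuous 0 T (fun t => xb t + z t) ->
  lmeas (fun t => taylor_rem t (ub t) (z t)).
Proof.
move=> acz acxz.
have mz i : lmeas (fun t => z t i 0) by apply: ac_measurable; exact: ac_coord.
apply: measurable_funB; [apply: measurable_funB; [apply: measurable_funB|]|].
- exact: (H_measurable mub acxz).
- exact: (H_measurable mub acx).
- by apply: measurable_sum => i; apply: measurable_funM; [exact: Hx_measurable | exact: mz].
apply: measurable_funM; first exact: measurable_cst.
apply: measurable_sum => i; apply: measurable_funM; last exact: mz.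
have -> : (fun t => (Hxx t *m z t) i 0) = (fun t => \sum_(j < n) Hxx t i j * z t j 0).
  by apply/funext => t; rewrite mxE.
apply: measurable_sum => j; apply: measurable_funM; [exact: Hxx_measurable | exact: mz].
Qed.

Lemma dH_continuous t : 0 <= t <= T -> continuous (dH t).
Proof.
move=> tT u; apply: cvgB; last exact: cvg_cst.
exact: (H_continuous_control hS2).
Qed.

Lemma df_continuous t i : 0 <= t <= T -> continuous (fun u => df t u i 0).
Proof.
move=> tT u.
have E w : df t w i 0 = bf f0 f (rshift 1 i) t (xb t) w - f t (xb t) (ub t) i 0.
  by rewrite mxE [X in _ + X]mxE bf_state.
rewrite /continuous_at E; under eq_fun do rewrite E.
by apply: cvgB; [exact: (bf_continuous_control hS2) | exact: cvg_cst].
Qed.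

Lemma bb_continuous t (a : 'cV[R]_n) : 0 <= t <= T -> continuous (fun u => dotp (bb t u) a).
Proof.
move=> tT.
(* Moving the matrices onto [a] leaves a linear combination of scalar functions of [u] already known
   to be continuous. *)
have -> : (fun u => dotp (bb t u) a) = (fun u =>
    (\sum_(i < n) a i 0 * partial i (fun y => H t y u (psi t)) (xb t)
     + \sum_(i < n) (2^-1 *: ((W t)^T *m a + W t *m a)) i 0 * df t u i 0) - dotp (Hx t (ub t)) a).
  apply/funext => u; rewrite /bb dotpDl dotpBl dotpZl dotpDl addrAC; congr (_ - _); congr (_ + _).
    by apply: eq_bigr => i _; rewrite mxE mulrC.
  rewrite !dotp_mull trmxK -dotpDr -dotpZr dotpC; exact: eq_bigr.
have c1 := @continuous_lincomb R U n (fun i => a i 0)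
  (fun i w => partial i (fun y => H t y w (psi t)) (xb t))
  (fun i => H_partial_continuous_control L0 hS2 hS3 tT).
have c2 := @continuous_lincomb R U n (fun i => (2^-1 *: ((W t)^T *m a + W t *m a)) i 0)
  (fun i w => df t w i 0) (fun i => @df_continuous t i tT).
move=> u; apply: cvgB; last exact: cvg_cst.
by apply: cvgD; [exact: (c1 u) | exact: (c2 u)].
Qed.

Variables (v : R -> U) (y : R -> 'cV[R]_n).
Hypotheses (mv : U_ad T v) (sy : is_state T x0 f v y).
Let z t := y t - xb t.

(** The running costs appear as primitives so that they can be differentiated; their values at [T]
    are the total costs. *)
Definition lyapunov t : R := dotp (psi t) (z t) + 2^-1 * dotp (W t *m z t) (z t)
  - (prim (fun s => f0 s (y s) (v s)) t - prim (fun s => f0 s (xb s) (ub s)) t).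

Lemma cost_prim_derive (v' : R -> U) (y' : R -> 'cV[R]_n) : U_ad T v' ->
  absolutely_continuous 0 T y' ->
  ac_derive T (prim (fun s => f0 s (y' s) (v' s))) (fun s => f0 s (y' s) (v' s)).
Proof.
move=> mv' acy'; have [B B0 yB] := ac_bounded acy'.
apply: (@prim_ac_derive R T (system_cst n L * (1 + B))) => //; first exact: f0_measurable.
move=> t tT; rewrite -(bf_cost _ f); apply: le_trans (bf_bounded L0 hS2 _ _ _ tT) _.
by rewrite ler_wpM2l ?(system_cst_ge0 _ L0)// lerD2l; exact: yB.
Qed.

Lemma variation_derive : mx_ac_derive T z (fun t => f t (y t) (v t) - f t (xb t) (ub t)).
Proof.
exact: (mx_ac_deriveB (caratheodory_mx_ac_derive sy.1) (caratheodory_mx_ac_derive sx.1)).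
Qed.

(** The equation of [psi] assembles the linear terms and the costs into [H] minus its first order
    part. In the equation of [W], [H_xx] supplies the second order part of the Taylor remainder, and
    the two products with [fx] remove the linearization from [F], leaving [drift]. *)
Lemma lyapunov_derive_identity t : 0 <= t <= T ->
  let F := f t (y t) (v t) - f t (xb t) (ub t) in
  let fx := f_x f t (xb t) (ub t) in
  dotp (- (fx *m psi t) + f0_x f0 t (xb t) (ub t)) (z t) + dotp (psi t) F
  + 2^-1 * (dotp (- (fx *m W t + W t *m fx^T + Hxx t) *m z t + W t *m F) (z t)
            + dotp (W t *m z t) F)
  - (f0 t (y t) (v t) - f0 t (xb t) (ub t)) = rate t (v t) (z t).
Proof.
move=> tT F fx.
have yE : xb t + z t = y t by rewrite /z addrC subrK.
have -> : - (fx *m psi t) + f0_x f0 t (xb t) (ub t) = - Hx t (ub t).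
  by rewrite /Hx (H_xE hS2 _ _ _ tT) opprB addrC.
rewrite /rate /taylor_rem /drift yE -/F -/fx /H.
rewrite -/(Hx t (ub t)).
have -> : dotp (f t (y t) (v t)) (psi t) - f0 t (y t) (v t)
    - (dotp (f t (xb t) (ub t)) (psi t) - f0 t (xb t) (ub t)) =
    dotp (psi t) F - (f0 t (y t) (v t) - f0 t (xb t) (ub t)).
  by rewrite /F dotpBr !(dotpC (psi t)); ring.
move: F (z t) (Hx t (ub t)) (Hxx t) => F z' h hh.
rewrite mulNmx !mulmxDl !dotpDl !dotpNl !dotpDl !dotpBr -!mulmxA.
have -> : dotp (fx *m (W t *m z')) z' = dotp (W t *m z') (fx^T *m z') by rewrite dotp_mull.
have -> : dotp (W t *m (fx^T *m z')) z' = dotp ((W t)^T *m z') (fx^T *m z').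
  by rewrite dotp_mull dotpC.
have -> : dotp (W t *m F) z' = dotp ((W t)^T *m z') F by rewrite dotp_mull dotpC.
by field.
Qed.

Lemma lyapunov_derive : ac_derive T lyapunov (fun t => rate t (v t) (z t)).
Proof.
have dz := variation_derive.
have dp := caratheodory_mx_ac_derive sp.1.
have dW := caratheodory_mx_ac_derive sW.1.
have D1 := ac_derive_dotp dp dz.
have D2 := ac_deriveZ 2^-1 (ac_derive_dotp (mx_ac_deriveM dW dz) dz).
have D3 := ac_deriveB (cost_prim_derive mv sy.1.1) (cost_prim_derive mub acx).
have [acl dl] := ac_deriveB (ac_deriveD D1 D2) D3; split => //.
apply: ae_imply dl => t Ht tT; have {}Ht := Ht tT.
rewrite -lyapunov_derive_identity//; move: tT => /andP[t0 tT].
by rewrite (ltW t0) (ltW tT).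
Qed.

Lemma variation0 : z 0 = 0.
Proof. by rewrite /z sx.2 sy.2 subrr. Qed.

Lemma lyapunov0 : lyapunov 0 = 0.
Proof.
rewrite /lyapunov variation0 mulmx0 !prim0.
have d0 (a : 'cV[R]_n) : dotp a 0 = 0 by rewrite /dotp big1// => i _; rewrite mxE mulr0.
by rewrite !d0 mulr0 subrr addr0 subr0.
Qed.

Lemma lyapunovT : lyapunov T = cost T f0 ub xb - cost T f0 v y.
Proof.
rewrite /lyapunov sp.2 sW.2 mul0mx.
have d0 (a : 'cV[R]_n) : dotp 0 a = 0 by rewrite /dotp big1// => i _; rewrite mxE mul0r.
by rewrite !d0 mulr0 addr0 sub0r opprB.
Qed.

End Variation.

(** The arithmetic of [rate_on_needle]. Half of the gain [al * c] pays for the error [eta] in the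
    direction; the errors that do not scale with [al] are collected in the bracket. *)
Lemma needle_arith (R : realFieldType) (r d b1 b2 b3 q1 q2 nC k al eta c eps : R) :
  `|r - d - b1| <= q1 -> q1 <= q2 -> `|b3| <= nC * (eta * al + k) ->
  b1 = al * b2 + b3 -> al * c <= al * b2 -> nC * eta * al <= c / 2 * al ->
  - eps <= d -> c / 2 * al - (eps + nC * k + q2) <= r.
Proof.
rewrite !ler_norml => /andP[? ?] ? /andP[? ?] ? ? ? ?.
have ? : nC * (eta * al + k) = nC * eta * al + nC * k by ring.
have ? : al * c = c * al by ring.
lra.
Qed.

(** * Needle variations *)

Section Needle.
Context {R : realType} {U : metricType R}.
Variables (T : R) (n : nat) (L : R).
Variables (f0 : R -> 'cV[R]_n -> U -> R) (f : R -> 'cV[R]_n -> U -> 'cV[R]_n).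
Local Notation LT := (lebesgueT R).
Hypotheses (T0 : 0 <= T) (L0 : 0 < L) (hS1 : @assumption_S1 R U).
Hypotheses (hS2 : assumption_S2 T f0 f L) (hS3 : assumption_S3 T f0 f L).
Variables (x0 : 'cV[R]_n) (ub : R -> U) (xb psi : R -> 'cV[R]_n) (W : R -> 'M[R]_n).
Hypotheses (mub : U_ad T ub) (sx : is_state T x0 f ub xb).
Hypotheses (sp : is_adjoint T f0 f ub xb psi) (sW : is_second_adjoint T f0 f ub xb psi W).
Local Notation K := (system_cst n L).
Local Notation df := (df f ub xb).
Local Notation dH := (dH f0 f ub xb psi).
Local Notation bb := (bb f0 f ub xb psi W).
Local Notation taylor_rem := (taylor_rem f0 f ub xb psi).
Local Notation rate := (rate f0 f ub xb psi W).

Variable C : R.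
Hypothesis C0 : 0 <= C.
Hypothesis CP : forall t, 0 <= t <= T ->
  [/\ (forall z, `|rate t (ub t) z - taylor_rem t (ub t) z| <= C * `|z| ^+ 3),
      (forall u z, `|rate t u z - dH t u - dotp (bb t u) z| <= C * `|z| ^+ 2),
      (forall z, `|taylor_rem t (ub t) z| <= C * `|z| ^+ 2),
      (forall u, `|df t u| <= C) &
      (forall u, `|bb t u| <= C)].

Variables (A : set R) (v : R -> U) (y : R -> 'cV[R]_n).
Variables (a : 'cV[R]_n) (c eta eps s0 h : R).
Hypotheses (mA : measurable (A : set LT)) (mv : U_ad T v) (sy : is_state T x0 f v y).
Hypothesis vA : forall t, ~ A t -> v t = ub t.
Hypothesis A_dH : forall t, A t -> - eps <= dH t (v t).
Hypothesis A_df : forall t i, A t -> `|df t (v t) i 0 - a i 0| <= eta.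
Hypothesis A_bb : forall t, A t -> c <= dotp (bb t (v t)) a.
Hypotheses (s00 : 0 <= s0) (s0T : s0 <= T) (h0 : 0 <= h).
Hypothesis A_sub : forall t, A t -> s0 <= t <= s0 + h.
Hypotheses (eta0 : 0 <= eta) (eps0 : 0 <= eps) (c0 : 0 <= c).
Hypothesis eta_small : n%:R * C * eta <= c / 2.

(* [needle_time t] is the Lebesgue measure of [A] up to time [t]. *)
Definition needle_ind (t : R) : R := \1_A t.
Definition needle_time : R -> R := prim needle_ind.
Local Notation ind := needle_ind.
Local Notation alpha := needle_time.
Local Notation z := (fun t => y t - xb t).

Lemma needle_ind_on t : A t -> ind t = 1.
Proof. by move=> At; rewrite /needle_ind indicE mem_set. Qed.

Lemma needle_ind_off t : ~ A t -> ind t = 0.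
Proof. by move=> At; rewrite /needle_ind indicE memNset. Qed.

Lemma needle_ind_ge0 t : 0 <= ind t.
Proof. by rewrite /needle_ind indicE. Qed.

Lemma needle_ind_le1 t : ind t <= 1.
Proof. by rewrite /needle_ind indicE lern1; case: (_ \in _). Qed.

Lemma needle_ind_measurable : measurable_fun (`[0, T]%classic : set LT) (ind : LT -> R).
Proof. exact: (@measurable_indic _ LT R `[0, T]%classic A mA). Qed.

Lemma needle_time_derive : ac_derive T alpha ind.
Proof.
apply: (@prim_ac_derive R T 1) => //; first exact: needle_ind_measurable.
by move=> t _; rewrite ger0_norm ?needle_ind_ge0// needle_ind_le1.
Qed.

Lemma needle_time0 : alpha 0 = 0.
Proof. exact: prim0. Qed.

Lemma needle_time_nd s t : 0 <= s -> s <= t -> t <= T -> alpha s <= alpha t.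
Proof.
move=> s0' st tT; apply: (ac_derive_nondecreasing needle_time_derive s0' st tT).
by apply: aeW => r _; exact: needle_ind_ge0.
Qed.

Lemma needle_time_ge0 t : 0 <= t <= T -> 0 <= alpha t.
Proof. by move=> /andP[t0 tT]; rewrite -needle_time0; exact: needle_time_nd. Qed.

Lemma needle_time_start : alpha s0 = 0.
Proof.
apply/eqP; rewrite eq_le needle_time_ge0 ?s00// andbT.
have D := ac_deriveZ (-1) needle_time_derive.
have := ac_derive_nondecreasing D (lexx 0) s00 s0T.
rewrite needle_time0 mulr0 mulN1r oppr_ge0; apply; apply: aeW => r /andP[_ rs].
rewrite needle_ind_off ?mulr0// => /A_sub/andP[s0r _].
by move: (le_lt_trans s0r rs); rewrite ltxx.
Qed.

(** The Gronwall factor at time [T] times the bound [C] on [df]. *)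
Definition variation_cst : R := 2 * expR (2 * K * T) * C.
Local Notation C1 := variation_cst.

Lemma variation_cst_ge0 : 0 <= C1.
Proof. by rewrite /variation_cst !mulr_ge0// expR_ge0. Qed.

(** The controls differ only on [A], so beyond the Lipschitz term the velocity of [z] is at most
    [C * ind], whose primitive is [C * alpha]. *)
Lemma variation_le t : 0 <= t <= T -> `|z t| <= C1 * alpha t.
Proof.
move=> tT; have K0 : 0 <= K by exact: system_cst_ge0.
have acz : absolutely_continuous 0 T z.
  exact: (acB sy.1.1 sx.1.1).
have dza := ac_deriveZ C needle_time_derive.
have := gronwall K0 acz (variation_derive sx sy) (variation0 sx sy) dza.
rewrite needle_time0 mulr0 => /(_ erefl) G.
have {G} := G _ _ t tT.
rewrite /variation_cst mulrA => G; apply: (le_trans (G _ _)) => [s sT|s i sT|].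
- by rewrite mulr_ge0// needle_ind_ge0.
- apply: le_trans (mx_entry_le_norm _ _ _) _.
  have E : f s (y s) (v s) - f s (xb s) (ub s) = (f s (y s) (v s) - f s (xb s) (v s)) + df s (v s).
    by rewrite /df addrA subrK.
  rewrite E; apply: le_trans (ler_normD _ _) _; apply: lerD.
    exact: (f_lipschitz L0 hS2).
  have [As|nAs] := pselect (A s).
    by rewrite needle_ind_on// mulr1; have [_ _ _ + _] := CP sT; apply.
  by rewrite needle_ind_off// mulr0 vA// /df subrr normr0.
- have K20 : 0 <= 2 * K by exact: mulr_ge0.
  rewrite ler_wpM2r ?needle_time_ge0// ler_wpM2r// ler_wpM2l// ler_expR ler_wpM2l ?K20//.
  by move: tT => /andP[].
Qed.

Local Notation av := (alpha T).

Lemma variation_leT t : 0 <= t <= T -> `|z t| <= C1 * av.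
Proof.
move=> /andP[t0 tT]; apply: le_trans (variation_le _) _; first by rewrite t0.
by rewrite ler_wpM2l ?variation_cst_ge0//; exact: needle_time_nd.
Qed.

(** The velocity of [z] differs from [ind s *: a] by at most [eta] on [A], plus a Lipschitz term
    [K * (C1 * av)] that acts for a time at most [h]. Since [z] vanishes at [s0], the second
    contribution is [O(h |A|)], however [A] is distributed in the interval. *)
Lemma variation_direction t : s0 <= t -> t <= s0 + h -> t <= T ->
  `|z t - alpha t *: a| <= eta * alpha t + K * (C1 * av) * h.
Proof.
move=> st th tT; have K0 : 0 <= K by exact: system_cst_ge0.
have t0 : 0 <= t by exact: le_trans st.
have av0 : 0 <= C1 * av by rewrite mulr_ge0 ?variation_cst_ge0// needle_time_ge0// T0 lexx.
have k0 : 0 <= K * (C1 * av) by rewrite mulr_ge0.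
have at0 : 0 <= alpha t by rewrite needle_time_ge0// t0.
apply: mx_norm_le => [|i j]; first by rewrite addr_ge0// mulr_ge0.
rewrite (ord1 j) mxE [X in _ + X]mxE [X in _ - X]mxE.
have dz := variation_derive sx sy i 0.
have da := needle_time_derive.
have d1 := ac_deriveD (ac_deriveZ eta da) (ac_deriveZ (K * (C1 * av)) (ac_derive_id T)).
have d2 := ac_deriveB dz (ac_deriveZ (a i 0) da).
have Fle s : s0 < s < t ->
    `|(f s (y s) (v s) - f s (xb s) (ub s)) i 0 - a i 0 * ind s| <= eta * ind s + K * (C1 * av) * 1.
  move=> /andP[s0s ss]; have sT : 0 <= s <= T.
    by rewrite (le_trans s00 (ltW s0s)) (le_trans (ltW ss) tT).
  have h1 : `|(f s (y s) (v s) - f s (xb s) (v s)) i 0| <= K * (C1 * av).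
    apply: le_trans (mx_entry_le_norm _ _ _) _.
    apply: le_trans (f_lipschitz L0 hS2 _ _ _ sT) _.
    by rewrite ler_wpM2l//; exact: variation_leT.
  have -> : (f s (y s) (v s) - f s (xb s) (ub s)) i 0 - a i 0 * ind s =
      (df s (v s) i 0 - a i 0 * ind s) + (f s (y s) (v s) - f s (xb s) (v s)) i 0.
    by rewrite /df !mxE; ring.
  rewrite mulr1; apply: le_trans (ler_normD _ _) _; apply: lerD => //.
  have [As|nAs] := pselect (A s).
    by rewrite needle_ind_on// !mulr1; exact: A_df.
  by rewrite needle_ind_off// !mulr0 subr0 vA// /df subrr mxE normr0.
have zs0 : z s0 = 0.
  apply/eqP; rewrite -normr_le0; apply: le_trans (variation_le _) _; first by rewrite s00.
  by rewrite needle_time_start mulr0.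
have zi0 : z s0 i 0 = 0 by rewrite zs0 mxE.
have h1 := ac_derive_nondecreasing (ac_deriveB d1 d2) s00 st tT.
have h2 := ac_derive_nondecreasing (ac_deriveD d1 d2) s00 st tT.
move: h1 h2; rewrite zi0 needle_time_start !mulr0 subrr add0r subr0 addr0 => h1 h2.
have {}h1 : K * (C1 * av) * s0 <= eta * alpha t + K * (C1 * av) * t - (z t i 0 - a i 0 * alpha t).
  by apply: h1; apply: aeW => s /Fle; rewrite ler_norml => /andP[? ?]; lra.
have {}h2 : K * (C1 * av) * s0 <= eta * alpha t + K * (C1 * av) * t + (z t i 0 - a i 0 * alpha t).
  by apply: h2; apply: aeW => s /Fle; rewrite ler_norml => /andP[? ?]; lra.
have h3 : K * (C1 * av) * (t - s0) <= K * (C1 * av) * h by rewrite ler_wpM2l// lerBlDl.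
move: h1 h2 h3; rewrite mulrBr (mulrC (a i 0)) !mxE; move: (K * (C1 * av)) => k h1 h2 h3.
by rewrite ler_norml; apply/andP; split; lra.
Qed.

Lemma taylor_rem_bounded t : 0 <= t <= T ->
  `|taylor_rem t (ub t) (z t)| <= C * (C1 * av) ^+ 2.
Proof.
move=> tT; have [_ _ /(_ (z t)) H _ _] := CP tT; apply: le_trans H _.
have av0 : 0 <= C1 * av by rewrite mulr_ge0 ?variation_cst_ge0// needle_time_ge0// T0 lexx.
by rewrite ler_wpM2l// ler_pXn2r ?nnegrE//; exact: variation_leT.
Qed.

(** Bounds the error of the rate at every point of [A]: tolerance in the Hamiltonian, error in the
    direction, quadratic remainder. Integrated over [A] it acquires a factor [av]. *)
Definition needle_slope : R := eps + n%:R * C * (K * (C1 * av) * h) + C * (C1 * av) ^+ 2.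

Lemma rate_on_needle t : 0 <= t <= T -> A t ->
  c / 2 * alpha t - needle_slope <= rate t (v t) (z t).
Proof.
move=> tT At; have [_ /(_ (v t) (z t)) H2 _ _ /(_ (v t)) H5] := CP tT.
have av0 : 0 <= C1 * av by rewrite mulr_ge0 ?variation_cst_ge0// needle_time_ge0// T0 lexx.
have at0 : 0 <= alpha t by exact: needle_time_ge0.
have h1 : C * `|z t| ^+ 2 <= C * (C1 * av) ^+ 2.
  by rewrite ler_wpM2l// ler_pXn2r ?nnegrE//; exact: variation_leT.
have h2 : `|dotp (bb t (v t)) (z t - alpha t *: a)| <=
    n%:R * C * (eta * alpha t + K * (C1 * av) * h).
  apply: le_trans (dotp_le _ _) _; rewrite -mulrA ler_wpM2l// ler_pM//.
  by have /andP[st sh] := A_sub At; apply: variation_direction => //; move: tT => /andP[].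
have h3 : dotp (bb t (v t)) (z t) =
    alpha t * dotp (bb t (v t)) a + dotp (bb t (v t)) (z t - alpha t *: a).
  by rewrite -dotpZr -dotpDr [_ *: a + _]addrC subrK.
have h4 : alpha t * c <= alpha t * dotp (bb t (v t)) a by rewrite ler_wpM2l// A_bb.
have h5 : n%:R * C * eta * alpha t <= c / 2 * alpha t by rewrite ler_wpM2r.
have h6 := A_dH At.
exact: needle_arith H2 h1 h2 h3 h4 h5 h6.
Qed.

Lemma rate_off_needle t : 0 <= t <= T -> ~ A t ->
  - `|taylor_rem t (ub t) (z t)| - C * (C1 * av) ^+ 3 <= rate t (v t) (z t).
Proof.
move=> tT nAt; rewrite vA//; have [/(_ (z t)) H1 _ _ _ _] := CP tT.
have av0 : 0 <= C1 * av by rewrite mulr_ge0 ?variation_cst_ge0// needle_time_ge0// T0 lexx.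
have h1 : C * `|z t| ^+ 3 <= C * (C1 * av) ^+ 3.
  by rewrite ler_wpM2l// ler_pXn2r ?nnegrE//; exact: variation_leT.
have h2 := ler_norm (- taylor_rem t (ub t) (z t)); rewrite normrN in h2.
move: H1 h1 h2; move: (rate _ _ _) (taylor_rem _ _ _) (C * _ ^+ 3) (C * _ ^+ 3).
move=> r1 r2 r3 r4; rewrite ler_norml => /andP[? ?] ? ?; lra.
Qed.

(** Division by [av ^+ 2] makes the integrand bounded by [C * C1 ^+ 2], a constant independent of
    the needle. *)
Definition needle_error : R :=
  prim (fun t => `|taylor_rem t (ub t) (z t)| / av ^+ 2) T.

Lemma taylor_rem_path_measurable :
  measurable_fun (`[0, T]%classic : set LT) ((fun t => taylor_rem t (ub t) (z t)) : LT -> R).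
Proof.
apply: (taylor_rem_measurable hS1 hS2 hS3 mub sx sp); first exact: (acB sy.1.1 sx.1.1).
have -> : (fun t => xb t + z t) = y by apply/funext => t; rewrite addrC subrK.
exact: sy.1.1.
Qed.

(** [lyapunov] minus [c / 4 * alpha ^+ 2], plus primitives of all error terms, is nondecreasing. The
    constant is [c / 4] because the square of [alpha] has derivative [2 * alpha * ind], which
    matches the gain [c / 2 * alpha] on [A]. *)
Lemma needle_comparison : 0 < av -> cost T f0 ub xb <= cost T f0 v y ->
  c / 4 * av ^+ 2 <= needle_slope * av + av ^+ 2 * needle_error + C * (C1 * av) ^+ 3 * T.
Proof.
move=> av_gt0 min.
have av2 : 0 < av ^+ 2 by rewrite exprn_gt0.
have drem : ac_derive T (prim (fun t => `|taylor_rem t (ub t) (z t)| / av ^+ 2))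
    (fun t => `|taylor_rem t (ub t) (z t)| / av ^+ 2).
  apply: (@prim_ac_derive R T (C * (C1 * av) ^+ 2 / av ^+ 2)) => //.
    apply: measurable_funM; last exact: measurable_cst.
    by apply: measurableT_comp => //; exact: taylor_rem_path_measurable.
  move=> t tT; rewrite normrM normr_id gtr0_norm ?invr_gt0// ler_wpM2r ?invr_ge0 ?(ltW av2)//.
  exact: taylor_rem_bounded.
have da := needle_time_derive.
have d1 := ac_deriveZ (c / 4) (ac_deriveM da da).
have d2 := ac_deriveZ needle_slope da.
have d3 := ac_deriveZ (av ^+ 2) drem.
have d4 := ac_deriveZ (C * (C1 * av) ^+ 3) (ac_derive_id T).
have dl := lyapunov_derive T0 L0 hS1 hS2 mub sx sp sW mv sy.
have D := ac_deriveD (ac_deriveD (ac_deriveD (ac_deriveB dl d1) d2) d3) d4.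
have l0 : lyapunov f0 ub xb psi W v y 0 = 0.
  by eapply lyapunov0; [exact: sx | exact: sy].
have lT : lyapunov f0 ub xb psi W v y T = cost T f0 ub xb - cost T f0 v y.
  by eapply lyapunovT; [exact: sp | exact: sW].
have := ac_derive_nondecreasing D (lexx 0) T0 (lexx T).
rewrite needle_time0 l0 prim0 !mulr0 !addr0 subr0.
rewrite lT -/needle_error => H.
have {}H : 0 <= cost T f0 ub xb - cost T f0 v y - c / 4 * (av * av)
    + needle_slope * av + av ^+ 2 * needle_error + C * (C1 * av) ^+ 3 * T.
  apply: H; apply: aeW => t /andP[t0 tT].
  have tT' : 0 <= t <= T by rewrite (ltW t0) (ltW tT).
  have -> : av ^+ 2 * (`|taylor_rem t (ub t) (z t)| / av ^+ 2) = `|taylor_rem t (ub t) (z t)|.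
    by rewrite mulrC divfK// gt_eqF.
  have C3 : 0 <= C * (C1 * av) ^+ 3.
    by rewrite mulr_ge0// exprn_ge0// mulr_ge0 ?variation_cst_ge0// ltW.
  have [At|nAt] := pselect (A t).
    have := rate_on_needle tT' At; rewrite needle_ind_on// !mulr1 !mul1r.
    move: C3 (normr_ge0 (taylor_rem t (ub t) (z t))).
    move: (rate _ _ _) `|_| (C * _ ^+ 3) needle_slope (alpha t) => r1 r2 r3 r4 r5 ? ? ?; lra.
  have := rate_off_needle tT' nAt; rewrite needle_ind_off//.
  by move: (rate _ _ _) `|_| (C * _ ^+ 3) needle_slope (alpha t) => r1 r2 r3 r4 r5 ?; lra.
have E : c / 4 * av ^+ 2 = c / 4 * (av * av) by rewrite expr2.
rewrite E; move: H min.
move: (cost _ _ _ _) (cost _ _ _ _) (c / 4 * _) (needle_slope * _) (_ * needle_error) (_ * T).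
by move=> *; lra.
Qed.

(** After division by [av ^+ 2], the four terms come from the tolerance [eps], the direction, the
    quadratic remainder on [A] and the cubic one off [A], each reduced to a multiple of [h] by
    [eps <= h * av] or [av <= h] where needed. *)
Definition needle_cst : R :=
  1 + n%:R * C * (K * C1) + C * C1 ^+ 2 + C * C1 ^+ 3 * T.

Theorem needle_estimate : 0 < av -> av <= h -> eps <= h * av ->
  cost T f0 ub xb <= cost T f0 v y ->
  c / 4 <= needle_cst * h + needle_error.
Proof.
move=> av_gt0 avh epsh /(needle_comparison av_gt0) H.
have av2 : 0 < av ^+ 2 by rewrite exprn_gt0.
have K0 : 0 <= K by exact: system_cst_ge0.
have C10 := variation_cst_ge0.
rewrite -(ler_pM2r av2); apply: le_trans H _.
rewrite /needle_slope /needle_cst.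
have e1 : eps * av <= h * av ^+ 2 by rewrite expr2 mulrA ler_wpM2r ?(ltW av_gt0).
have m1 : 0 <= C * C1 ^+ 2 * av ^+ 2 * (h - av).
  by rewrite mulr_ge0 ?subr_ge0// mulr_ge0 ?exprn_ge0 ?(ltW av_gt0)// mulr_ge0 ?exprn_ge0.
have m2 : 0 <= C * C1 ^+ 3 * T * av ^+ 2 * (h - av).
  by rewrite mulr_ge0 ?subr_ge0// mulr_ge0 ?exprn_ge0 ?(ltW av_gt0)// mulr_ge0// mulr_ge0 ?exprn_ge0.
rewrite -subr_ge0; set D := (X in 0 <= X).
have -> : D = (h * av ^+ 2 - eps * av) + C * C1 ^+ 2 * av ^+ 2 * (h - av)
    + C * C1 ^+ 3 * T * av ^+ 2 * (h - av).
  by rewrite /D; ring.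
by apply: addr_ge0 => //; apply: addr_ge0 => //; rewrite subr_ge0.
Qed.

End Needle.

(** * Negligibility of the cells *)

Section Cells.
Context {R : realType} {U : metricType R}.
Local Notation LT := (lebesgueT R).
Local Notation mu := (@completed_lebesgue_measure R).

Lemma prim_cvg0 (T C : R) (g : nat -> R -> R) : 0 <= T ->
  (forall k, measurable_fun (`[0, T]%classic : set LT) (g k : LT -> R)) ->
  (forall k t, 0 <= t <= T -> `|g k t| <= C) ->
  (forall t, 0 <= t <= T -> g ^~ t @ \oo --> 0) ->
  (fun k => prim (g k) T) @ \oo --> 0.
Proof.
move=> T0 mg gC g0.
pose D : set LT := `[0, T]%classic.
have mD : measurable D by exact: measurable_itv_lebesgue.
have C0 : 0 <= C by rewrite (le_trans _ (gC 0%N 0 _))// lexx.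
have mf k : measurable_fun D (fun t => (g k t)%:E) by exact/measurable_EFinP/mg.
have f_f : {ae mu, forall t, D t -> (fun k => (g k t)%:E) @ \oo --> (cst 0%E : LT -> \bar R) t}.
  apply: aeW => t; rewrite /D/= in_itv/= => /g0 h.
  by apply: cvg_EFin; [exact: nearW | exact: h].
have DT : D `<=` `[0, T]%classic by [].
have iC : mu.-integrable D (cst C%:E).
  exact: (@bounded_integrable R D T (cst C) C mD DT (measurable_cst _)
    (fun t _ => eq_ind_r (fun x => x <= C) (lexx C) (ger0_norm C0))).
have f_g : {ae mu, forall t k, D t -> (`|(g k t)%:E| <= (cst C%:E : LT -> \bar R) t)%E}.
  by apply: aeW => t k; rewrite /D/= in_itv/= => /(gC k); rewrite lee_fin.
have [_ _] := dominated_convergence mD mf (measurable_cst _) f_f iC f_g.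
rewrite integral0 => H; exact: (fine_cvg H).
Qed.

(** The last time at which no measure of [P] has accumulated: every interval to its right meets [P]
    in positive measure, so short needles can all start there. *)
Lemma needle_start (T : R) (P : set R) : 0 <= T -> measurable (P : set LT) ->
  0 < needle_time P T ->
  exists s0, [/\ 0 <= s0, s0 < T, needle_time P s0 = 0 &
    forall s, s0 < s -> s <= T -> 0 < needle_time P s].
Proof.
move=> T0 mP PT; have dP := needle_time_derive T0 mP.
pose S := [set s | 0 <= s <= T /\ needle_time P s = 0].
have S0 : S 0 by split; [rewrite lexx | exact: needle_time0].
have hS : has_sup S by split; [exists 0 | exists T => s [/andP[]]].
have s00 : 0 <= sup S by exact: sup_upper_bound.
have s0T : sup S <= T by apply: ge_sup; [exists 0 | move=> s [/andP[]]].
have Ps0 : needle_time P (sup S) = 0.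
  apply/eqP; rewrite eq_le (needle_time_ge0 T0 mP) ?s00// andbT.
  apply/ler_addgt0Pr => e e0; rewrite add0r.
  have [s [/andP[s0 sT] Ps] es] := sup_adherent e0 hS.
  have sS : s <= sup S by apply: sup_upper_bound => //; split => //; rewrite s0.
  (* Accumulated measure grows at most at unit speed, so it still vanishes at the supremum of its
     zeros. *)
  have := ac_derive_nondecreasing (ac_deriveB (ac_derive_id T) dP) s0 sS s0T.
  rewrite Ps subr0 => H; have {}H : s <= sup S - needle_time P (sup S).
    by apply: H; apply: aeW => r _; rewrite subr_ge0 needle_ind_le1.
  by move: H es; lra.
exists (sup S); split => //.
  by rewrite lt_neqAle s0T andbT; apply: contraTneq PT => <-; rewrite Ps0 ltxx.
move=> s Ss sT; have s0 : 0 <= s by exact: le_trans (ltW Ss).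
rewrite lt_neqAle (needle_time_ge0 T0 mP) ?s0// andbT eq_sym.
apply/eqP => Ps; have : s <= sup S by apply: sup_upper_bound => //; split => //; rewrite s0.
by rewrite leNgt Ss.
Qed.

Variables (T : R) (n : nat) (L : R).
Variables (f0 : R -> 'cV[R]_n -> U -> R) (f : R -> 'cV[R]_n -> U -> 'cV[R]_n).
Hypotheses (T0 : 0 <= T) (L0 : 0 < L) (hS1 : @assumption_S1 R U).
Hypotheses (hS2 : assumption_S2 T f0 f L) (hS3 : assumption_S3 T f0 f L).
Variables (x0 : 'cV[R]_n) (ub : R -> U) (xb psi : R -> 'cV[R]_n) (W : R -> 'M[R]_n).
Hypotheses (mub : U_ad T ub) (sx : is_state T x0 f ub xb).
Hypotheses (sp : is_adjoint T f0 f ub xb psi) (sW : is_second_adjoint T f0 f ub xb psi W).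
Hypothesis minJ : forall v y, U_ad T v -> is_state T x0 f v y ->
  cost T f0 ub xb <= cost T f0 v y.
Local Notation df := (df f ub xb).
Local Notation dH := (dH f0 f ub xb psi).
Local Notation bb := (bb f0 f ub xb psi W).
Local Notation taylor_rem := (taylor_rem f0 f ub xb psi).
Local Notation rate := (rate f0 f ub xb psi W).

Variable C : R.
Hypothesis C0 : 0 <= C.
Hypothesis CP : forall t, 0 <= t <= T ->
  [/\ (forall z, `|rate t (ub t) z - taylor_rem t (ub t) z| <= C * `|z| ^+ 3),
      (forall u z, `|rate t u z - dH t u - dotp (bb t u) z| <= C * `|z| ^+ 2),
      (forall z, `|taylor_rem t (ub t) z| <= C * `|z| ^+ 2),
      (forall u, `|df t u| <= C) &
      (forall u, `|bb t u| <= C)].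
Variables (d : nat -> U) (a : 'cV[R]_n) (c eta : R).
Hypotheses (c_gt0 : 0 < c) (eta0 : 0 <= eta) (eta_small : n%:R * C * eta <= c / 2).

(** The inequalities are strict, hence open in the control: if they hold at some [v] they hold at a
    nearby term of the dense sequence. *)
Definition admissible (k j : nat) (t : R) : Prop :=
  [/\ - k.+1%:R^-1 < dH t (d j), \sum_(i < n) `|df t (d j) i 0 - a i 0| < eta &
      c < dotp (bb t (d j)) a].

(* Only almost maximizers of the Hamiltonian, with [k] arbitrarily large, can be
   taken from the dense sequence [d]. *)
Definition cell : set R := \bigcap_k \bigcup_j (`[0, T]%classic `&` [set t | admissible k j t]).

Lemma cell_itv t : cell t -> 0 <= t <= T.
Proof. by move=> /(_ 0%N I)[j _ [+ _]]; rewrite /= in_itv. Qed.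

Lemma admissible_measurable k j :
  measurable (`[0, T]%classic `&` [set t | admissible k j t] : set LT).
Proof.
have mI := @measurable_itv_lebesgue R `[0, T].
have m1 : measurable (`[0, T]%classic `&` (dH ^~ (d j)) @^-1` `]- k.+1%:R^-1, +oo[%classic : set LT).
  exact: (dH_measurable hS1 hS2 mub sx sp).
have m2 : measurable (`[0, T]%classic `&`
    (fun t => \sum_(i < n) `|df t (d j) i 0 - a i 0|) @^-1` `]-oo, eta[%classic : set LT).
  have : measurable_fun (`[0, T]%classic : set LT)
      ((fun t => \sum_(i < n) `|df t (d j) i 0 - a i 0|) : LT -> R).
    apply: measurable_sum => i; apply: measurableT_comp => //.
    apply: measurable_funB; last exact: measurable_cst.
    exact: (df_measurable hS1 hS2 mub sx).
  by apply => //; exact: measurable_itv.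
have m3 : measurable (`[0, T]%classic `&` (fun t => dotp (bb t (d j)) a) @^-1` `]c, +oo[%classic : set LT).
  exact: (bb_measurable hS1 hS2 mub sx sp sW).
have -> : `[0, T]%classic `&` [set t | admissible k j t] =
  (`[0, T]%classic `&` (dH ^~ (d j)) @^-1` `]- k.+1%:R^-1, +oo[%classic) `&`
  (`[0, T]%classic `&` (fun t => \sum_(i < n) `|df t (d j) i 0 - a i 0|) @^-1` `]-oo, eta[%classic) `&`
  (`[0, T]%classic `&` (fun t => dotp (bb t (d j)) a) @^-1` `]c, +oo[%classic).
  apply/seteqP; split => t.
    move=> [It [h1 h2 h3]]; split; [split; split => //|split => //];
      by rewrite /= in_itv/= ?h1 ?h2 ?h3.
  move=> [[[It +] [_ +]] [_ +]]; rewrite /= !in_itv/= !andbT => h1 h2 h3.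
  by split.
by apply: measurableI => //; exact: measurableI.
Qed.

Lemma cell_measurable : measurable (cell : set LT).
Proof.
apply: bigcapT_measurable => k; apply: bigcupT_measurable => j.
exact: admissible_measurable.
Qed.

Let C1 := variation_cst T n L C.

(** Hides the needle and its state, keeping of the normalized remainder [g] only what dominated
    convergence needs. *)
Lemma needle_exists (s0 h : R) : 0 <= s0 -> 0 < h -> s0 + h <= T ->
  needle_time cell s0 = 0 -> 0 < needle_time cell (s0 + h) ->
  exists g : R -> R,
    [/\ measurable_fun (`[0, T]%classic : set LT) (g : LT -> R),
        (forall t, 0 <= t <= T -> exists z (av : R),
           [/\ 0 < av, av <= h, `|z| <= C1 * av & g t = `|taylor_rem t (ub t) z| / av ^+ 2]) &
        c / 4 <= needle_cst T n L C * h + prim g T].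
Proof.
move=> s00 h0 shT Ps0 Psh.
have mP := cell_measurable; have dP := needle_time_derive T0 mP.
pose A := cell `&` `[s0, s0 + h]%classic.
have mA : measurable (A : set LT).
  by apply: measurableI => //; exact: measurable_itv_lebesgue.
have A_sub t : A t -> s0 <= t <= s0 + h by move=> [_]; rewrite /= in_itv.
have s0sh : s0 <= s0 + h by rewrite lerDl ltW.
have s0T : s0 <= T by exact: le_trans shT.
have sh0 : 0 <= s0 + h by exact: le_trans s0sh.
have dA := needle_time_derive T0 mA.
have As0 : needle_time A s0 = 0 by exact: (needle_time_start T0 mA s00 s0T A_sub).
have av_gt0 : 0 < needle_time A T.
  apply: lt_le_trans (needle_time_nd T0 mA sh0 shT (lexx T)).
  have := ac_derive_nondecreasing (ac_deriveB dA dP) s00 s0sh shT.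
  rewrite As0 Ps0 subrr subr_ge0 => H; apply: lt_le_trans Psh (H _).
  apply: aeW => t /andP[st ts]; rewrite subr_ge0.
  have [Pt|nPt] := pselect (cell t); last by rewrite (needle_ind_off nPt) needle_ind_ge0.
  rewrite (needle_ind_on Pt) needle_ind_on//; split => //.
  by rewrite /= in_itv/= (ltW st) (ltW ts).
have avh : needle_time A T <= h.
  have h1 : needle_time A T <= needle_time A (s0 + h).
    have := ac_derive_nondecreasing (ac_deriveZ (-1) dA) sh0 shT (lexx T).
    rewrite !mulN1r lerN2; apply; apply: aeW => t /andP[st _].
    rewrite needle_ind_off ?mulr0// => /A_sub/andP[_ ts].
    by move: (lt_le_trans st ts); rewrite ltxx.
  have := ac_derive_nondecreasing (ac_deriveB (ac_derive_id T) dA) s00 s0sh shT.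
  rewrite As0 subr0 => H; have {}H : s0 <= s0 + h - needle_time A (s0 + h).
    by apply: H; apply: aeW => r _; rewrite subr_ge0 needle_ind_le1.
  by move: H h1; lra.
have ha : 0 < h * needle_time A T by rewrite mulr_gt0.
(* The tolerance is chosen once the measure of [A] is known, to meet the condition [eps <= h * av]
   of [needle_estimate]; a cell offers every tolerance. *)
have [l] : exists l : nat, (l.+1%:R^-1 : R) < h * needle_time A T.
  have [N _ HN] := near_infty_natSinv_lt (PosNum ha).
  by exists N; apply: HN => /=.
move=> lha.
have exP t : A t -> exists j, admissible l j t.
  by move=> [/(_ l I)[j _ [_ /= Hj]] _]; exists j.
pose v t := if t \in A then d (first_index (admissible l) t) else ub t.
have v_on t : A t -> v t = d (first_index (admissible l) t) by move=> At; rewrite /v mem_set.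
have v_off t : ~ A t -> v t = ub t by move=> At; rewrite /v memNset.
have vP t : A t -> [/\ - l.+1%:R^-1 < dH t (v t),
    \sum_(i < n) `|df t (v t) i 0 - a i 0| < eta & c < dotp (bb t (v t)) a].
  by move=> At; rewrite v_on//; have [] := first_indexP (exP t At).
have mv : U_ad T v.
  move=> B mB.
  have -> : `[0, T]%classic `&` v @^-1` B =
      ((`[0, T]%classic `&` ub @^-1` B) `\` A) `|`
      \bigcup_(j in [set j | B (d j)]) (A `&` [set t | first_index (admissible l) t = j]).
    apply/seteqP; split => [t [It Bt]|t].
      have [At|nAt] := pselect (A t); last first.
        by left; split => //; split => //; rewrite /preimage/= -v_off.
      right; exists (first_index (admissible l) t) => //.
      by rewrite /= -v_on.
    move=> [[[It Bt] nAt]|[j /= Bj [At /= jt]]].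
      by split => //; rewrite /preimage/= v_off.
    split; first by have /cell_itv := At.1; rewrite /= in_itv.
    by rewrite /preimage/= v_on// jt.
  apply: (@measurableU _ LT).
    by apply: (@measurableD _ LT) => //; exact: mub.
  apply: bigcup_measurable => j _; apply: measurable_first_index => // i.
  have -> : A `&` [set t | admissible l i t] =
      A `&` (`[0, T]%classic `&` [set t | admissible l i t]).
    apply/seteqP; split => t; last by move=> [? []].
    move=> [At Ht]; split => //; split => //.
    by have /cell_itv := At.1; rewrite /= in_itv.
  by apply: measurableI => //; exact: admissible_measurable.
have [y sy] := state_exists L0 hS1 hS2 x0 T0 mv.
have est := @needle_estimate R U T n L f0 f T0 L0 hS1 hS2 hS3 x0 ub xb psi W mub sx sp sW C C0 CP
  A v y a c eta l.+1%:R^-1 s0 h mA mv sy v_off.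
exists (fun t => `|taylor_rem t (ub t) (y t - xb t)| / needle_time A T ^+ 2); split.
- apply: measurable_funM; last exact: measurable_cst.
  by apply: measurableT_comp => //; exact: (taylor_rem_path_measurable hS1 hS2 hS3 mub sx sp sy).
- move=> t tT; exists (y t - xb t), (needle_time A T); split => //.
  exact: (variation_leT T0 L0 hS2 sx C0 CP mA sy v_off).
- apply: est => //.
  + by move=> t /vP[/ltW].
  + move=> t i /vP[_ /ltW Hs _]; apply: le_trans Hs.
    by rewrite (bigD1 i)//= lerDl sumr_ge0.
  + by move=> t /vP[_ _ /ltW].
  + exact: ltW.
  + exact: ltW.
  + exact: minJ.
Qed.

Lemma cell_negligible : mu.-negligible cell.
Proof.
have mP := cell_measurable.
have cellT : cell `<=` `[0, T]%classic by move=> t /cell_itv; rewrite /= in_itv.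
have PE : needle_time cell T = fine (mu cell).
  rewrite /needle_time /prim /Rintegral; congr fine.
  rewrite integral_indic ?setIidl//; exact: measurable_itv_lebesgue.
have fin : mu cell \is a fin_num.
  rewrite ge0_fin_numE//; apply: (@le_lt_trans _ _ (mu (`[0, T]%classic : set LT))).
    by apply: le_measure; rewrite ?inE//; exact: measurable_itv_lebesgue.
  by rewrite completed_measure_itv// ltry.
have [P0|Pn0] := eqVneq (needle_time cell T) 0.
  by exists cell; split => //; apply/eqP; rewrite -(fineK fin) -PE P0.
have PT : 0 < needle_time cell T.
  by rewrite lt_neqAle eq_sym Pn0 (needle_time_ge0 T0 mP)// T0 lexx.
exfalso.
have [s0 [s00 s0T Ps0 Ps]] := needle_start T0 mP PT.
(* Needle lengths tending to 0, the first one reaching [T]. *)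
pose h k : R := (T - s0) / k.+1%:R.
have h0 k : 0 < h k by rewrite divr_gt0// subr_gt0.
have hT k : s0 + h k <= T.
  rewrite -lerBrDl /h ler_pdivrMr// ler_peMr ?ler1n// subr_ge0 ltW//.
have sh k : s0 < s0 + h k by rewrite ltrDl.
have ex k := needle_exists s00 (h0 k) (hT k) Ps0 (Ps _ (sh k) (hT k)).
pose g k := projT1 (cid (ex k)).
have mg k : measurable_fun (`[0, T]%classic : set LT) (g k : LT -> R).
  by rewrite /g; case: cid => ? [].
have gz k t : 0 <= t <= T -> exists z (av : R),
    [/\ 0 < av, av <= h k, `|z| <= C1 * av & g k t = `|taylor_rem t (ub t) z| / av ^+ 2].
  by rewrite /g; case: cid => ? /= [_ + _]; apply.
have ge k : c / 4 <= needle_cst T n L C * h k + prim (g k) T.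
  by rewrite /g; case: cid => ? [].
have C10 : 0 <= C1 by rewrite /C1 variation_cst_ge0.
(* Since [z] is at most [C1 * av], the factor [av ^+ 2] cancels. This yields both the dominating
   constant and the pointwise limit. *)
have gsmall k t (e : R) : 0 <= t <= T -> 0 <= e ->
    (forall z, `|z| <= C1 * h k -> `|taylor_rem t (ub t) z| <= e * `|z| ^+ 2) ->
    `|g k t| <= e * C1 ^+ 2.
  move=> tT e0 He; have [z [av [av0 avh zav ->]]] := gz k t tT.
  have av2 : 0 < av ^+ 2 by rewrite exprn_gt0.
  rewrite normrM normr_id gtr0_norm ?invr_gt0// ler_pdivrMr//.
  apply: le_trans (He z _) _; first by rewrite (le_trans zav)// ler_wpM2l.
  rewrite -mulrA -exprMn ler_wpM2l// ler_pXn2r ?nnegrE//.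
  by rewrite mulr_ge0// ltW.
have gC k t : 0 <= t <= T -> `|g k t| <= C * C1 ^+ 2.
  by move=> tT; apply: gsmall => // z _; have [_ _ + _ _] := CP tT; apply.
have hcvg : h @ \oo --> 0.
  rewrite -[X in _ --> X](mulr0 (T - s0)); apply: cvgM; first exact: cvg_cst.
  exact: cvg_harmonic.
have g0 t : 0 <= t <= T -> g ^~ t @ \oo --> 0.
  move=> tT; apply/cvgr0Pnorm_le => e e0.
  have c2 : 0 < C1 ^+ 2 + 1 by rewrite ltr_wpDl ?sqr_ge0.
  have e'0 : 0 < e / (C1 ^+ 2 + 1) by rewrite divr_gt0.
  have [r r0 Hr] := taylor_rem_small hS2 hS3 ub xb psi tT e'0.
  have hr : 0 < r / (C1 + 1) by rewrite divr_gt0// ltr_wpDl.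
  near=> k.
  apply: le_trans (gsmall k t (e / (C1 ^+ 2 + 1)) tT (ltW e'0) _) _.
    move=> z zh; apply: Hr; apply: le_lt_trans zh _.
    have hk : h k < r / (C1 + 1).
      rewrite -[ltLHS]gtr0_norm//; near: k.
      by move/cvgr0Pnorm_lt : hcvg; apply.
    rewrite (@le_lt_trans _ _ ((C1 + 1) * h k))//.
      by rewrite ler_wpM2r ?lerDl// ltW.
    by rewrite mulrC -ltr_pdivlMr// ltr_wpDl.
  rewrite mulrAC ler_pdivrMr// ler_wpM2l ?(ltW e0)// lerDl//.
have lim0 : (fun k => needle_cst T n L C * h k + prim (g k) T) @ \oo --> 0.
  rewrite -[X in _ --> X](addr0 0) -[X in X + _](mulr0 (needle_cst T n L C)).
  apply: cvgD; first by apply: cvgM; [exact: cvg_cst | exact: hcvg].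
  exact: (prim_cvg0 T0 mg gC g0).
have : c / 4 <= 0 by apply: (cvgr_to_ge lim0); apply: nearW => k; exact: ge.
by rewrite leNgt divr_gt0.
Unshelve. all: by end_near. Qed.

End Cells.

(** * Covering the exceptional times by countably many cells *)

Lemma rational_vector_dense (R : realType) n (x : 'cV[R]_n) (e : R) : 0 < e ->
  exists q : 'cV[rat]_n, forall i, `|x i 0 - ratr (q i 0)| < e.
Proof.
move=> e0.
have ex i : exists q : rat, `|x i 0 - ratr q| < e.
  have : x i 0 - e < x i 0 + e by lra.
  move=> /rat_in_itvoo[q]; rewrite in_itv/= => /andP[h1 h2]; exists q.
  by rewrite ltr_norml; apply/andP; split; lra.
exists (\col_i projT1 (cid (ex i))) => i; rewrite mxE.
by case: cid.
Qed.

Theorem theorem4p3 (R : realType) (T : R) (n : nat) (x0 : 'cV[R]_n)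
    (U : metricType R)
    (f0 : R -> 'cV[R]_n -> U -> R) (f : R -> 'cV[R]_n -> U -> 'cV[R]_n)
    (L : R) (ubar : R -> U) (xbar psibar : R -> 'cV[R]_n)
    (Wbar : R -> 'M[R]_n) :
  0 < T -> (1 <= n)%N -> 0 < L ->
  @assumption_S1 R U ->
  assumption_S2 T f0 f L ->
  assumption_S3 T f0 f L ->
  @polish R U ->
  is_minimizer T x0 f0 f ubar ->
  is_state T x0 f ubar xbar ->
  is_adjoint T f0 f ubar xbar psibar ->
  is_second_adjoint T f0 f ubar xbar psibar Wbar ->
  {ae completed_lebesgue_measure, forall t : R, t \in `[0, T] ->
    forall v : U, Ubar f0 f xbar psibar t v ->
    dotp (Wbar t *m (f t (xbar t) (ubar t) - f t (xbar t) v)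
          + H_x f0 f t (xbar t) (ubar t) (psibar t)
          - H_x f0 f t (xbar t) v (psibar t))
         (f t (xbar t) (ubar t) - f t (xbar t) v) <= 0}.
Proof.
move=> T_gt0 n1 L0 hS1 hS2 hS3 _ [mub minJ] sx sp sW.
have T0 : 0 <= T by exact: ltW.
have [C C0 CP] := expansion L0 hS2 hS3 ubar sx.1.1 sp.1.1 sW.1.1.
have [d Hd] := separable_sequence (ubar 0) hS1.
have NC : 0 <= n%:R * C by rewrite mulr_ge0.
pose c (m : nat) : R := m.+1%:R^-1.
(* Chosen so that [n%:R * C * eta m <= c m / 2]; the summand 1 keeps the denominator positive. *)
pose eta m : R := c m / (2 * (n%:R * C + 1)).
have c0 m : 0 < c m by rewrite invr_gt0.
have nc2 : 0 < 2 * (n%:R * C + 1) by rewrite mulr_gt0// ltr_wpDl.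
have eta0 m : 0 < eta m by rewrite divr_gt0.
have etas m : n%:R * C * eta m <= c m / 2.
  rewrite /eta mulrA ler_pdivrMr//; have := c0 m; move: (n%:R * C) (c m) NC => q r; nra.
pose N (p : 'cV[rat]_n * nat) := cell T f0 f ubar xbar psibar Wbar d
  (map_mx ratr p.1) (c p.2) (eta p.2).
(* One cell per rational direction and threshold, enumerated by their codes; numbers that code
   nothing give the empty set. *)
pose NN i := if (unpickle i : option ('cV[rat]_n * nat)%type) is Some p then N p else set0.
have nN : completed_lebesgue_measure.-negligible (\bigcup_i NN i).
  apply: negligible_bigcup => i; rewrite /NN; case: unpickle => [p|].
    apply: (@cell_negligible R U T n L f0 f T0 L0 hS1 hS2 hS3 x0 ubar xbar psibar Wbar
      mub sx sp sW _ C C0 CP) => //; last exact: ltW.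
    by move=> v y mv sy; exact: minJ.
  exact: negligible_set0.
apply: negligibleS nN => t /= nt; apply: contrapT => tN; apply: nt.
rewrite in_itv/= => tT v vU.
set target := dotp _ _.
pose df0 := df f ubar xbar t v; pose b0 := bb f0 f ubar xbar psibar Wbar t v.
(* Both factors change sign, and [W] and its transpose have the same quadratic form, so the average
   in [bb] contributes the single [W] of the statement. *)
have targetE : target = dotp b0 df0.
  rewrite /target /b0 /bb -/df0.
  have -> : f t (xbar t) (ubar t) - f t (xbar t) v = - df0 by rewrite /df0 /df opprB.
  rewrite -/(Hx f0 f xbar psibar t (ubar t)) -/(Hx f0 f xbar psibar t v).
  move: (Hx _ _ _ _ _ _) (Hx _ _ _ _ _ _) (df0) => h1 h2 e.
  rewrite mulmxN dotpNr !dotpDl !dotpNl dotpZl dotpDl.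
  have -> : dotp ((Wbar t)^T *m e) e = dotp (Wbar t *m e) e.
    by rewrite dotp_mull trmxK dotpC.
  by field.
rewrite leNgt; apply/negP; rewrite targetE => tgt.
(* Twice [c m] is still below the violation, so replacing [df0] by the rational direction [a], at a
   cost of at most [c m / 2], leaves more than [c m]. *)
have [m mc] : exists m, c m < dotp b0 df0 / 2.
  have tgt2 : 0 < dotp b0 df0 / 2 by rewrite divr_gt0.
  have [M _ HM] := near_infty_natSinv_lt (PosNum tgt2).
  by exists M; apply: HM => /=.
have en0 : 0 < eta m / n.+1%:R by rewrite divr_gt0.
have [q Hq] := rational_vector_dense df0 en0.
pose a : 'cV[R]_n := map_mx ratr q.
have aq i : `|df0 i 0 - a i 0| < eta m / n.+1%:R by rewrite [a i 0]mxE; exact: Hq.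
have sum_a : \sum_(i < n) `|df0 i 0 - a i 0| < eta m.
  apply: (@le_lt_trans _ _ (\sum_(i < n) eta m / n.+1%:R)).
    by apply: ler_sum => i _; exact: ltW.
  rewrite sumr_const card_ord; move: (eta m) (eta0 m) => r r0.
  by rewrite -[_ *+ n]mulr_natr mulrAC ltr_pdivrMr// ltr_pM2l// ltr_nat.
have ba : c m < dotp b0 a.
  have h1 : `|df0 - a| <= eta m.
    apply: mx_norm_le => [|i j]; first exact: ltW.
    rewrite (ord1 j) mxE [X in _ + X]mxE (le_trans (ltW (aq i)))//.
    by rewrite ler_pdivrMr// ler_peMr ?ler1n// ltW.
  have [_ _ _ _ /(_ v) bC] := CP t tT.
  have h2 : `|dotp b0 (df0 - a)| <= n%:R * C * eta m.
    by apply: le_trans (dotp_le _ _) _; rewrite -mulrA ler_wpM2l// ler_pM.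
  have h3 : dotp b0 df0 = dotp b0 a + dotp b0 (df0 - a) by rewrite -dotpDr addrC subrK.
  have := etas m; have := c0 m; move: mc h2 h3; rewrite ler_norml.
  move: (c m) (dotp b0 df0) (dotp b0 a) (dotp b0 _) (n%:R * C * _) => r1 r2 r3 r4 r5.
  by move=> ? /andP[? ?] ? ? ?; lra.
apply: tN; exists (pickle (q, m)) => //; rewrite /NN pickleK /N /= => k _.
(* The constant sequence [fun=> u], read at index 0, turns [admissible] into a condition on a single
   control value. *)
pose V := [set u | admissible f0 f ubar xbar psibar Wbar (fun=> u) a (c m) (eta m) k 0%N t].
have Vv : nbhs v V.
  have h1 : \forall u \near v, - k.+1%:R^-1 < dH f0 f ubar xbar psibar t u.
    have dv : - k.+1%:R^-1 < dH f0 f ubar xbar psibar t v.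
      (* Membership in [Ubar] enters here: [v] does at least as well as [ubar t], so its jump is
         nonnegative. *)
      by rewrite (@lt_le_trans _ _ 0) ?oppr_lt0 ?invr_gt0// subr_ge0; exact: vU.
    have cd : continuous (dH f0 f ubar xbar psibar t) by exact: (dH_continuous hS2 tT).
    exact: (cvgr_gt _ (cd v) _ dv).
  have h2 : \forall u \near v, \sum_(i < n) `|df f ubar xbar t u i 0 - a i 0| < eta m.
    have cs : continuous (fun u => \sum_(i < n) 1 * `|df f ubar xbar t u i 0 - a i 0|).
      apply: continuous_lincomb => i u; apply: cvg_norm; apply: cvgB; last exact: cvg_cst.
      exact: (df_continuous hS2 tT).
    have : \forall u \near v, \sum_(i < n) 1 * `|df f ubar xbar t u i 0 - a i 0| < eta m.
      apply: (cvgr_lt _ (cs v)); move: sum_a; congr (_ < _).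
      by apply: eq_bigr => i _; rewrite mul1r.
    apply: filterS => u; congr (_ < _); apply: eq_bigr => i _; by rewrite mul1r.
  have h3 : \forall u \near v, c m < dotp (bb f0 f ubar xbar psibar Wbar t u) a.
    have cb : continuous (fun u => dotp (bb f0 f ubar xbar psibar Wbar t u) a).
      exact: (bb_continuous L0 hS2 hS3 tT).
    exact: (cvgr_gt _ (cb v) _ ba).
  by apply: filterS3 h1 h2 h3 => u u1 u2 u3; split.
have [j Vj] : exists j, V (d j).
  have [||j Hj] := Hd V°; [exact: open_interior | by exists v | ].
  by exists j; exact: interior_subset.
have tI : `[0, T]%classic t by rewrite /= in_itv.
exact: (ex_intro2 _ _ j I (conj tI Vj)).
Qed.
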